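(* Let $d=(d_i)$ be smooth with $d_i(u)\ge c_0>0$ for all $u\in\overline{\mathbb{R}}_+^N$, $1\le i\le N$, and suppose that the symmetric matrix $P(u)=(p_{ij}(u))$, $$p_{ij}(u)=\left(\frac{\partial d_i}{\partial u_j}(u)+\frac{\partial d_j}{\partial u_i}(u)\right)u_iu_j+\left(\delta_{ij}d_i(u)u_j+\delta_{ji}d_j(u)u_i\right),$$ is positive semidefinite for every $u\in\overline{\mathbb{R}}_+^N$ (here $\delta_{ij}$ is the Kronecker delta). Assume that $d$ is bounded above and below by positive constants: there are constants $\delta,C>0$ such that $\delta\le d_i(u)\le C$ for all $u\in\overline{\mathbb{R}}_+^N$, $1\le i\le N$. Let $f=(f_i):\overline{\mathbb{R}}_+^N\to\mathbb{R}^N$ be locally Lipschitz continuous and satisfy, for some constant $C>0$ and all $u=(u_i)\in\overline{\mathbb{R}}_+^N$, $1\le i\le N$: - (quasi-positivity) $f_i(u_1,\dots,u_{i-1},0,u_{i+1},\dots,u_N)\ge 0$; - (total mass dissipation) $\sum_{i} f_i(u)\le 0$; - (quadratic growth) $|f(u)|\le C(1+|u|^2)$ and $\dfrac{\partial f_i}{\partial u_i}(u)\ge -C(1+|u|)$. Let $u=(u_i(x,t))$ be the positive classical solution on $\Omega\times[0,T)$, $0<T<\infty$, of the quasilinear reaction diffusion system $$\tau_i\frac{\partial u_i}{\partial t}-\Delta\left(d_i(u)u_i\right)=f_i(u)\ \text{ in }\Omega\times(0,T),\quad \frac{\partial}{\partial\nu}\left(d_i(u)u_i\right)=0\ \text{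 on }\partial\Omega\times(0,T),\quad u_i|_{t=0}=u_i^0\ \text{ in }\Omega,\qquad 1\le i\le N.$$ Then there is a constant $C_T<\infty$ such that $$\sup_{0\le t<T}\|u(\cdot,t)\|_{L\log L}\le C_T.$$
   Context: $\Omega\subset\mathbb{R}^n$ is a bounded domain with smooth boundary $\partial\Omega$, $\nu$ is the outer unit normal vector, $\tau=(\tau_i)\in\mathbb{R}_+^N$ has positive entries, and $u_0=(u_i^0(x))\not\equiv 0$, $u_i^0\ge 0$, is a sufficiently smooth initial value. $\overline{\mathbb{R}}_+^N=\{u\in\mathbb{R}^N: u_i\ge 0,\ 1\le i\le N\}$. A unique positive classical solution exists locally in time; $T$ denotes the (finite) time up to which it is considered, and may be the maximal existence time. $\|\cdot\|_{L\log L}$ is the standard norm of the Zygmund space $L\log L(\Omega)$ (applied to vector-valued functions componentwise); a bound on it is equivalent to a bound on $\int_\Omega |u|\log(1+|u|)\,dx$. Since $f$ is only locally Lipschitz, $\partial f_i/\partial u_i$ is understood at the points where it exists. $C_T$ is a constant depending on $T$ (and on the data of the problem). *)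

(* Defs.v *)
From HB Require Import structures.
From mathcomp Require Import all_boot all_order all_algebra.
From mathcomp Require Import all_classical all_reals all_analysis.

Set Implicit Arguments.
Unset Strict Implicit.
Unset Printing Implicit Defensive.

Import Order.TTheory GRing.Theory Num.Theory.
Import numFieldNormedType.Exports.

Local Open Scope classical_set_scope.
Local Open Scope ring_scope.

Lemma product_sigma_finite d1 d2 (T1 : measurableType d1)
    (T2 : measurableType d2) (R : realType)
    (m1 : {sigma_finite_measure set T1 -> \bar R})
    (m2 : {sigma_finite_measure set T2 -> \bar R}) :
  sigma_finite setT (m1 \x m2)%E.
Proof.
have /sigma_finiteP[F [TF ndF Foo]] := sigma_finiteT m1.
have /sigma_finiteP[G [TG ndG Goo]] := sigma_finiteT m2.
exists (fun n => F n `*` G n).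
  rewrite -setXTT TF TG predeqE => -[x y]; split.
    move=> [/= [n _ Fnx] [k _ Gky]]; exists (maxn n k) => //; split.
    - by move: x Fnx; exact/subsetPset/ndF/leq_maxl.
    - by move: y Gky; exact/subsetPset/ndG/leq_maxr.
  by move=> [n _ []/= ? ?]; split; exists n.
move=> k; have [? ?] := Foo k; have [? ?] := Goo k.
split; first exact: measurableX.
by rewrite product_measure1E// lte_mul_pinfty// ge0_fin_numE.
Qed.

(* Lebesgue measure on R^n, by induction on n: the image of the product measure
   on R x R^n under (x, t) |-> x :: t. *)
Section lebesgue_tuple.
Context {R : realType}.
Local Notation T := (measurableTypeR R).

Definition cons_pair n (p : T * n.-tuple T) : n.+1.-tuple T :=
  [the n.+1.-tuple T of p.1 :: p.2].

Lemma measurable_cons_pair n : measurable_fun setT (@cons_pair n).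
Proof. exact: measurable_cons. Qed.

Definition uncons_pair n (t : n.+1.-tuple T) : T * n.-tuple T :=
  (thead t, [tuple of behead t]).

Lemma cons_pairK n : cancel (@cons_pair n) (@uncons_pair n).
Proof. by case=> x t; congr pair; apply/val_inj. Qed.

Lemma measurable_uncons_pair n : measurable_fun setT (@uncons_pair n).
Proof.
apply: measurable_fun_pair; first exact: measurable_tnth.
exact: measurable_behead.
Qed.

Section step.
Variables (n : nat) (mu : {sigma_finite_measure set (n.-tuple T) -> \bar R}).

Definition lebesgue_tuple_step : set (n.+1.-tuple T) -> \bar R :=
  pushforward (lebesgue_measure \x mu)%E (@cons_pair n).

Let measurable_preim A : measurable A -> measurable (@cons_pair n @^-1` A).
Proof. by rewrite -[X in _ -> measurable X]setTI; exact: measurable_cons_pair. Qed.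

Let step0 : lebesgue_tuple_step set0 = 0%E.
Proof. by rewrite /lebesgue_tuple_step /pushforward preimage_set0 measure0. Qed.

Let step_ge0 A : (0 <= lebesgue_tuple_step A)%E.
Proof. by rewrite /lebesgue_tuple_step /pushforward measure_ge0. Qed.

Let step_sigma_additive : semi_sigma_additive lebesgue_tuple_step.
Proof.
move=> F mF tF mUF; rewrite /lebesgue_tuple_step /pushforward preimage_bigcup.
apply: measure_semi_sigma_additive.
- by move=> k; exact: measurable_preim.
- apply/trivIsetP => /= i j _ _ ij; rewrite -preimage_setI.
  by move/trivIsetP : tF => /(_ _ _ _ _ ij) ->//; rewrite preimage_set0.
- by rewrite -preimage_bigcup; exact: measurable_preim.
Qed.

HB.instance Definition _ := isMeasure.Build _ _ _ lebesgue_tuple_step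
  step0 step_ge0 step_sigma_additive.

Let step_sigma_finite : sigma_finite setT lebesgue_tuple_step.
Proof.
have [F TF Foo] := product_sigma_finite lebesgue_measure mu.
exists (fun k => @uncons_pair n @^-1` F k).
  by rewrite -preimage_bigcup -TF preimage_setT.
move=> k; have [mF Fk] := Foo k; split.
  by rewrite -[X in measurable X]setTI; exact: measurable_uncons_pair.
rewrite /lebesgue_tuple_step /pushforward -comp_preimage.
suff -> : @uncons_pair n \o @cons_pair n = id by [].
by apply/funext => p; exact: cons_pairK.
Qed.

HB.instance Definition _ := @Measure_isSigmaFinite.Build _ _ _
  lebesgue_tuple_step step_sigma_finite.
End step.

Fixpoint lebesgue_tuple n : {sigma_finite_measure set (n.-tuple T) -> \bar R} :=
  match n with
  | 0 => \d_([tuple] : 0.-tuple T)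
  | m.+1 => lebesgue_tuple_step (lebesgue_tuple m)
  end.
End lebesgue_tuple.

Section euclidean_space.
Context {R : realType}.

Definition euclidean_norm n (v : 'rV[R]_n) : R :=
  Num.sqrt (\sum_(j < n) v 0 j ^+ 2).

Definition basis_vec n (j : 'I_n) : 'rV[R]_n := delta_mx 0 j.

Definition orthant n : set 'rV[R]_n := [set u | forall j, 0 <= u 0 j].

Definition gradient n (g : 'rV[R]_n -> R) (x : 'rV[R]_n) : 'rV[R]_n :=
  \row_j 'D_(basis_vec j) g x.

Definition laplacian n (g : 'rV[R]_n -> R) (x : 'rV[R]_n) : R :=
  \sum_(j < n) 'D_(basis_vec j) (fun y => 'D_(basis_vec j) g y) x.

(* Directional derivative computed inside A only: one-sided at those boundary
   points of A where the line x + h v leaves A on one side. The values of g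
   outside A are never used. *)
Definition is_derive_in n (A : set 'rV[R]_n) (x v : 'rV[R]_n)
    (g : 'rV[R]_n -> R) (l : R) : Prop :=
  h^-1 * (g (x + h *: v) - g x) @[h --> within [set h | A (x + h *: v)] 0^']
    --> l.

Definition derive_in n (A : set 'rV[R]_n) (x v : 'rV[R]_n)
    (g : 'rV[R]_n -> R) : R :=
  lim (h^-1 * (g (x + h *: v) - g x)
         @[h --> within [set h | A (x + h *: v)] 0^']).

Fixpoint Ck n (U : set 'rV[R]_n) (k : nat) (g : 'rV[R]_n -> R) : Prop :=
  (forall x, U x -> {for x, continuous g}) /\
  if k is m.+1 then
    forall j, (forall x, U x -> derivable g x (basis_vec j)) /\
              Ck U m (fun x => 'D_(basis_vec j) g x)
  else True.

Definition smooth n (U : set 'rV[R]_n) (g : 'rV[R]_n -> R) : Prop :=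
  forall k, Ck U k g.

(* Regularity on a closed set A, up to its boundary: some extension to an open
   neighbourhood of A is regular. *)
Definition Ck_on n (A : set 'rV[R]_n) (k : nat) (g : 'rV[R]_n -> R) : Prop :=
  exists U G, [/\ open U, A `<=` U, Ck U k G & forall x, A x -> G x = g x].

Definition smooth_on n (A : set 'rV[R]_n) (g : 'rV[R]_n -> R) : Prop :=
  exists U G, [/\ open U, A `<=` U, smooth U G & forall x, A x -> G x = g x].

Definition boundary n (A : set 'rV[R]_n) : set 'rV[R]_n :=
  closure A `\` interior A.

Definition local_defining_function n (Om : set 'rV[R]_n) (x0 : 'rV[R]_n)
    (U : set 'rV[R]_n) (rho : 'rV[R]_n -> R) : Prop :=
  [/\ open U /\ U x0, smooth U rho, (forall x, U x -> gradient rho x != 0),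
      U `&` Om = U `&` [set x | rho x < 0] &
      U `&` boundary Om = U `&` [set x | rho x = 0]].

Definition smooth_bounded_domain n (Om : set 'rV[R]_n) : Prop :=
  [/\ open Om, Om !=set0, connected Om, bounded_set Om &
      forall x0, boundary Om x0 ->
        exists U rho, local_defining_function Om x0 U rho].

Definition outer_unit_normal n (Om : set 'rV[R]_n) (x v : 'rV[R]_n) : Prop :=
  exists U rho, local_defining_function Om x U rho /\
    v = (euclidean_norm (gradient rho x))^-1 *: gradient rho x.

Definition psd n (A : 'M[R]_n) : Prop :=
  forall x : 'rV[R]_n, 0 <= (x *m A *m x^T) 0 0.

End euclidean_space.

Section zygmund.
Context {R : realType} {n : nat}.

Definition row_of_tuple (t : n.-tuple (measurableTypeR R)) : 'rV[R]_n :=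
  \row_j tnth t j.

Definition integral_on (Om : set 'rV[R]_n) (g : 'rV[R]_n -> \bar R) : \bar R :=
  (\int[lebesgue_tuple n]_(t in row_of_tuple @^-1` Om) g (row_of_tuple t))%E.

(* Luxemburg norm of L log L(Om) for the Young function s log(1 + s); +oo if g
   does not belong to the space. *)
Definition LlogL_norm (Om : set 'rV[R]_n) (g : 'rV[R]_n -> R) : \bar R :=
  ereal_inf [set l%:E | l in [set l : R | 0 < l /\
    (integral_on Om (fun x => (`|g x| / l * ln (1 + `|g x| / l))%:E) <= 1)%E]].

Definition LlogL_norm_vec (Om : set 'rV[R]_n) N (g : 'rV[R]_n -> 'rV[R]_N)
    : \bar R :=
  (\sum_(i < N) LlogL_norm Om (fun x => g x 0%R i))%E.

End zygmund.

Section reaction_diffusion.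
Context {R : realType}.

Definition P_matrix N (d : 'I_N -> 'rV[R]_N -> R) (u : 'rV[R]_N) : 'M[R]_N :=
  \matrix_(i, j)
    ((derive_in (orthant (n := N)) u (basis_vec j) (d i) +
      derive_in (orthant (n := N)) u (basis_vec i) (d j)) * (u 0 i * u 0 j) +
     ((i == j)%:R * d i u * u 0 j + (j == i)%:R * d j u * u 0 i)).

Definition extends_continuously (X : topologicalType) (A B : set X)
    (g : X -> R) : Prop :=
  exists G : X -> R, {within B, continuous G} /\ forall p, A p -> G p = g p.

Definition cylinder n (A : set 'rV[R]_n) (T : R) : set ('rV[R]_n * R) :=
  [set p | A p.1 /\ 0 < p.2 < T].

(* C^{2,1}(closure Om x (0, T)): the derivatives exist in Om x (0, T) and extend
   continuously to closure Om x (0, T). *)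
Definition C21 n (Om : set 'rV[R]_n) (T : R) (w : 'rV[R]_n -> R -> R) : Prop :=
  let Q := cylinder Om T in
  let ext := extends_continuously Q (cylinder (closure Om) T) in
  let D j x t := 'D_(basis_vec j) (w^~ t) x in
  [/\ ext (fun p => w p.1 p.2),
      (forall p, Q p -> derivable (w p.1) p.2 1) /\
        ext (fun p => derive1 (w p.1) p.2),
      (forall j, (forall p, Q p -> derivable (w^~ p.2) p.1 (basis_vec j)) /\
        ext (fun p => D j p.1 p.2)) &
      (forall j k,
        (forall p, Q p -> derivable ((D j)^~ p.2) p.1 (basis_vec k)) /\
        ext (fun p => 'D_(basis_vec k) ((D j)^~ p.2) p.1))].

Record positive_classical_solution n N (Om : set 'rV[R]_n) (T : R)
    (tau : 'I_N -> R) (d : 'I_N -> 'rV[R]_N -> R) (f : 'rV[R]_N -> 'rV[R]_N)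
    (u0 : 'I_N -> 'rV[R]_n -> R) (u : 'rV[R]_n -> R -> 'rV[R]_N) : Prop := {
  solution_continuous :
    {within [set p : 'rV[R]_n * R | closure Om p.1 /\ 0 <= p.2 < T],
       continuous (fun p => u p.1 p.2)} ;
  solution_C21 : forall i, C21 Om T (fun x t => u x t 0 i) ;
  solution_positive : forall i x t, Om x -> 0 < t < T -> 0 < u x t 0 i ;
  solution_equation : forall i x t, Om x -> 0 < t < T ->
    tau i * derive1 (fun s => u x s 0 i) t
      - laplacian (fun y => d i (u y t) * u y t 0 i) x = f (u x t) 0 i ;
  solution_boundary : forall i x v t,
    boundary Om x -> outer_unit_normal Om x v -> 0 < t < T ->
    is_derive_in (closure Om) x v (fun y => d i (u y t) * u y t 0 i) 0 ;
  solution_initial : forall i x, Om x -> u x 0 0 i = u0 i x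
}.

End reaction_diffusion.

(* Main.v *)
Require Import Defs.
From HB Require Import structures.
From mathcomp Require Import all_boot all_order all_algebra.
From mathcomp Require Import all_classical all_reals all_analysis.
From mathcomp Require Import measurable_realfun.
From mathcomp Require Import ring lra.

Set Implicit Arguments.
Unset Strict Implicit.
Unset Printing Implicit Defensive.

Import Order.TTheory GRing.Theory Num.Theory.
Import numFieldNormedType.Exports.

Local Open Scope classical_set_scope.
Local Open Scope ring_scope.

(** The bound comes from the entropy obtained by testing the i-th equation
against [ln u_i] and adding up: [H = sum_i tau_i int (u_i ln u_i - u_i)].

Diffusion decreases [H].  With [xi = D_j u] the derivative in a space
direction, [- D_j (ln u_i) * D_j (d_i u_i)] summed over [i] is minus
[sum_i d_i xi_i^2 / u_i + sum_(i,k) (D_k d_i) xi_i xi_k], which is half of the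
quadratic form of [P_matrix] at the vector [xi_i / u_i] ([psd_quadratic]).

The reaction contributes [sum_i f_i ln u_i].  Quasi-positivity at [u_i = 0]
and the lower bound on [D_i f_i] give [f_i >= - C (1 + |u|) u_i]
([reaction_lower]); since [sum_i f_i <= 0], the number [ln (1 + |u|)] may be
subtracted from every [ln u_i], and [s (ln (1 + m) - ln s) <= 1 + m] leaves
[C (1 + |u|)^2] ([reaction_bound]).  So [H] stays bounded as soon as [u] is
bounded in [L^2] of space-time.

That [L^2] bound is the classical duality estimate for [w = sum_i tau_i u_i]
and [z = sum_i d_i u_i], which are comparable.  Mass dissipation says
[D_t w <= Laplacian z], hence [w t <= w a + Laplacian (int_a^t z)]; testing
with [z t >= 0] and integrating in time,
[int int w z + 1/2 int |grad int z|^2 <= C int int z], and the mass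
[int w] does not grow ([L2_grid]).

Four points shape the argument.

Time integrals are replaced by Riemann sums on a uniform grid of a compact
interval [[a, b]] inside [(0, T)] with [a = T / 2]: the time derivatives are
uniformly continuous there, so the discretisation errors vanish with the mesh
([time_increment]).  All constants are independent of [b].  On [[0, T / 2]] the
solution is continuous up to the boundary, hence bounded ([early_bound]).

A component may vanish on the boundary of the domain, where [ln u_i] is not an
admissible test function, so [ln (u_i + e)] is used instead.  Its dissipation
has a sign only up to a multiple of [int sum_i e / (u_i + e)]
([degenerate_form]), which tends to [0] with [e] uniformly in time, because
[u_i > 0] inside the domain ([small_layer]).

Green's formula is needed on a domain with smooth boundary.  Fubini and the
fundamental theorem of calculus give it for compactly supported functions; a
partition of unity and a cut-off along the level sets of a local defining
function extend it to fields tangent to the boundary ([divergence_theorem]).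
The one-sided Neumann condition does make [grad (d_i u_i)] tangent
([neumann_tangent]).

Finally, [f] is only locally Lipschitz, so the bound on [D_i f_i] is available
on a line only where the derivative exists.  A Lipschitz function is the
integral of its derivative, which is seen here through the Radon-Nikodym
density of its Stieltjes measure ([lipschitz_derivative_ge]). *)

(** * Lipschitz functions of one variable are integrals of their derivative *)
Section lip.
Context {R : realType}.
Implicit Types (phi psi : R -> R).
Local Notation mu := (@lebesgue_measure R).

Lemma lebesgue_stieltjes_oc (F : cumulative R R) (x y : R) : x <= y ->
  lebesgue_stieltjes_measure F `]x, y] = (F y - F x)%:E.
Proof.
move=> xy; rewrite /lebesgue_stieltjes_measure/= /measure_extension/=.
rewrite measurable_mu_extE//=; last exact: is_ocitv.
by rewrite wlength_itv_bnd.
Qed.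

Lemma lipschitz_continuous phi (K : R) :
  (forall x y, `|phi x - phi y| <= K * `|x - y|) -> continuous phi.
Proof.
move=> lip x; apply/cvgrPdist_lt => e e0; near=> y.
apply: (le_lt_trans (lip x y)).
have K1 : 0 < `|K| + 1 by rewrite ltr_wpDl.
apply: (@le_lt_trans _ _ ((`|K| + 1) * `|x - y|)).
  by rewrite ler_wpM2r// (le_trans (ler_norm K))// lerDl.
rewrite -ltr_pdivlMl// mulrC.
near: y; apply: cvgr_dist_lt; first exact: cvg_id.
by rewrite mulr_gt0// invr_gt0.
Unshelve. all: by end_near. Qed.

(** If [F] is [K]-Lipschitz then [G x = K * x - F x] is again nondecreasing,
and the Stieltjes measures of [F] and [G] add up to [K] times Lebesgue
measure: a Lebesgue-null set is null for each of the two. *)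
Lemma lebesgue_stieltjes_null (F : cumulative R R) (K : R) : 0 < K ->
  (forall x y, x <= y -> F y - F x <= K * (y - x)) ->
  forall A, measurable A -> mu A = 0%E -> lebesgue_stieltjes_measure F A = 0%E.
Proof.
move=> K0 lip.
pose G x := K * x - F x.
have Gnd : {homo G : x y / x <= y}.
  by move=> x y /lip; rewrite /G mulrBr; lra.
have Grc : right_continuous G.
  move=> x; apply: cvgB; last exact: cumulative_is_right_continuous.
  apply: cvg_within_filter; exact: (@mulrl_continuous _ K x).
pose G' : cumulative R R := HB.pack G (isCumulative.Build R _ R G Gnd Grc).
pose c := NngNum (ltW (divr_gt0 ltr01 K0)).
pose m : {measure set (measurableTypeR R) -> \bar R} :=
  mscale c (measure_add (lebesgue_stieltjes_measure F) (lebesgue_stieltjes_measure G')).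
have mE A : m A = ((1 / K)%:E *
    (lebesgue_stieltjes_measure F A + lebesgue_stieltjes_measure G' A))%E.
  by rewrite -measure_addE.
have meq A : measurable A -> mu A = m A.
  apply: lebesgue_stieltjes_measure_unique => X /ocitvP[->|[[x y]/= xy ->]].
    by rewrite !measure0.
  rewrite mE !lebesgue_stieltjes_oc ?ltW//=.
  rewrite -EFinD -EFinM /G; congr (_%:E).
  by field; rewrite gt_eqF.
move=> A mA; rewrite meq// mE => /eqP.
rewrite mule_eq0 => /orP[|].
  by rewrite eqe/= div1r invr_eq0 gt_eqF.
by rewrite padde_eq0// => /andP[/eqP].
Qed.

Lemma lipschitz_nondecreasing_density psi (K a b : R) : 0 < K -> a < b ->
  {homo psi : x y / x <= y} ->
  (forall x y, x <= y -> psi y - psi x <= K * (y - x)) ->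
  exists g : R -> R, mu.-integrable setT (EFin \o g) /\
    forall x, a <= x <= b -> psi x - psi a = \int[mu]_(t in `]a, x]) g t.
Proof.
move=> K0 ab nd lip.
have cpsi : continuous psi.
  apply: (@lipschitz_continuous _ K) => x y.
  wlog xy : x y / x <= y.
    by move=> W; have [/W//|/ltW/W] := leP x y; rewrite distrC (distrC x).
  by rewrite distrC (distrC x) !ger0_norm ?subr_ge0 ?nd// lip.
have prc : right_continuous psi by exact: right_continuousW.
pose F : cumulative R R := HB.pack psi (isCumulative.Build R _ R psi nd prc).
pose nu := lebesgue_stieltjes_measure F.
have mab : measurable (`]a, b] : set (measurableTypeR R)).
  exact: measurable_itv.
have nuab : (nu `]a, b]%classic < +oo)%E by rewrite /nu lebesgue_stieltjes_oc ?ltW// ltry.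
pose nur : {finite_measure set (measurableTypeR R) -> \bar R} := mfrestr mab nuab.
have dom : nur `<< mu.
  apply/null_content_dominatesP => A mA A0.
  rewrite /= /mfrestr /mrestr.
  have L := @lebesgue_stieltjes_null F K K0 lip.
  apply: L; first exact: measurableI.
  apply/eqP; rewrite eq_le measure_ge0 andbT -A0.
  by apply: le_measure; rewrite ?inE//; exact: measurableI.
have [g [g0 gfin gint gE]] := radon_nikodym_sigma_finite dom.
exists (fine \o g); have eg : EFin \o (fine \o g) = g.
  by apply/funext => x /=; rewrite fineK.
split; first by rewrite eg.
move=> x /andP[ax xb]; rewrite /Rintegral.
rewrite (_ : (fun _ => _) = g); last by rewrite -eg; apply/funext => y.
rewrite -gE; last exact: measurable_itv.
rewrite /= /mfrestr /mrestr.
rewrite setIidl; last first.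
  by move=> y /=; rewrite !in_itv/= => /andP[-> /le_trans]; exact.
by rewrite /nu lebesgue_stieltjes_oc.
Qed.

(** Adding a multiple of the identity makes [phi] nondecreasing, hence the
primitive of a density [g].  By Lebesgue differentiation [phi] is derivable
almost everywhere with derivative the density up to that multiple, so the
hypothesis bounds [g] from below almost everywhere, and it remains to
integrate. *)
Lemma lipschitz_derivative_ge phi (K m a b : R) : a < b ->
  (forall x y, `|phi x - phi y| <= K * `|x - y|) ->
  (forall x, a < x < b -> derivable phi x 1 -> m <= derive1 phi x) ->
  m * (b - a) <= phi b - phi a.
Proof.
move=> ab lip dm; pose K' := `|K| + 1.
have K'0 : 0 < K' by rewrite /K' ltr_wpDl.
have KK' : K <= K' by rewrite /K' (le_trans (ler_norm K))// lerDl.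
pose psi x := phi x + K' * x.
have lip' x y : x <= y -> `|phi y - phi x| <= K' * (y - x).
  move=> xy; apply: (le_trans (lip y x)).
  by rewrite ger0_norm ?subr_ge0// ler_wpM2r ?subr_ge0.
have nd : {homo psi : x y / x <= y}.
  by move=> x y /lip'; rewrite /psi ler_norml => /andP[+ _]; lra.
have K2 : 0 < K' + K' by rewrite addr_gt0.
have lip2 x y : x <= y -> psi y - psi x <= (K' + K') * (y - x).
  by move=> /lip'; rewrite /psi ler_norml => /andP[_ +]; lra.
have [g [gint gE]] := lipschitz_nondecreasing_density K2 ab nd lip2.
have gi (A : set (measurableTypeR R)) : measurable A -> mu.-integrable A (EFin \o g).
  by move=> mA; apply: integrableS gint.
have ge_ae : {ae mu, forall x, `]a, b]%classic x -> m + K' <= g x}.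
  have lb : {ae mu, forall x, x != b}.
    exists [set b]; split => //; first by rewrite lebesgue_measure_set1.
    by move=> x /= /negP; rewrite negbK => /eqP.
  have := lebesgue_differentiation (open_integrable_locally openT gint).
  apply: filterS2 lb; first exact: (ae_filter_ringOfSetsType mu).
  move=> x xb lx /=; rewrite in_itv/= => /andP[ax xb'].
  have {}xb : x < b by rewrite lt_neqAle xb.
  have iab : mu.-integrable `]a, b] (EFin \o g) by apply: gi; exact: measurable_itv.
  have axb : (BRight a < BRight x)%O by rewrite bnd_simp.
  have [dF FE] := FTC1_lebesgue_pt xb iab axb lx.
  have near_eq : \near x, \int[mu]_(t in `]a, x]) g t + psi a = psi x.
    near=> y; rewrite -gE ?subrK//; apply/andP; split; apply: ltW.
      by near: y; exact: lt_nbhsr.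
    by near: y; exact: lt_nbhsl.
  have dpsi : is_derive x 1 psi (g x).
    apply: near_eq_is_derive near_eq _.
    rewrite -[g x]addr0 -FE derive1E.
    by apply: is_deriveD; exact: derivableP.
  have dphi : is_derive x 1 phi (g x - K').
    have -> : phi = psi - (fun x => K' * x).
      by apply/funext => y; rewrite /psi !fctE addrK.
    apply: is_deriveB.
    have -> : (fun y : R => K' * y) = K' \*: id by [].
    by apply: is_derive_eq; rewrite /GRing.scale/= mulr1.
  have := dm x; rewrite ax xb derive1E derive_val => /(_ erefl).
  by move=> /(_ (@ex_derive _ _ _ _ _ _ _ dphi)); lra.
have mab : measurable (`]a, b] : set (measurableTypeR R)).
  exact: measurable_itv.
have : psi b - psi a >= (m + K') * (b - a).
  rewrite gE; last by rewrite lexx ltW.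
  pose c := m + K'.
  have cint : mu.-integrable `]a, b] (EFin \o cst c).
    apply/integrableP; split; first by apply/measurable_EFinP; exact: measurable_cst.
    rewrite (eq_integral (cst `|c|%:E))//.
    rewrite integral_cst//= lebesgue_measure_itv/= lte_fin ab.
    by rewrite -EFinB -EFinM ltry.
  have g_int : mu.-integrable `]a, b] (EFin \o g) by exact: gi.
  have mg : measurable_fun `]a, b] g.
    by apply/measurable_EFinP; exact: (measurable_int mu g_int).
  (* The maximum with [c] turns the almost everywhere bound into one that holds
     everywhere, without changing the integral. *)
  have -> : \int[mu]_(t in `]a, b]) g t = \int[mu]_(t in `]a, b]) Num.max (g t) c.
    rewrite /Rintegral; congr fine; apply: ae_eq_integral => //.
    - exact/measurable_EFinP.
    - by apply/measurable_EFinP; apply: measurable_maxr => //; exact: measurable_cst.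
    - apply: filterS ge_ae; first exact: (ae_filter_ringOfSetsType mu).
      move=> x h xab; have {}h := h xab.
      by rewrite /= (elimT max_idPl).
  have cE : c * (b - a) = \int[mu]_(t in `]a, b]) cst c t.
    by rewrite Rintegral_cst//= lebesgue_measure_itv/= lte_fin ab -EFinB.
  rewrite -/c cE; apply: le_Rintegral => //.
    have h : mu.-integrable `]a, b] ((abse \o (EFin \o g)) \+ (abse \o (EFin \o cst c))).
      by apply: integrableD => //; exact: integrable_abse.
    apply: le_integrable h => //.
      by apply/measurable_EFinP; apply: measurable_maxr => //; exact: measurable_cst.
    move=> x _ /=; rewrite lee_fin [leRHS]ger0_norm ?addr_ge0//.
    have := normr_ge0 (g x); have := normr_ge0 c.
    by case: (leP (g x) c) => _; lra.
  by move=> x _ /=; rewrite le_max lexx orbT.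
by rewrite /psi; lra.
Unshelve. all: by end_near. Qed.

End lip.

(** * Integration over R^n of bounded functions with bounded support *)
Section tuple_integral.
Context {R : realType}.
Local Notation T := (measurableTypeR R).
Local Notation leb n := (@lebesgue_tuple R n).

Definition tbox n (M : R) : set (n.-tuple T) := [set t | forall j, `|tnth t j| <= M].

Lemma measurable_tbox n M : measurable (@tbox n M).
Proof.
have -> : @tbox n M = \bigcap_(j in [set: 'I_n]) ((@tnth n T)^~ j @^-1` [set` `[- M, M]]).
  apply/seteqP; split=> t /=.
    by move=> h j _ /=; rewrite in_itv/= -ler_norml.
  by move=> h j; rewrite ler_norml; have := h j I; rewrite /= in_itv.
apply: fin_bigcap_measurable; first exact: finite_finset.
move=> j _; rewrite -[X in measurable X]setTI.
by apply: measurable_tnth => //; exact: measurable_itv.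
Qed.

Lemma lebesgue_tuple_pushforward n (A : set (n.+1.-tuple T)) :
  leb n.+1 A = pushforward (lebesgue_measure \x leb n)%E (@cons_pair R n) A.
Proof. by []. Qed.

Lemma tbox_finite n M : (leb n (tbox M) < +oo)%E.
Proof.
elim: n => [|n IH].
  rewrite /= /dirac indicE ?ltry//.
rewrite lebesgue_tuple_pushforward /pushforward.
have -> : @cons_pair R n @^-1` tbox M = `[- M, M]%classic `*` tbox M.
  apply/seteqP; split=> -[x t] /=.
    move=> h; split => [|j].
      by have := h ord0; rewrite tnth0 in_itv/= -ler_norml.
    by have := h (lift ord0 j); rewrite tnthS.
  move=> [+ h] j; rewrite in_itv/= -ler_norml => xM.
  by case: (unliftP ord0 j) => [k|] ->; rewrite ?tnthS ?tnth0.
rewrite product_measure1E; last 2 first.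
- exact: measurable_itv.
- exact: measurable_tbox.
apply: lte_mul_pinfty => //.
change (lebesgue_measure `[- M, M]%classic \is a fin_num).
by rewrite lebesgue_measure_itv/=; case: ifP => _; rewrite -?EFinB.
Qed.

Lemma tbox_integrable n M :
  (leb n).-integrable setT (EFin \o (fun t => M * \1_(@tbox n M) t)).
Proof.
have mb := @measurable_tbox n M.
have i1 : (leb n).-integrable setT (EFin \o \1_(@tbox n M)).
  apply/integrableP; split.
    by apply/measurable_EFinP; exact: measurable_indic.
  rewrite (eq_integral (fun x => (\1_(@tbox n M) x)%:E)); last first.
    by move=> x _; rewrite /= ger0_norm.
  by rewrite integral_indic// setIT tbox_finite.
by apply: eq_integrable (integrableZl _ M i1).
Qed.

Lemma bounded_box_integrable n (g : n.-tuple T -> R) M :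
  measurable_fun setT g -> (forall t, `|g t| <= M) ->
  (forall t, g t != 0 -> tbox M t) ->
  (leb n).-integrable setT (EFin \o g).
Proof.
move=> mg gM gbox.
have := @tbox_integrable n M.
apply: le_integrable => //; first exact/measurable_EFinP.
move=> t _ /=; rewrite lee_fin.
have M0 : 0 <= M by apply: le_trans (gM t).
rewrite [leRHS]ger0_norm ?mulr_ge0// indicE.
have [g0|/gbox h] := eqVneq (g t) 0; first by rewrite g0 normr0 mulr_ge0.
by rewrite mem_set//= mulr1.
Qed.

Definition upd n (t : n.-tuple T) (j : 'I_n) (s : R) : n.-tuple T :=
  [tuple if i == j then s else tnth t i | i < n].

(** Fubini: [lebesgue_tuple] is an iterated product, so a coordinate [j] can be
integrated first; induction on [n] brings [j] to the head of the tuple. *)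
Lemma integral_lines0 n (g : n.-tuple T -> R) (j : 'I_n) M :
  measurable_fun setT g -> (forall t, `|g t| <= M) ->
  (forall t, g t != 0 -> tbox M t) ->
  (forall t, \int[lebesgue_measure]_s (g (upd t j s))%:E = 0)%E ->
  (\int[leb n]_t (g t)%:E = 0)%E.
Proof.
elim: n => [|n IH] in g j * => mg gM gbox gj; first by case: j gj.
have ig := bounded_box_integrable mg gM gbox.
have mcp : measurable_fun setT (@cons_pair R n) by exact: measurable_cons_pair.
have igc : (lebesgue_measure \x leb n)%E.-integrable setT
    (fun p : T * n.-tuple T => (g (cons_pair p))%:E).
  apply/integrableP; split.
    by apply/measurable_EFinP; exact: measurableT_comp mg mcp.
  have /integrableP[_] := ig.
  rewrite /= (@ge0_integral_pushforward _ _ _ _ _ _ mcp _ setT)//.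
  by apply: measurableT_comp => //; exact: measurableT_comp.
transitivity (\int[(lebesgue_measure \x leb n)]_p (g (cons_pair p))%:E)%E.
  rewrite /= (@integral_pushforward _ _ _ _ _ _ mcp _ setT (EFin \o g))//.
  exact/measurable_EFinP.
case: (unliftP ord0 j) => [k|] jE.
  rewrite -integral12_prod_meas1//.
  rewrite integral0_eq// => x _; rewrite /fubini_F.
  apply: (IH (fun t => g (cons_pair (x, t))) k).
  - apply: measurableT_comp mg _.
    by apply: measurableT_comp mcp _; exact: measurable_pair1.
  - by move=> t; exact: gM.
  - by move=> t /gbox h i; have := h (lift ord0 i); rewrite tnthS.
  - move=> t; apply: etrans (gj (cons_pair (x, t))); rewrite jE.
    apply: eq_integral => s _; congr (g _)%:E; apply: eq_from_tnth => i.
    rewrite /upd tnth_mktuple; case: (unliftP ord0 i) => [i'|] ->.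
      by rewrite !tnthS tnth_mktuple (inj_eq lift_inj).
    by rewrite tnth0 /= tnth0.
rewrite -integral21_prod_meas1//.
rewrite integral0_eq// => t _; rewrite /fubini_G.
apply: etrans (gj (cons_pair (0, t))); rewrite jE.
apply: eq_integral => s _; congr (g _)%:E; apply: eq_from_tnth => i.
rewrite /upd tnth_mktuple; case: (unliftP ord0 i) => [i'|] ->.
  by rewrite !tnthS.
by rewrite tnth0.
Qed.

End tuple_integral.

Section Int_def.
Context {R : realType} {n : nat}.
Local Notation T := (measurableTypeR R).
Local Notation V := 'rV[R]_n.
Local Notation leb := (@lebesgue_tuple R n).
Implicit Types (f g : V -> R).

Definition box_bounded (M : R) g :=
  (forall x, `|g x| <= M) /\ forall x, g x != 0 -> forall j, `|x 0 j| <= M.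

(** Everything that is integrated below is bounded, measurable and vanishes
outside a box; on this class the real-valued integral is linear and monotone
without further side conditions. *)
Definition BM g :=
  measurable_fun setT (fun t : n.-tuple T => g (row_of_tuple t)) /\
  exists M, box_bounded M g.

Definition Int g : R := (\int[leb]_t g (row_of_tuple t)).

Lemma row_of_tupleE (t : n.-tuple T) j : row_of_tuple t 0 j = tnth t j.
Proof. by rewrite mxE. Qed.

Lemma BM_integrable g : BM g -> leb.-integrable setT (EFin \o (g \o row_of_tuple)).
Proof.
move=> [mg [M [gM gb]]]; apply: (bounded_box_integrable (M := M)) => //.
  by move=> t; exact: gM.
by move=> t /gb h j; rewrite -row_of_tupleE.
Qed.

Lemma BM0 : BM (fun=> 0).
Proof.
split; first exact: measurable_cst.
by exists 0; split => x; rewrite ?normr0// eqxx.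
Qed.

Lemma BMD f g : BM f -> BM g -> BM (fun x => f x + g x).
Proof.
move=> [mf [M [fM fb]]] [mg [M' [gM gb]]]; split.
  exact: measurable_funD.
have M0 : 0 <= M by apply: le_trans (fM 0).
have M'0 : 0 <= M' by apply: le_trans (gM 0).
exists (M + M'); split=> x.
  by rewrite (le_trans (ler_normD _ _))// lerD.
have [f0|/fb h _ j] := eqVneq (f x) 0; last by rewrite (le_trans (h j))// lerDl.
by rewrite f0 add0r => /gb h j; rewrite (le_trans (h j))// lerDr.
Qed.

Lemma BMM f g : BM f -> (measurable_fun setT (fun t : n.-tuple T => g (row_of_tuple t))) ->
  (exists M, forall x, f x != 0 -> `|g x| <= M) -> BM (fun x => f x * g x).
Proof.
move=> [mf [M [fM fb]]] mg [M' gM]; split; first exact: measurable_funM.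
have M0 : 0 <= M by apply: le_trans (fM 0).
exists (Num.max M (M * `|M'|)); split=> x.
  rewrite normrM le_max; apply/orP; right.
  have [->|f0] := eqVneq (f x) 0; first by rewrite normr0 mul0r mulr_ge0.
  by rewrite ler_pM// (le_trans (gM x f0))// ler_norm.
by rewrite mulf_eq0 negb_or => /andP[/fb h _] j; rewrite le_max h.
Qed.

Lemma BMZ c f : BM f -> BM (fun x => c * f x).
Proof.
move=> mf; under eq_fun do rewrite mulrC.
apply: (BMM (g := fun=> c)) => //.
by exists `|c|.
Qed.

Lemma BMN f : BM f -> BM (fun x => - f x).
Proof. by move=> /(BMZ (-1)); under eq_fun do rewrite mulN1r. Qed.

Lemma BM_sum I (r : seq I) (P : pred I) (F : I -> V -> R) :
  (forall i, P i -> BM (F i)) -> BM (fun x => \sum_(i <- r | P i) F i x).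
Proof.
move=> h; elim: r => [|i r IH].
  rewrite (_ : (fun x => _) = (fun=> 0)); first exact: BM0.
  by apply/funext => x; rewrite big_nil.
rewrite (_ : (fun x => _) = (fun x =>
    if P i then F i x + \sum_(j <- r | P j) F j x else \sum_(j <- r | P j) F j x)); last first.
  by apply/funext => x; rewrite big_cons.
have := h i; case: (P i) => [/(_ isT) hi|_]; last exact: IH.
exact: BMD.
Qed.

Lemma IntD f g : BM f -> BM g -> Int (fun x => f x + g x) = Int f + Int g.
Proof. by move=> bf bg; rewrite /Int -RintegralD//; exact: BM_integrable. Qed.

Lemma IntZ c f : BM f -> Int (fun x => c * f x) = c * Int f.
Proof. by move=> bf; rewrite /Int -RintegralZl//; exact: BM_integrable. Qed.

Lemma IntN f : BM f -> Int (fun x => - f x) = - Int f.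
Proof.
by move=> bf; rewrite -mulN1r -IntZ//; congr Int; apply/funext => x; rewrite mulN1r.
Qed.

Lemma IntB f g : BM f -> BM g -> Int (fun x => f x - g x) = Int f - Int g.
Proof. by move=> bf bg; rewrite IntD ?IntN//; exact: BMN. Qed.

Lemma Int0 : Int (fun=> 0) = 0.
Proof. by rewrite /Int Rintegral_cst// mul0r. Qed.

Lemma Int_sum I (r : seq I) (P : pred I) (F : I -> V -> R) :
  (forall i, P i -> BM (F i)) ->
  Int (fun x => \sum_(i <- r | P i) F i x) = \sum_(i <- r | P i) Int (F i).
Proof.
move=> h; elim: r => [|i r IH].
  by rewrite big_nil -[RHS]Int0; congr Int; apply/funext => x; rewrite big_nil.
rewrite big_cons; transitivity (Int (fun x =>
    (if P i then F i x else 0) + \sum_(i <- r | P i) F i x)).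
  congr Int; apply/funext => x; rewrite big_cons.
  by case: ifP => // _; rewrite add0r.
have bs := @BM_sum _ r _ _ h.
have := h i; case: (P i) => [/(_ isT) hi|_]; first by rewrite IntD ?IH.
by rewrite -IH; congr Int; apply/funext => x; rewrite add0r.
Qed.

Lemma le_Int f g : BM f -> BM g -> (forall x, f x <= g x) -> Int f <= Int g.
Proof. by move=> bf bg fg; apply: le_Rintegral => //; exact: BM_integrable. Qed.

Lemma Int_ge0 f : (forall x, 0 <= f x) -> 0 <= Int f.
Proof. by move=> f0; exact: Rintegral_ge0. Qed.

Lemma BM_norm f : BM f -> BM (fun x => `|f x|).
Proof.
move=> [mf [M [fM fb]]]; split; first exact: measurableT_comp.
exists M; split => x; first by rewrite normr_id.
by rewrite normr_eq0; exact: fb.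
Qed.

Lemma Int_norm f : BM f -> `|Int f| <= Int (fun x => `|f x|).
Proof. by move=> bf; apply: le_normr_Rintegral => //; exact: BM_integrable. Qed.

Lemma Int_EFin f : BM f -> (\int[leb]_t (f (row_of_tuple t))%:E)%E = (Int f)%:E.
Proof.
move=> bf; rewrite /Int /Rintegral fineK//; apply: integrable_fin_num => //.
exact: (BM_integrable bf).
Qed.

(** A common box bound makes a multiple of the indicator of the box an integrable
majorant. *)
Lemma Int_dominated (F : nat -> V -> R) f M : (forall k, BM (F k)) ->
  (forall k, box_bounded M (F k)) ->
  (forall x, F k x @[k --> \oo] --> f x) ->
  BM f /\ Int (F k) @[k --> \oo] --> Int f.
Proof.
move=> bF FM Ff.
have mf : measurable_fun setT (fun t : n.-tuple T => f (row_of_tuple t)).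
  apply: (measurable_fun_cvg (h := fun k t => F k (row_of_tuple t))) => //.
  by move=> k; case: (bF k).
have bf : BM f.
  split => //; exists M; split=> x.
    have h1 : `|F k x| @[k --> \oo] --> `|f x| by exact: cvg_norm.
    apply: (ler_cvg_to h1 (cvg_cst M)).
    by apply: nearW => k; have [h _] := FM k; exact: h.
  move=> fx0 j; rewrite leNgt; apply/negP => Mx.
  move/negP: fx0; apply; apply/eqP.
  rewrite -(cvg_lim (@Rhausdorff R) (Ff x)).
  rewrite (_ : (fun k => F k x) = cst 0); first exact: lim_cst.
  apply/funext => k /=; apply/eqP; apply: contraTT Mx => Fkx.
  by rewrite -leNgt; have [_ h] := FM k; exact: h.
split => //.
have ig : leb.-integrable setT (EFin \o (fun t => M * \1_(@tbox R n M) t)).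
  by apply: tbox_integrable.
have [|||||_ _] := @dominated_convergence _ _ _ leb setT measurableT
  (fun k t => (F k (row_of_tuple t))%:E) (fun t => (f (row_of_tuple t))%:E)
  (EFin \o (fun t => M * \1_(@tbox R n M) t)).
- by move=> k; apply/measurable_EFinP; case: (bF k).
- exact/measurable_EFinP.
- by apply: aeW => t _; apply: cvg_EFin; [exact: nearW|exact: Ff].
- exact: ig.
- apply: aeW => t k _ /=; rewrite lee_fin.
  have [h1 h2] := FM k; have M0 : 0 <= M by apply: le_trans (h1 0).
  rewrite indicE; have [->|/h2 h] := eqVneq (F k (row_of_tuple t)) 0.
    by rewrite normr0 mulr_ge0.
  by rewrite mem_set ?mulr1// => j; rewrite -row_of_tupleE.
rewrite (Int_EFin bf) => h; apply: fine_cvg; apply: cvg_trans h.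
by apply: near_eq_cvg; apply: nearW => k; rewrite /= Int_EFin.
Qed.

(** The sigma-algebra on tuples is a product one, while open sets of rows come
from the norm: an open set is a countable union of cubes with rational centre
and radius [1 / k]. *)
Lemma measurable_row_open (U : set V) : open U -> measurable (@row_of_tuple R n @^-1` U).
Proof.
move=> oU.
pose c (p : 'rV[rat]_n) : V := map_mx ratr p.
pose B (p : 'rV[rat]_n * nat) : set V :=
  if `[< ball (c p.1) (p.2.+1%:R^-1) `<=` U >] then ball (c p.1) (p.2.+1%:R^-1) else set0.
have -> : U = \bigcup_p B p.
  apply/seteqP; split; last first.
    by move=> x [p _]; rewrite /B; case: asboolP => // h /h.
  move=> x Ux.
  have /nbhs_ballP[e /= e0 xe] : nbhs x U by exact: open_nbhs_nbhs.
  have [k ke] : exists k, k.+1%:R^-1 < e / 2.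
    have /ltr_add_invr[k] : 0 < e / 2 by rewrite divr_gt0.
    by rewrite add0r => ?; exists k.
  have [q qx] : exists q : 'rV[rat]_n, ball (c q) (k.+1%:R^-1) x.
    have h j : exists r : rat, ball (x 0 j) (k.+1%:R^-1) (ratr r).
      have [|r] := @rat_in_itvoo R (x 0 j - k.+1%:R^-1) (x 0 j + k.+1%:R^-1).
        by rewrite ltrBlDr -addrA ltrDl addr_gt0// invr_gt0.
      by rewrite in_itv/= => r1; exists r; rewrite -ball_normE/= ltr_distlC.
    have [r hr] := choice h.
    exists (\row_j r j); apply: ball_sym; split; first by rewrite /= invr_gt0.
    by move=> i j; rewrite ord1 !mxE; exact: hr.
  exists (q, k) => //; rewrite /B/=; case: asboolP => //.
  case=> y qy; apply: xe.
  rewrite (splitr e); apply: ball_triangle (le_ball (ltW ke) qy).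
  by apply: le_ball (ltW ke) _ _; exact: ball_sym.
rewrite preimage_bigcup; apply: countable_bigcupT_measurable; first exact: countableP.
move=> p; rewrite /B; case: asboolP => _; last by rewrite preimage_set0.
have -> : @row_of_tuple R n @^-1` ball (c p.1) p.2.+1%:R^-1 =
    \bigcap_(j in [set: 'I_n]) ((@tnth n T)^~ j @^-1` ball (c p.1 0 j) (p.2.+1%:R^-1)).
  apply/seteqP; split=> t /=.
    by move=> [_ h] j _ /=; rewrite -row_of_tupleE; exact: h.
  move=> h; split; first by rewrite invr_gt0.
  by move=> i j; rewrite ord1 row_of_tupleE; exact: h.
apply: fin_bigcap_measurable; first exact: finite_finset.
move=> j _; rewrite -[X in measurable X]setTI.
by apply: measurable_tnth => //; exact: measurable_ball.
Qed.

End Int_def.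

Section Int_calc.
Context {R : realType} {n : nat}.
Local Notation T := (measurableTypeR R).
Local Notation V := 'rV[R]_n.
Local Notation leb := (@lebesgue_tuple R n).
Implicit Types (f g : V -> R).

Lemma measurable_row_restrict (W : set V) g : open W ->
  (forall x, W x -> {for x, continuous g}) ->
  measurable_fun setT (fun t : n.-tuple T => (g \_ W) (row_of_tuple t)).
Proof.
move=> oW cg.
have mW := measurable_row_open oW.
rewrite (_ : (fun t => _) = (g \o row_of_tuple) \_ (@row_of_tuple R n @^-1` W)); last first.
  by apply/funext => t; rewrite !patchE; congr (if _ then _ else _);
     apply/idP/idP; rewrite !inE.
apply/(measurable_restrictT _ mW) => //.
move=> _; apply: (measurability _ (RGenOpens.measurableE R)).
move=> _ [_ [a [b ->] <-]].
have -> : (@row_of_tuple R n @^-1` W) `&` (g \o @row_of_tuple R n) @^-1` `]a, b[%classic =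
    @row_of_tuple R n @^-1` (W `&` g @^-1` `]a, b[%classic) by [].
apply: measurable_row_open; rewrite openE => x [Wx gx].
apply: filterI; first exact: open_nbhs_nbhs.
by apply: (cg x Wx); apply: open_nbhs_nbhs; split => //; exact: interval_open.
exact: mW.
Qed.

Lemma coord_le_norm m (x : 'rV[R]_m) j : `|x 0 j| <= `|x|.
Proof.
rewrite /Num.norm/= mx_normrE.
exact: (le_bigmax _ (fun ij : 'I_1 * 'I_m => `|x ij.1 ij.2|) (0, j)).
Qed.

Lemma norm_le_coord m (x : 'rV[R]_m) M : 0 <= M -> (forall j, `|x 0 j| <= M) -> `|x| <= M.
Proof.
move=> M0 h; rewrite /Num.norm/= mx_normrE; apply: bigmax_le => //.
by move=> [i j] _ /=; rewrite ord1.
Qed.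

Lemma bounded_rowP (W : set V) : bounded_set W -> exists M, forall x, W x -> forall j, `|x 0 j| <= M.
Proof.
move=> [M [Mr h]]; exists (M + 1) => x Wx j.
have h1 : `|x| <= M + 1 by apply: (h (M + 1)); rewrite ?ltrDl.
exact: le_trans (coord_le_norm x j) h1.
Qed.

Lemma BM_restrict (W : set V) g : open W -> bounded_set W ->
  (forall x, W x -> {for x, continuous g}) ->
  (exists M, forall x, W x -> `|g x| <= M) -> BM (g \_ W).
Proof.
move=> oW /bounded_rowP[M WM] cg [M' gM]; split; first exact: measurable_row_restrict.
exists (Num.max M `|M'|); split => x; rewrite patchE; case: ifPn => [|_].
- rewrite inE => Wx; rewrite le_max; apply/orP; right.
  exact: le_trans (gM x Wx) (ler_norm _).
- by rewrite normr0 le_max normr_ge0 orbT.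
- by rewrite inE => Wx _ j; rewrite le_max WM.
- by rewrite eqxx.
Qed.

Lemma row_of_upd (t : n.-tuple T) j (s : R) :
  row_of_tuple (upd t j s) = row_of_tuple (upd t j 0) + s *: basis_vec j.
Proof.
apply/rowP => i; rewrite !mxE !tnth_mktuple eqxx/=.
by case: eqP => _; rewrite ?mulr1 ?add0r ?mulr0 ?addr0.
Qed.

Lemma is_derive_line g (x v : V) (s l : R) :
  is_derive (x + s *: v) v g l -> is_derive s 1 (fun s => g (x + s *: v)) l.
Proof.
move=> [dg dgl]; have e : (fun h : R => h^-1 *: (g (x + (h *: (1 : R) + s) *: v) - g (x + s *: v))) =
  (fun h => h^-1 *: (g (h *: v + (x + s *: v)) - g (x + s *: v))).
  apply/funext => h; congr (_ *: (g _ - _)).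
  by rewrite /GRing.scale/= mulr1 -/(GRing.scale _ _) scalerDl addrCA.
by split; [rewrite /derivable e|rewrite /derive e].
Qed.

(** The fundamental theorem of calculus on each line parallel to the [j]-th axis:
[g] vanishes at both ends of a long enough segment. *)
Lemma Int_derive0 g dg (j : 'I_n) M : BM dg ->
  (forall x, is_derive x (basis_vec j) g (dg x)) ->
  (forall x, continuous (fun s : R => dg (x + s *: basis_vec j))) ->
  (forall x, g x != 0 -> `|x 0 j| <= M) -> Int dg = 0.
Proof.
move=> [mdg [M' [dgM dgb]]] dgE cdg gM; rewrite /Int /Rintegral.
rewrite (_ : integral _ _ _ = 0%E)//.
apply: (@integral_lines0 R n (fun t => dg (row_of_tuple t)) j M') => //.
  by move=> t /dgb h i; rewrite -row_of_tupleE.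
move=> t; pose x := row_of_tuple (upd t j 0).
under eq_integral do rewrite row_of_upd -/x.
pose L := `|M| + `|M'| + 1.
have L0 : 0 < L by rewrite ltr_wpDl// addr_ge0.
have xj s : (x + s *: basis_vec j) 0 j = s.
  by rewrite !mxE tnth_mktuple eqxx add0r mulr1.
have out s : L <= `|s| -> g (x + s *: basis_vec j) = 0.
  move=> Ls; apply/eqP; apply: contraTT Ls => /gM; rewrite xj -ltNge /L => h.
  by have := ler_norm M; have := normr_ge0 M'; lra.
rewrite (_ : (fun s => _) = (fun s => (dg (x + s *: basis_vec j))%:E) \_ `[- L, L]); last first.
  apply/funext => s; rewrite patchE; case: ifPn => //.
  move=> /negP; rewrite inE/= in_itv/= -ler_norml => /negP; rewrite -ltNge => Ls.
  congr EFin; apply/eqP; apply: contraTT Ls => /dgb /(_ j); rewrite xj -leNgt /L => h.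
  by have := ler_norm M'; have := normr_ge0 M; lra.
rewrite -integral_mkcond.
have dphi (s : R) : is_derive s (1 : R) (fun s : R => g (x + s *: basis_vec j)) (dg (x + s *: basis_vec j)).
  exact: is_derive_line.
have cphi : continuous (fun s : R => g (x + s *: basis_vec j)).
  move=> s; apply: differentiable_continuous; apply/derivable1_diffP.
  by case: (dphi s).
rewrite (@continuous_FTC2 _ _ (fun s => g (x + s *: basis_vec j))).
- rewrite !out ?sube0//; rewrite ?normrN ger0_norm// ltW//.
- by rewrite -subr_gt0 opprK addr_gt0.
- by apply: continuous_subspaceT => s; exact: cdg.
- split.
  + by move=> s _; case: (dphi s).
  + by apply: cvg_at_right_filter; exact: cphi.
  + by apply: cvg_at_left_filter; exact: cphi.
- by move=> s _; rewrite derive1E; case: (dphi s).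
Qed.

End Int_calc.

(** * Functions with continuous partial derivatives *)
Section C1.
Context {R : realType}.

Lemma cvg_sumr (T : Type) (F : set_system T) (FF : Filter F) (I : Type) (r : seq I)
    (f : I -> T -> R) (l : I -> R) :
  (forall i, f i x @[x --> F] --> l i) ->
  (\sum_(i <- r) f i x) @[x --> F] --> \sum_(i <- r) l i.
Proof.
move=> h; elim: r => [|i r IH].
  rewrite big_nil (_ : (fun x => _) = fun=> 0); first exact: cvg_cst.
  by apply/funext => x; rewrite big_nil.
rewrite big_cons (_ : (fun x => _) = (fun x => f i x + \sum_(j <- r) f j x)).
  exact: cvgD.
by apply/funext => x; rewrite big_cons.
Qed.

Lemma is_derive_continuous (f : R -> R) (s l : R) : is_derive s 1 f l -> {for s, continuous f}.
Proof. by case=> df _; apply: differentiable_continuous; exact/derivable1_diffP. Qed.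

Lemma MVT_sym (f df : R -> R) (b : R) :
  (forall s : R, `|s| <= `|b| -> is_derive s (1 : R) f (df s)) ->
  exists2 c, `|c| <= `|b| & f b - f 0 = df c * b.
Proof.
move=> h; have cf (A : set R) : (forall s, A s -> `|s| <= `|b|) -> {within A, continuous f}.
  move=> hA; apply: continuous_in_subspaceT => s; rewrite inE => /hA /h.
  exact: is_derive_continuous.
have [b0|b0] := leP 0 b.
  have [s|s /=|c + ->] := @MVT_segment R f df 0 b b0.
  - by rewrite in_itv/= => /andP[s0 sb]; apply: h; rewrite !ger0_norm// ltW.
  - apply: cf => {}s /=; rewrite in_itv/= => /andP[s0 sb].
    by rewrite !ger0_norm.
  - rewrite in_itv/= subr0 => /andP[c0 cb]; exists c => //.
    by rewrite !ger0_norm.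
have [s|s /=|c + E] := @MVT_segment R f df b 0 (ltW b0).
- rewrite in_itv/= => /andP[s0 sb]; apply: h.
  by rewrite !ler0_norm ?lerN2 ?ltW.
- apply: cf => {}s /=; rewrite in_itv/= => /andP[s0 sb].
  by rewrite !ler0_norm ?lerN2// ltW.
- rewrite in_itv/= => /andP[c0 cb]; exists c.
    by rewrite !ler0_norm ?lerN2// ltW.
  by rewrite -opprB E sub0r mulrN opprK.
Qed.

Definition dlin n (a : 'I_n -> R) (v : 'rV[R]_n) : R := \sum_j v 0 j * a j.

Lemma dlin_is_linear n a : linear (@dlin n a).
Proof.
move=> c u v; rewrite /dlin scaler_sumr -big_split/=; apply: eq_bigr => j _.
by rewrite !mxE mulrDl -mulrA.
Qed.

Definition dlinL n a : {linear 'rV[R]_n -> R} :=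
  HB.pack (@dlin n a) (GRing.isLinear.Build _ _ _ _ (@dlin n a) (@dlin_is_linear n a)).

Lemma dlin_continuous n a : continuous (@dlin n a).
Proof.
move=> x; apply: (cvg_sumr (nbhs_filter x)) => j.
apply: cvgM; last exact: cvg_cst.
exact: (@coord_continuous _ 1 n 0 j x).
Qed.

(** Moving from [x] to [x + v] along the coordinate axes, one at a time, reduces
the increment to one-dimensional mean value theorems. *)
Lemma C1_increment n (g : 'rV[R]_n -> R) (dg : 'I_n -> 'rV[R]_n -> R) x :
  (forall j, \forall y \near x, is_derive y (basis_vec j) g (dg j y)) ->
  (forall j, {for x, continuous (dg j)}) ->
  forall e, 0 < e -> \forall v \near (0 : 'rV[R]_n),
    `|g (v + x) - (g x + dlin (dg^~ x) v)| <= e * `|v|.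
Proof.
move=> gE dgc e e0.
pose e' := e / n.+1%:R; have e'0 : 0 < e' by rewrite divr_gt0.
have [r /= r0 hr] : exists2 r, 0 < r & forall y, `|y - x| < r -> forall j,
    is_derive y (basis_vec j) g (dg j y) /\ `|dg j y - dg j x| <= e'.
  have : \forall y \near x, forall j, is_derive y (basis_vec j) g (dg j y) /\
      `|dg j y - dg j x| <= e'.
    apply: (@filter_forall _ _ (fun j y => is_derive y (basis_vec j) g (dg j y) /\
      `|dg j y - dg j x| <= e') (nbhs x) (nbhs_filter x)) => j; near=> y; split; first by near: y; exact: gE.
    by rewrite distrC; near: y; move/cvgrPdist_le: (dgc j); exact.
  move=> /nbhs_ballP[r /= r0 hr]; exists r => // y yx; apply: hr.
  by rewrite -ball_normE/= distrC.
near=> v.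
have vr : `|v| < r.
  near: v; apply/nbhs_ballP; exists r => // w; rewrite -ball_normE/= sub0r normrN.
  exact.
(* The corners of the staircase from [x] to [x + v]. *)
pose S k : 'rV[R]_n := \row_j (if (j < k)%N then v 0 j else 0).
have S0 : S 0%N = 0 by apply/rowP => j; rewrite !mxE.
have Sn : S n = v by apply/rowP => j; rewrite !mxE ltn_ord.
have SS (k : 'I_n) : S k.+1 = S k + v 0 k *: basis_vec k.
  apply/rowP => j; rewrite !mxE ltnS leq_eqVlt.
  have [->|jk] := eqVneq j k; first by rewrite eqxx ltnn/= mulr1 add0r.
  by rewrite -val_eqE/= in jk; rewrite (negbTE jk)/= mulr0 addr0.
have Sv (k : 'I_n) s : `|s| <= `|v 0 k| -> `|S k + s *: basis_vec k| <= `|v|.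
  move=> sv; apply: norm_le_coord => // j; rewrite !mxE.
  have [->|jk] := eqVneq j k.
    by rewrite ltnn/= mulr1 add0r (le_trans sv)// coord_le_norm.
  by rewrite mulr0 addr0; case: ifPn => _; rewrite ?normr0// coord_le_norm.
have step (k : 'I_n) : `|g (x + S k.+1) - g (x + S k) - v 0 k * dg k x| <= e' * `|v|.
  have hd s : `|s| <= `|v 0 k| -> `|dg k (x + S k + s *: basis_vec k) - dg k x| <= e' /\
      is_derive s (1:R) (fun s => g (x + S k + s *: basis_vec k))
        (dg k (x + S k + s *: basis_vec k)).
    move=> sv; have yx : `|x + S k + s *: basis_vec k - x| < r.
      by rewrite -(addrA x) (addrC _ (- x)) addKr (le_lt_trans (Sv _ _ sv)).
    have [h1 h2] := hr _ yx k.
    by split => //; exact: is_derive_line.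
  have [c cv E] := MVT_sym (fun s sv => (hd s sv).2).
  rewrite SS addrA; rewrite scale0r addr0 in E; rewrite E mulrC -mulrBr normrM mulrC.
  by rewrite ler_pM// ?coord_le_norm//; case: (hd c cv).
have -> : g (v + x) - (g x + dlin (dg^~ x) v) =
    \sum_(k < n) (g (x + S k.+1) - g (x + S k) - v 0 k * dg k x).
  rewrite sumrB -(big_mkord xpredT (fun k => g (x + S k.+1) - g (x + S k))).
  by rewrite telescope_sumr// Sn S0 addr0 opprD addrA (addrC v).
apply: le_trans (ler_norm_sum _ _ _) _.
apply: (le_trans (ler_sum _ (fun k _ => step k))).
rewrite sumr_const card_ord -mulr_natl mulrA ler_wpM2r//.
rewrite /e' mulrCA ler_piMr ?(ltW e0)// ler_pdivrMr// mul1r ler_nat//.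
Unshelve. all: by end_near. Qed.

Lemma C1_differentiable n (g : 'rV[R]_n -> R) (dg : 'I_n -> 'rV[R]_n -> R) x :
  (forall j, \forall y \near x, is_derive y (basis_vec j) g (dg j y)) ->
  (forall j, {for x, continuous (dg j)}) ->
  differentiable g x /\ forall v, 'd g x v = \sum_j v 0 j * dg j x.
Proof.
move=> gE dgc.
have e : 'd g x = dlin (dg^~ x) :> ('rV[R]_n -> R).
  apply: (@diff_unique _ _ _ g (dlinL (dg^~ x))).
    exact: dlin_continuous.
  by apply/eqaddoP => eps eps0; exact: C1_increment.
split; last by move=> v; rewrite e.
apply/diff_locallyP; rewrite e; split; first exact: dlin_continuous.
by apply/eqaddoP => eps eps0; exact: C1_increment.
Qed.

(** Directional derivatives in a normed space are derivatives along a line, so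
that the chain rules below only have to be proved for curves. *)
Lemma is_derive_line0 (V : normedModType R) (f : V -> R) (x v : V) l :
  is_derive x v f l <-> is_derive (0 : R) (1 : R) (fun h : R => f (h *: v + x)) l.
Proof.
have e : (fun h : R => h^-1 *: (f (h *: v + x) - f x)) =
  (fun h => h^-1 *: (f ((h *: (1 : R) + 0) *: v + x) - f (0 *: v + x))).
  by apply/funext => h; rewrite addr0 scale0r add0r /GRing.scale/= mulr1.
split => -[df dfl]; split.
- by rewrite /derivable -e.
- by rewrite /derive -e.
- by rewrite /derivable e.
- by rewrite /derive e.
Qed.

Lemma is_derive_curve n (g : 'rV[R]_n -> R) (dg : 'I_n -> 'rV[R]_n -> R)
   (c : R -> 'rV[R]_n) (s : R) (dc : 'I_n -> R) :
  (forall j, \forall y \near c s, is_derive y (basis_vec j) g (dg j y)) ->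
  (forall j, {for c s, continuous (dg j)}) ->
  (forall j, is_derive s (1 : R) (fun s => c s 0 j) (dc j)) ->
  is_derive s (1 : R) (g \o c) (\sum_j dc j * dg j (c s)).
Proof.
move=> gE dgc cE.
have [dgx dgxE] := C1_differentiable gE dgc.
have derc : derivable c s 1.
  by apply/derivable_mxP => i j; rewrite ord1; case: (cE j).
have dcs : differentiable c s by exact/derivable1_diffP.
have dgcs : differentiable (g \o c) s by exact: differentiable_comp.
split; first exact/derivable1_diffP.
rewrite deriveE// diff_comp//= dgxE.
apply: eq_bigr => j _; rewrite -deriveE// derive_mx// mxE; congr (_ * _).
by case: (cE j).
Qed.

Lemma is_derive_comp_row (V : normedModType R) n (g : 'rV[R]_n -> R)
   (dg : 'I_n -> 'rV[R]_n -> R)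
   (u : V -> 'rV[R]_n) (x v : V) (du : 'I_n -> R) :
  (forall j, \forall y \near u x, is_derive y (basis_vec j) g (dg j y)) ->
  (forall j, {for u x, continuous (dg j)}) ->
  (forall j, is_derive x v (fun y => u y 0 j) (du j)) ->
  is_derive x v (g \o u) (\sum_j du j * dg j (u x)).
Proof.
move=> gE dgc uE; apply/is_derive_line0.
have e : u (0 *: v + x) = u x by rewrite scale0r add0r.
have := @is_derive_curve n g dg (fun h => u (h *: v + x)) 0 du.
rewrite /= e => H; apply: H => // j.
exact: (iffLR (is_derive_line0 (fun y => u y 0 j) x v _) (uE j)).
Qed.

Lemma is_derive_comp1 (V : normedModType R) (g : R -> R) (u : V -> R) (x v : V) (dg du : R) :
  is_derive (u x) (1 : R) g dg -> is_derive x v u du ->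
  is_derive x v (g \o u) (du * dg).
Proof.
move=> gE uE; apply/is_derive_line0.
have e : u (0 *: v + x) = u x by rewrite scale0r add0r.
have uE' := iffLR (is_derive_line0 _ _ _ _) uE.
rewrite -e in gE.
have dg0 := iffLR (derivable1_diffP _ _) (@ex_derive _ _ _ _ _ _ _ gE).
have du0 := iffLR (derivable1_diffP _ _) (@ex_derive _ _ _ _ _ _ _ uE').
have dgu : differentiable (g \o (fun h : R => u (h *: v + x))) 0.
  exact: differentiable_comp.
split; first exact/derivable1_diffP.
have du1 : derivable (fun h : R => u (h *: v + x)) 0 1 by case: uE'.
have dg1 : derivable g (u (0 *: v + x)) 1 by case: gE.
rewrite -derive1E (derive1_comp du1 dg1) !derive1E mulrC.
by congr (_ * _); [case: uE'|case: gE].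
Qed.

End C1.

Section for_continuous.
Context {R : realType} {X : topologicalType}.
Implicit Types f g : X -> R.

Lemma forc_cst (c : R) (x : X) : {for x, continuous (fun=> c)}.
Proof. exact: cvg_cst. Qed.

Lemma forcD f g x : {for x, continuous f} -> {for x, continuous g} ->
  {for x, continuous (fun y => f y + g y)}.
Proof. by move=> cf cg; apply: (@cvgD _ _ _ (nbhs x) (nbhs_filter x)). Qed.

Lemma forcM f g x : {for x, continuous f} -> {for x, continuous g} ->
  {for x, continuous (fun y => f y * g y)}.
Proof. by move=> cf cg; apply: (@cvgM _ _ (nbhs x) (nbhs_filter x)). Qed.

Lemma forcN f x : {for x, continuous f} -> {for x, continuous (fun y => - f y)}.
Proof. by move=> cf; apply: (@cvgN _ _ _ (nbhs x) (nbhs_filter x)). Qed.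

Lemma forcB f g x : {for x, continuous f} -> {for x, continuous g} ->
  {for x, continuous (fun y => f y - g y)}.
Proof. by move=> cf cg; apply: (@cvgB _ _ _ (nbhs x) (nbhs_filter x)). Qed.

Lemma forc_sum I (r : seq I) (f : I -> X -> R) x :
  (forall i, {for x, continuous (f i)}) ->
  {for x, continuous (fun y => \sum_(i <- r) f i y)}.
Proof. by move=> cf; exact: (@cvg_sumr R _ (nbhs x) (nbhs_filter x) _ _ f (f^~ x)). Qed.

Lemma forc_comp (h : R -> R) f x : {for x, continuous f} -> {for f x, continuous h} ->
  {for x, continuous (fun y => h (f y))}.
Proof. by move=> cf ch; apply: (@continuous_comp _ _ _ f h). Qed.

End for_continuous.

(** * Splines, bumps and cut-offs *)
Section bump.
Context {R : realType}.

Definition sqp (s : R) : R := Num.max s 0 ^+ 2.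

Lemma sqp_ge0 s : 0 <= sqp s. Proof. exact: sqr_ge0. Qed.

Lemma sqp_increment (s h : R) :
  `|sqp (h + s) - sqp s - 2 * Num.max s 0 * h| <= h ^+ 2.
Proof.
rewrite /sqp ler_norml; case: (leP (h + s) 0) => hs; case: (leP s 0) => s0;
  apply/andP; split; nra.
Qed.

Lemma is_derive_sqp (s : R) : is_derive s (1 : R) sqp (2 * Num.max s 0).
Proof.
suff H : h^-1 *: (sqp (h *: (1 : R) + s) - sqp s) @[h --> 0^'] --> 2 * Num.max s 0.
  by split; [apply/cvg_ex; exists (2 * Num.max s 0)|apply/cvg_lim].
apply/cvgrPdist_le => e e0; near=> h.
have h0 : h != 0 by near: h; exact: nbhs_dnbhs_neq.
rewrite /GRing.scale/= mulr1.
have -> : 2 * Num.max s 0 - h^-1 * (sqp (h + s) - sqp s) =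
    - (h^-1 * (sqp (h + s) - sqp s - 2 * Num.max s 0 * h)).
  by field.
rewrite normrN normrM normfV ler_pdivrMl ?normr_gt0//.
apply: (le_trans (sqp_increment _ _)).
rewrite -real_normK ?num_real// expr2 ler_wpM2l//.
by near: h; apply: dnbhs0_le.
Unshelve. all: by end_near. Qed.

Lemma continuous_max0 : continuous (fun s : R => Num.max s 0).
Proof. by move=> s; apply: continuous_max; [exact: cvg_id|exact: cvg_cst]. Qed.

(** The C^1 transition from [0] for [s <= 0] to [1] for [2 <= s], piecewise
quadratic; its derivative is the hat function [dspline]. *)
Definition spline (s : R) := (sqp s - 2 * sqp (s - 1) + sqp (s - 2)) / 2.
Definition dspline (s : R) := Num.max s 0 - 2 * Num.max (s - 1) 0 + Num.max (s - 2) 0.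

Ltac spline_cases s :=
  rewrite /spline /dspline /sqp; case: (leP s 0) => ?; case: (leP (s - 1) 0) => ?;
  case: (leP (s - 2) 0) => ?; nra.

Lemma spline_ge0 s : 0 <= spline s.
Proof. spline_cases s. Qed.

Lemma spline_le1 s : spline s <= 1.
Proof. spline_cases s. Qed.

Lemma spline_0 s : s <= 0 -> spline s = 0.
Proof. move=> s0; spline_cases s. Qed.

Lemma spline_1 s : 2 <= s -> spline s = 1.
Proof. move=> s0; spline_cases s. Qed.

Lemma dspline_ge0 s : 0 <= dspline s.
Proof. spline_cases s. Qed.

Lemma dspline_0 s : s <= 0 -> dspline s = 0.
Proof. move=> s0; spline_cases s. Qed.

Lemma dspline_2 s : 2 <= s -> dspline s = 0.
Proof. move=> s0; spline_cases s. Qed.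

Lemma is_derive_spline (s : R) : is_derive s (1 : R) spline (dspline s).
Proof.
have shift c : is_derive s (1 : R) (fun t => sqp (t - c)) (2 * Num.max (s - c) 0).
  have -> : 2 * Num.max (s - c) 0 = (1 - 0) * (2 * Num.max (s - c) 0) by rewrite subr0 mul1r.
  apply: (@is_derive_comp1 R R sqp (fun t => t - c)); first exact: is_derive_sqp.
have -> : spline = 2^-1 \*: ((sqp - 2 \*: (fun t => sqp (t - 1))) + (fun t => sqp (t - 2))).
  by apply/funext => t; rewrite /spline/= !fctE /GRing.scale/= mulrC.
have S0 := is_derive_sqp s; have S1 := shift 1; have S2 := shift 2.
apply: is_derive_eq.
by rewrite /GRing.scale/= /dspline; field.
Qed.

Lemma continuous_dspline : continuous dspline.
Proof.
move=> s; have sh (c : R) : {for s, continuous (fun t : R => Num.max (t - c) 0)}.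
  apply: (@continuous_comp _ _ _ (fun t : R => t - c) (fun t : R => Num.max t 0)).
    by apply: cvgB; [exact: cvg_id|exact: cvg_cst].
  exact: continuous_max0.
apply: cvgD; last exact: sh.
apply: cvgB; first exact: continuous_max0.
by apply: cvgM; [exact: cvg_cst|exact: sh].
Qed.

Lemma continuous_spline : continuous spline.
Proof. by move=> s; apply: is_derive_continuous; exact: is_derive_spline. Qed.

Context {n : nat}.
Local Notation V := 'rV[R]_n.
Implicit Types (x y : V) (r : R).

(** The Euclidean ball around [x0] of radius [r] is where [quad x0 (r ^+ 2)] is
positive, and its squared positive part is a C^1 bump on that ball. *)
Definition quad (x0 : V) r x := r - \sum_j (x 0 j - x0 0 j) ^+ 2.
Definition bump x0 r x := sqp (quad x0 r x).
Definition dbump x0 r (j : 'I_n) x := - (2 * (x 0 j - x0 0 j)) * (2 * Num.max (quad x0 r x) 0).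

Lemma is_derive_coord (i j : 'I_n) x : is_derive x (basis_vec j) (fun y : V => y 0 i) ((i == j)%:R : R).
Proof.
have -> : (i == j)%:R = (basis_vec j : V) 0 i by rewrite mxE eqxx/=.
split.
  have /derivable_mxP := @derivable_id R V x (basis_vec j); exact.
by have /(congr1 (fun M : V => M 0 i)) := @derive_id R V x (basis_vec j);
   rewrite derive_mx ?mxE//; exact: derivable_id.
Qed.

Lemma is_derive_quad x0 r (j : 'I_n) x : is_derive x (basis_vec j) (quad x0 r) (- (2 * (x 0 j - x0 0 j))).
Proof.
have h i : is_derive x (basis_vec j) (fun y : V => (y 0 i - x0 0 i) ^+ 2)
    (2 * (x 0 i - x0 0 i) * (i == j)%:R).
  have hi : is_derive x (basis_vec j) (fun y : V => y 0 i - x0 0 i) ((i == j)%:R - 0).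
    by apply: (@is_deriveB _ _ _ (fun y : V => y 0 i) (cst (x0 0 i))); exact: is_derive_coord.
  have -> : (fun y : V => (y 0 i - x0 0 i) ^+ 2) = (fun y : V => y 0 i - x0 0 i) ^+ 2.
    by apply/funext => y; rewrite exprfctE.
  by apply: is_derive_eq; rewrite subr0 expr1 /GRing.scale/= mulr_natl.
have -> : quad x0 r = cst r - \sum_(i < n) (fun y : V => (y 0 i - x0 0 i) ^+ 2).
  by apply/funext => y; rewrite /quad !fctE fct_sumE.
apply: is_derive_eq; rewrite sub0r; congr (- _).
rewrite (bigD1 j)//= eqxx mulr1 big1 ?addr0// => i /negbTE ->.
by rewrite mulr0.
Qed.

Lemma continuous_coordB (j : 'I_n) (c : R) : continuous (fun y : V => y 0 j - c).
Proof.
move=> x; apply: (@cvgB _ _ _ (nbhs x) (nbhs_filter x)); last exact: cvg_cst.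
exact: (@coord_continuous _ 1 n 0 j x).
Qed.

Lemma continuous_quad x0 r : continuous (quad x0 r).
Proof.
move=> x; apply: forcB; first exact: forc_cst.
apply: (forc_sum (f := fun j (y : V) => (y 0 j - x0 0 j) ^+ 2)) => j.
exact: (forcM (@continuous_coordB j (x0 0 j) x) (@continuous_coordB j (x0 0 j) x)).
Qed.

Lemma is_derive_bump x0 r j x : is_derive x (basis_vec j) (bump x0 r) (dbump x0 r j x).
Proof. by apply: is_derive_comp1; [exact: is_derive_sqp|exact: is_derive_quad]. Qed.

Lemma continuous_bump x0 r : continuous (bump x0 r).
Proof.
move=> x; apply: (@continuous_comp _ _ _ (quad x0 r) sqp); first exact: continuous_quad.
by apply: is_derive_continuous; exact: is_derive_sqp.
Qed.

Lemma continuous_dbump x0 r j : continuous (dbump x0 r j).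
Proof.
move=> x; apply: (@forcM _ _ (fun y => - (2 * (y 0 j - x0 0 j)))
  (fun y => 2 * Num.max (quad x0 r y) 0)).
  by apply: forcN; apply: forcM; [exact: forc_cst|exact: continuous_coordB].
apply: forcM; first exact: forc_cst.
apply: (@forc_comp _ _ (fun t => Num.max t 0)); first exact: continuous_quad.
exact: continuous_max0.
Qed.

Lemma bump0 x0 r x : quad x0 r x <= 0 -> bump x0 r x = 0.
Proof. by rewrite /bump /sqp => /max_idPr ->; rewrite expr0n. Qed.

Lemma dbump0 x0 r j x : quad x0 r x <= 0 -> dbump x0 r j x = 0.
Proof. by rewrite /dbump /sqp => /max_idPr ->; rewrite !mulr0. Qed.

Lemma bump_gt0 x0 r x : 0 < quad x0 r x -> 0 < bump x0 r x.
Proof. by rewrite /bump /sqp => q; rewrite max_l ?ltW// exprn_gt0. Qed.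

Lemma quad_ge0_near x0 r x : 0 < r -> 0 <= quad x0 (r ^+ 2) x -> `|x - x0| <= r.
Proof.
move=> r0; rewrite /quad subr_ge0 => h; apply: norm_le_coord; first exact: ltW.
move=> j; rewrite !mxE -ler_sqr ?nnegrE//; last exact: ltW.
rewrite real_normK ?num_real//.
apply: le_trans h; rewrite (bigD1 j)//= lerDl sumr_ge0// => i _; exact: sqr_ge0.
Qed.

Lemma compact_quad x0 r : 0 < r -> compact [set x | 0 <= quad x0 (r ^+ 2) x].
Proof.
move=> r0; apply: bounded_closed_compact.
  exists (`|x0| + r); split; first exact: num_real.
  move=> M rM x /(quad_ge0_near r0) h /=.
  rewrite -(subrK x0 x) (le_trans (ler_normD _ _))// addrC (le_trans _ (ltW rM))//.
  by rewrite lerD2l.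
apply: (@closed_comp _ _ (quad x0 (r ^+ 2)) [set y | 0 <= y]); last exact: closed_ge.
by move=> x _; exact: continuous_quad.
Qed.

End bump.

Section bounded_on.
Context {R : realType} {X : Type}.
Implicit Types (D : set X) (f g : X -> R).

Definition bounded_on D g := exists M, forall x, D x -> `|g x| <= M.

Lemma bounded_on_pos D g : bounded_on D g -> exists2 M, 0 < M & forall x, D x -> `|g x| <= M.
Proof.
move=> [M hM]; exists (`|M| + 1); first by rewrite ltr_wpDl.
by move=> x /hM h; apply: (le_trans h); rewrite (le_trans (ler_norm M))// lerDl.
Qed.

Lemma bounded_onS D D' g : D `<=` D' -> bounded_on D' g -> bounded_on D g.
Proof. by move=> DD [M h]; exists M => x /DD; exact: h. Qed.

Lemma bounded_onD D f g : bounded_on D f -> bounded_on D g -> bounded_on D (fun x => f x + g x).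
Proof.
move=> [M h] [M' h']; exists (M + M') => x Dx; rewrite (le_trans (ler_normD _ _))//.
by rewrite lerD ?h ?h'.
Qed.

Lemma bounded_onM D f g : bounded_on D f -> bounded_on D g -> bounded_on D (fun x => f x * g x).
Proof.
by move=> [M h] [M' h']; exists (M * M') => x Dx; rewrite normrM ler_pM ?h ?h'.
Qed.

Lemma bounded_onN D f : bounded_on D f -> bounded_on D (fun x => - f x).
Proof. by move=> [M h]; exists M => x Dx; rewrite normrN h. Qed.

Lemma bounded_onB D f g : bounded_on D f -> bounded_on D g -> bounded_on D (fun x => f x - g x).
Proof. by move=> bf bg; apply: bounded_onD => //; exact: bounded_onN. Qed.

Lemma bounded_on_sum I (r : seq I) D (f : I -> X -> R) :
  (forall i, bounded_on D (f i)) -> bounded_on D (fun x => \sum_(i <- r) f i x).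
Proof.
move=> h; elim: r => [|i r [M IH]].
  by exists 0 => x _; rewrite big_nil normr0.
have [M' h'] := h i; exists (M' + M) => x Dx; rewrite big_cons.
by rewrite (le_trans (ler_normD _ _))// lerD ?h' ?IH.
Qed.

End bounded_on.

Section cont_on.
Context {R : realType} {X : topologicalType}.
Implicit Types (D : set X) (f g : X -> R).

Lemma compact_bounded_on D g : compact D -> {within D, continuous g} -> bounded_on D g.
Proof.
move=> cD cg; have := compact_bounded (continuous_compact cg cD).
move=> [M [_ h]]; exists (M + 1) => x Dx.
by apply: (h (M + 1)); [rewrite ltrDl|exists x].
Qed.

Lemma for_within D g : (forall x, D x -> {for x, continuous g}) -> {within D, continuous g}.
Proof. by move=> h; apply: continuous_in_subspaceT => x; rewrite inE; exact: h. Qed.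

Lemma within_for D D' g x : {within D, continuous g} -> open D' -> D' `<=` D -> D' x ->
  {for x, continuous g}.
Proof.
move=> /subspace_continuousP cg oD DD Dx.
have := cg x (DD _ Dx); rewrite /prop_for /continuous_at.
suff -> : within D (nbhs x) = nbhs x by [].
apply/seteqP; split=> A /=; last by move=> nA; apply: filterS nA => y.
rewrite /within/= => nA; have nD : nbhs x D' by exact: open_nbhs_nbhs.
by apply: filterS2 nA nD => y hA /DD; exact: hA.
Qed.

End cont_on.

Lemma forc_near (R : realType) (X : topologicalType) (f g : X -> R) x :
  {for x, continuous f} -> (\forall y \near x, f y = g y) -> {for x, continuous g}.
Proof.
rewrite /prop_for /continuous_at => cf E; rewrite -(nbhs_singleton E).
by apply: cvg_trans cf; exact: near_eq_cvg.
Qed.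

(** * The divergence theorem near a point *)
Section cutoff.
Context {R : realType} {n : nat}.
Local Notation V := 'rV[R]_n.
Variables (Om U : set V) (rho : V -> R) (drho : 'I_n -> V -> R) (x0 : V) (r : R).
Hypotheses (oOm : open Om) (bOm : bounded_set Om) (oU : open U)
  (UOm : U `&` Om = U `&` [set x | rho x < 0])
  (rhoC : forall x, U x -> {for x, continuous rho})
  (rhoD : forall j x, U x -> is_derive x (basis_vec j) rho (drho j x))
  (drhoC : forall j x, U x -> {for x, continuous (drho j)})
  (r0 : 0 < r)
  (QU : [set x | 0 <= quad x0 (r ^+ 2) x] `<=` U).

Let W := U `&` Om.
Let oW : open W. Proof. exact: openI. Qed.
Let bW : bounded_set W.
Proof. by move: bOm => [M [Mr h]]; exists M; split => // m /h hm x [_]; exact: hm. Qed.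
Let Q := [set x : V | 0 <= quad x0 (r ^+ 2) x].
Let b := bump x0 (r ^+ 2).
Let db := dbump x0 (r ^+ 2).
Let WQ := W `&` Q.

Lemma BM_W g : (forall x, W x -> {for x, continuous g}) -> bounded_on WQ g ->
  (forall x, quad x0 (r ^+ 2) x < 0 -> g x = 0) -> BM (g \_ W).
Proof.
move=> cg /bounded_on_pos[M M0 hM] g0; apply: BM_restrict => //.
exists M => x Wx; have [q|q] := leP 0 (quad x0 (r ^+ 2) x); first exact: hM.
by rewrite g0// normr0 ltW.
Qed.

Let cQ : compact Q. Proof. exact: compact_quad. Qed.

Let bdQ (g : V -> R) : (forall x, U x -> {for x, continuous g}) -> bounded_on WQ g.
Proof.
move=> cg; apply: (@bounded_onS _ _ _ Q) => [x []//|].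
by apply: compact_bounded_on => //; apply: for_within => x /QU; exact: cg.
Qed.

(** [eta k] vanishes where [- k^-1 <= rho] and equals [1] where
[rho <= - 3 / k], so [eta k] times a function on [Om] is extended by zero
through the boundary without loss of regularity.  The derivative in the
direction [j] is [- rate k * drho j]. *)
Definition eta (k : R) x := spline (- k * rho x - 1).
Definition rate (k : R) x := k * dspline (- k * rho x - 1).

Let argC k x : U x -> {for x, continuous (fun y => - k * rho y - 1)}.
Proof.
by move=> Ux; apply: forcB; [apply: forcM; [exact: forc_cst|exact: rhoC]|exact: forc_cst].
Qed.

Lemma etaC k x : U x -> {for x, continuous (eta k)}.
Proof.
by move=> Ux; apply: (@forc_comp _ _ spline); [exact: argC|exact: continuous_spline].
Qed.

Lemma rateC k x : U x -> {for x, continuous (rate k)}.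
Proof.
move=> Ux; apply: (@forcM _ _ (fun=> k)); first exact: forc_cst.
by apply: (@forc_comp _ _ dspline); [exact: argC|exact: continuous_dspline].
Qed.

Lemma etaD k j x : U x -> is_derive x (basis_vec j) (eta k) (- rate k x * drho j x).
Proof.
move=> Ux; have h : is_derive x (basis_vec j) (fun y => - k * rho y - 1) (- k * drho j x - 0).
  have hr := rhoD j Ux.
  have -> : (fun y => - k * rho y - 1) = - k \*: rho - cst 1 by [].
  by apply: is_derive_eq.
have -> : - rate k x * drho j x = (- k * drho j x - 0) * dspline (- k * rho x - 1).
  by rewrite /rate; ring.
by apply: (@is_derive_comp1 _ _ spline); exact: is_derive_spline.
Qed.

Variable G dG : 'I_n -> V -> R.
Hypotheses (GC : forall j x, W x -> {for x, continuous (G j)})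
  (dGC : forall j x, W x -> {for x, continuous (dG j)})
  (GD : forall j x, W x -> is_derive x (basis_vec j) (G j) (dG j x))
  (Gb : forall j, bounded_on WQ (G j)) (dGb : forall j, bounded_on WQ (dG j)).

(** With [b] the bump at [x0]: [divb] is the divergence of the field [b G], and
[fluxb] its component along the gradient of [rho]. *)
Definition divb x := \sum_j (db j x * G j x + b x * dG j x).
Definition fluxb x := b x * \sum_j G j x * drho j x.

Let WU x : W x -> U x. Proof. by case. Qed.

Lemma BM_divb : BM (divb \_ W).
Proof.
apply: BM_W.
- move=> x Wx; apply: (forc_sum (f := fun j x => db j x * G j x + b x * dG j x)) => j.
  apply: forcD; apply: forcM; [exact: continuous_dbump|exact: GC|exact: continuous_bump|exact: dGC].
- apply: bounded_on_sum => j; apply: bounded_onD; apply: bounded_onM => //.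
    by apply: bdQ => x _; exact: continuous_dbump.
  by apply: bdQ => x _; exact: continuous_bump.
- by move=> x /ltW q; rewrite /divb big1// => j _; rewrite /db /b dbump0// bump0// !mul0r addr0.
Qed.

Lemma BM_eta_divb k : BM ((fun x => eta k x * divb x) \_ W).
Proof.
apply: BM_W.
- move=> x Wx; apply: forcM; first exact/etaC/WU.
  apply: (forc_sum (f := fun j x => db j x * G j x + b x * dG j x)) => j.
  apply: forcD; apply: forcM; [exact: continuous_dbump|exact: GC|exact: continuous_bump|exact: dGC].
- apply: bounded_onM; first by apply: bdQ => x; exact: etaC.
  apply: bounded_on_sum => j; apply: bounded_onD; apply: bounded_onM => //.
    by apply: bdQ => x _; exact: continuous_dbump.
  by apply: bdQ => x _; exact: continuous_bump.
- move=> x /ltW q; rewrite /divb big1 ?mulr0// => j _.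
  by rewrite /db /b dbump0// bump0// !mul0r addr0.
Qed.

Lemma BM_rate_fluxb k : BM ((fun x => rate k x * fluxb x) \_ W).
Proof.
apply: BM_W.
- move=> x Wx; apply: forcM; first exact/rateC/WU.
  apply: forcM; first exact: continuous_bump.
  apply: (forc_sum (f := fun j x => G j x * drho j x)) => j.
  by apply: forcM; [exact: GC|exact/drhoC/WU].
- apply: bounded_onM; first by apply: bdQ => x; exact: rateC.
  apply: bounded_onM; first by apply: bdQ => x _; exact: continuous_bump.
  apply: bounded_on_sum => j; apply: bounded_onM => //.
  by apply: bdQ => x; exact: drhoC.
- by move=> x /ltW q; rewrite /fluxb /b bump0// mul0r mulr0.
Qed.

(** The field [eta k * b * G] has compact support in [W], hence its divergence
[eta k * divb - rate k * fluxb] integrates to zero. *)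
Lemma Int_cutoff (k : R) : 0 < k ->
  Int ((fun x => eta k x * divb x) \_ W) = Int ((fun x => rate k x * fluxb x) \_ W).
Proof.
move=> k0.
pose g j := (fun x => b x * G j x * eta k x) \_ W.
pose h j x := db j x * G j x * eta k x + b x * dG j x * eta k x
  - b x * G j x * (rate k x * drho j x).
pose dg j := h j \_ W.
have hC j x : W x -> {for x, continuous (h j)}.
  move=> Wx; apply: forcB; [apply: forcD|].
  - apply: forcM; last exact/etaC/WU.
    by apply: forcM; [exact: continuous_dbump|exact: GC].
  - apply: forcM; last exact/etaC/WU.
    by apply: forcM; [exact: continuous_bump|exact: dGC].
  - apply: forcM; first by apply: forcM; [exact: continuous_bump|exact: GC].
    by apply: forcM; [exact/rateC/WU|exact/drhoC/WU].
have BMdg j : BM (dg j).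
  apply: BM_W.
  - by move=> x; exact: hC.
  - apply: bounded_onB; [apply: bounded_onD|].
    + apply: bounded_onM; last by apply: bdQ => x; exact: etaC.
      by apply: bounded_onM => //; apply: bdQ => x _; exact: continuous_dbump.
    + apply: bounded_onM; last by apply: bdQ => x; exact: etaC.
      by apply: bounded_onM => //; apply: bdQ => x _; exact: continuous_bump.
    + apply: bounded_onM.
        by apply: bounded_onM => //; apply: bdQ => x _; exact: continuous_bump.
      by apply: bounded_onM; [apply: bdQ => x; exact: rateC|apply: bdQ => x; exact: drhoC].
  - by move=> x /ltW q; rewrite /h /db /b dbump0// bump0// !mul0r addr0 subr0.
(* Near a point off [W], either [eta k] vanishes because [rho > - k^-1], or the
   bump does: extension by zero keeps the field C^1. *)
have zero_near x : ~ W x -> \forall y \near x, forall j, g j y = 0 /\ dg j y = 0.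
  move=> nWx; have [Ux|nUx] := pselect (U x).
    have rx : 0 <= rho x.
      rewrite leNgt; apply/negP => rx; apply: nWx.
      by have : (U `&` [set x | rho x < 0]) x by []; rewrite -UOm.
    near=> y => j.
    have Uy : U y by near: y; exact: open_nbhs_nbhs.
    have ry : - k^-1 < rho y.
      near: y; apply: (cvgr_gt (rho x)); first exact: rhoC.
      by rewrite (lt_le_trans _ rx)// oppr_lt0 invr_gt0.
    have arg : - k * rho y - 1 <= 0.
      rewrite mulNr subr_le0 -mulrN -ler_pdivlMl// mulr1 lerNl; exact: ltW.
    rewrite /g /dg !patchE; case: ifPn => // _; rewrite /h /eta /rate.
    by rewrite spline_0// dspline_0// !mulr0 mul0r mulr0 addr0 subr0.
  have qx : quad x0 (r ^+ 2) x < 0.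
    by rewrite ltNge; apply/negP => /QU.
  near=> y => j.
  have qy : quad x0 (r ^+ 2) y <= 0.
    apply: ltW; near: y; apply: (cvgr_lt (quad x0 (r ^+ 2) x)) => //.
    exact: continuous_quad.
  rewrite /g /dg !patchE; case: ifPn => // _.
  by rewrite /h /db /b dbump0// bump0// !mul0r addr0 subr0.
have near_W x : W x -> \forall y \near x, forall j : 'I_n,
    b y * G j y * eta k y = g j y /\ h j y = dg j y.
  move=> Wx; have : nbhs x W by exact: open_nbhs_nbhs.
  by apply: filterS => y Wy j; rewrite /g /dg !patchE mem_set.
have dgE j x : is_derive x (basis_vec j) (g j) (dg j x).
  have [Wx|nWx] := pselect (W x).
    apply: (@near_eq_is_derive _ _ _ (fun y => b y * G j y * eta k y)).
      by apply: filterS (near_W x Wx) => y /(_ j)[].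
    have -> : dg j x = h j x by have [_ <-] := nbhs_singleton (near_W x Wx) j.
    have h1 : is_derive x (basis_vec j) b (db j x) by exact: is_derive_bump.
    have h2 := GD j Wx. have h3 := @etaD k j x (WU Wx).
    have -> : (fun y => b y * G j y * eta k y) = b * G j * eta k by [].
    apply: is_derive_eq; rewrite /GRing.scale/= /h.
    change ((b * G j) x) with (b x * G j x); ring.
  apply: (@near_eq_is_derive _ _ _ (cst 0)).
    by apply: filterS (zero_near x nWx) => y /(_ j)[].
  have [_ ->] := nbhs_singleton (zero_near x nWx) j.
  exact: is_derive_cst.
have dgC j : continuous (dg j).
  move=> x; have [Wx|nWx] := pselect (W x).
    apply: (forc_near (hC j x Wx)).
    by apply: filterS (near_W x Wx) => y /(_ j)[].
  apply: (@forc_near _ _ (fun=> 0)); first exact: forc_cst.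
  by apply: filterS (zero_near x nWx) => y /(_ j)[].
have [M WM] := bounded_rowP bW.
have I0 j : Int (dg j) = 0.
  apply: (@Int_derive0 _ _ (g j) (dg j) j M) => //.
    move=> x s; apply: (@continuous_comp _ _ _ (fun s : R => x + s *: basis_vec j) (dg j)); last exact: dgC.
    apply: (@cvgD _ _ _ (nbhs s) (nbhs_filter s)); first exact: cvg_cst.
    exact: scalel_continuous.
  by move=> x; rewrite /g patchE; case: ifPn; [rewrite inE => /WM ? _|rewrite eqxx].
have : Int (fun x => \sum_j dg j x) = 0 by rewrite Int_sum// big1.
have -> : (fun x => \sum_j dg j x) = (fun x => ((fun x => eta k x * divb x) \_ W) x
    - ((fun x => rate k x * fluxb x) \_ W) x).
  apply/funext => x; rewrite /dg !patchE.
  under eq_bigr do rewrite patchE.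
  case: ifPn => _; last by rewrite big1 ?subr0.
  rewrite /h sumrB /divb /fluxb; congr (_ - _).
    by rewrite mulr_sumr; apply: eq_bigr => j _; ring.
  by rewrite !mulr_sumr; apply: eq_bigr => j _; ring.
rewrite IntB; [|exact: BM_eta_divb|exact: BM_rate_fluxb].
by move/eqP; rewrite subr_eq0 => /eqP.
Unshelve. all: by end_near. Qed.

End cutoff.

Section local.
Context {R : realType} {n : nat}.
Local Notation V := 'rV[R]_n.
Variables (Om U : set V) (rho : V -> R) (drho ddrho : 'I_n -> V -> R) (x0 : V) (r : R).
Hypotheses (oOm : open Om) (bOm : bounded_set Om) (oU : open U)
  (UOm : U `&` Om = U `&` [set x | rho x < 0])
  (rhoC : forall x, U x -> {for x, continuous rho})
  (rhoD : forall j x, U x -> is_derive x (basis_vec j) rho (drho j x))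
  (drhoC : forall j x, U x -> {for x, continuous (drho j)})
  (drhoD : forall j x, U x -> is_derive x (basis_vec j) (drho j) (ddrho j x))
  (ddrhoC : forall j x, U x -> {for x, continuous (ddrho j)})
  (grad_gt0 : forall x, U x -> 0 < \sum_j drho j x ^+ 2)
  (r0 : 0 < r)
  (QU : [set x | 0 <= quad x0 (r ^+ 2) x] `<=` U).
Let W := U `&` Om.
Let Q := [set x : V | 0 <= quad x0 (r ^+ 2) x].
Let b := bump x0 (r ^+ 2).
Variable G dG : 'I_n -> V -> R.
Hypotheses (GC : forall j x, W x -> {for x, continuous (G j)})
  (dGC : forall j x, W x -> {for x, continuous (dG j)})
  (GD : forall j x, W x -> is_derive x (basis_vec j) (G j) (dG j x))
  (Gb : forall j, bounded_on (W `&` Q) (G j)) (dGb : forall j, bounded_on (W `&` Q) (dG j))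
  (flux_small : forall delta, 0 < delta -> exists2 kappa, 0 < kappa &
     forall x, W x -> Q x -> - kappa <= rho x -> `|\sum_j G j x * drho j x| <= delta).

Let cQ : compact Q. Proof. exact: compact_quad. Qed.
Let WU x : W x -> U x. Proof. by case. Qed.

Let bdQ (g : V -> R) : (forall x, U x -> {for x, continuous g}) -> bounded_on (W `&` Q) g.
Proof.
move=> cg; apply: (@bounded_onS _ _ _ Q) => [x []//|].
by apply: compact_bounded_on => //; apply: for_within => x /QU; exact: cg.
Qed.

Lemma rate_ge0 k x : 0 <= k -> 0 <= rate rho k x.
Proof. by move=> k0; rewrite /rate mulr_ge0// dspline_ge0. Qed.

Lemma BM_rate k : BM ((fun x => rate rho k x * b x) \_ W).
Proof.
apply: (@BM_W _ _ _ _ x0 r) => //.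
- by move=> x Wx; apply: forcM; [exact: rateC (WU Wx)|exact: continuous_bump].
- by apply: bounded_onM; apply: bdQ => x Ux; [exact: rateC Ux|exact: continuous_bump].
- by move=> x /ltW q; rewrite /b bump0// mulr0.
Qed.

Let drhob j : bounded_on (W `&` Q) (drho j). Proof. by apply: bdQ => x; exact: drhoC. Qed.
Let ddrhob j : bounded_on (W `&` Q) (ddrho j). Proof. by apply: bdQ => x; exact: ddrhoC. Qed.

Let drhoCW j x : W x -> {for x, continuous (drho j)}. Proof. by move=> /WU; exact: drhoC. Qed.
Let ddrhoCW j x : W x -> {for x, continuous (ddrho j)}. Proof. by move=> /WU; exact: ddrhoC. Qed.
Let drhoDW j x : W x -> is_derive x (basis_vec j) (drho j) (ddrho j x).
Proof. by move=> /WU; exact: drhoD. Qed.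

(** [rate k * b] is an approximate surface measure.  Its mass is bounded
independently of [k]: apply [Int_cutoff] to the gradient of [rho] itself, whose
flux is bounded below by a positive multiple of [b]. *)
Lemma rate_mass : exists2 C, 0 <= C & forall k, 0 < k -> Int ((fun x => rate rho k x * b x) \_ W) <= C.
Proof.
have [M M0 hM] : exists2 M, 0 < M & forall x, Q x -> `|(\sum_j drho j x ^+ 2)^-1| <= M.
  apply: bounded_on_pos; apply: compact_bounded_on => //; apply: for_within => x /QU Ux.
  apply: (@forc_comp _ _ (fun t => t^-1)).
    apply: (forc_sum (f := fun j x => drho j x * drho j x)) => j.
    by apply: forcM; exact: drhoC.
  by apply: (@cvgV _ _ (nbhs _) (nbhs_filter _)); [rewrite gt_eqF// grad_gt0|exact: cvg_id].
have Mgrad x : Q x -> 1 <= M * \sum_j drho j x ^+ 2.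
  move=> Qx; have := hM x Qx; have g0 := grad_gt0 (QU Qx).
  by rewrite ger0_norm ?invr_ge0 ?(ltW g0)// -ler_pdivrMr// mul1r.
have B1 := BM_eta_divb oOm bOm oU rhoC r0 QU drhoCW
  ddrhoCW drhob ddrhob.
have B2 := BM_divb oOm bOm oU r0 QU drhoCW
  ddrhoCW drhob ddrhob.
have B3 := BM_rate_fluxb oOm bOm oU rhoC drhoC r0 QU
   drhoCW drhob.
exists (M * Int (fun x => `|(divb x0 r drho ddrho \_ W) x|)).
  by rewrite mulr_ge0 ?(ltW M0)// Int_ge0.
move=> k k0.
have L1 := Int_cutoff oOm bOm oU UOm rhoC rhoD drhoC r0 QU drhoCW
  ddrhoCW drhoDW drhob ddrhob k0.
apply: (@le_trans _ _ (M * Int ((fun x => rate rho k x * fluxb drho x0 r drho x) \_ W))).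
  rewrite -IntZ; last exact: B3.
  apply: le_Int; [exact: BM_rate|exact/BMZ/B3|move=> x; rewrite !patchE].
  case: ifPn => [|_]; last by rewrite mulr0.
  rewrite inE => Wx; have [q|q] := leP 0 (quad x0 (r ^+ 2) x); last first.
    by rewrite /fluxb /b bump0 ?mul0r ?mulr0// ltW.
  rewrite /fluxb -/b.
  have -> : M * (rate rho k x * (b x * (\sum_j drho j x * drho j x))) =
    (rate rho k x * b x) * (M * \sum_j drho j x ^+ 2).
    by under [in RHS]eq_bigr do rewrite expr2; ring.
  rewrite ler_peMr// ?Mgrad// mulr_ge0 ?rate_ge0 ?(ltW k0)//.
  exact: sqp_ge0.
rewrite ler_wpM2l ?(ltW M0)// -L1.
apply: (le_trans (ler_norm _)); apply: (le_trans (Int_norm (B1 k))).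
apply: le_Int; [exact/BM_norm/B1|exact: BM_norm|move=> x; rewrite !patchE].
case: ifPn => _; last by rewrite normr0.
by rewrite normrM ler_piMl// ger0_norm ?spline_ge0 ?spline_le1.
Qed.

(** Let [k] tend to infinity in [Int_cutoff].  The left side converges by
dominated convergence; on the right, [rate k] lives where [rho >= - 3 / k],
where the flux is small, and has bounded mass. *)
Lemma local_divergence : Int (divb x0 r G dG \_ W) = 0.
Proof.
have [C C0 hC] := rate_mass.
have B1 := BM_eta_divb oOm bOm oU rhoC r0 QU GC dGC Gb dGb.
have B2 := BM_divb oOm bOm oU r0 QU GC dGC Gb dGb.
have B3 := BM_rate_fluxb oOm bOm oU rhoC drhoC r0 QU GC Gb.
have lim : Int ((fun x => eta rho k.+1%:R x * divb x0 r G dG x) \_ W) @[k --> \oo] -->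
    Int (divb x0 r G dG \_ W).
  have [_ [M MB]] := B2.
  have [//|k|x|//] := @Int_dominated R n
    (fun k => (fun x => eta rho k.+1%:R x * divb x0 r G dG x) \_ W) (divb x0 r G dG \_ W) M.
  - have le x : `|((fun x => eta rho k.+1%:R x * divb x0 r G dG x) \_ W) x| <=
        `|(divb x0 r G dG \_ W) x|.
      rewrite !patchE; case: ifPn => // _.
      by rewrite normrM ler_piMl// ger0_norm ?spline_ge0 ?spline_le1.
    split=> x; first by apply: le_trans (le x) _; case: MB.
    move=> nz; case: MB => _; apply.
    by rewrite -normr_gt0 (lt_le_trans _ (le x))// normr_gt0.
  - rewrite [X in _ --> X]patchE; case: ifPn => [|nW].
      rewrite inE => Wx.
      have rx : rho x < 0.
        by have : (U `&` Om) x by []; rewrite UOm => -[].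
      apply: cvg_near_cst; near=> k.
      rewrite patchE mem_set// /eta spline_1 ?mul1r//.
      rewrite lerBrDr mulNr -mulrN -ler_pdivrMr ?oppr_gt0//.
      rewrite (@le_trans _ _ k%:R) ?ler_nat//.
      by near: k; exact: nbhs_infty_ger.
    by apply: cvg_near_cst; apply: nearW => k; rewrite patchE (negbTE nW).
apply/eqP; rewrite -normr_le0; apply/ler_addgt0Pl => e e0; rewrite addr0.
have d0 : 0 < e / (C + 1) by rewrite divr_gt0// ltr_wpDl.
have [ka ka0 hka] := flux_small d0.
apply: (ler_cvg_to (cvg_norm lim) (cvg_cst e)); near=> k.
have k0 : 0 < k.+1%:R :> R by [].
rewrite (Int_cutoff oOm bOm oU UOm rhoC rhoD drhoC r0 QU GC dGC GD Gb dGb k0).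
apply: (le_trans (Int_norm (B3 _))).
apply: (@le_trans _ _ (e / (C + 1) * Int ((fun x => rate rho k.+1%:R x * b x) \_ W))); last first.
  apply: (@le_trans _ _ (e / (C + 1) * C)); first by rewrite ler_wpM2l ?(ltW d0)// hC.
  by rewrite mulrAC ler_pdivrMr ?ltr_wpDl// ler_wpM2l ?(ltW e0)// lerDl.
rewrite -IntZ; last exact: BM_rate.
apply: le_Int; [exact/BM_norm/B3|exact/BMZ/BM_rate|move=> x; rewrite !patchE].
case: ifPn => [|_]; last by rewrite normr0 mulr0.
rewrite inE => Wx; have [q|q] := leP 0 (quad x0 (r ^+ 2) x); last first.
  by rewrite /fluxb /b bump0 ?mul0r ?mulr0 ?normr0// ltW.
have b0 : 0 <= b x by exact: sqp_ge0.
have ra0 : 0 <= rate rho k.+1%:R x by exact: rate_ge0.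
(* [dspline] vanishes from [2] on, so only points with [rho > - 3 / k] remain. *)
have [h2|h2] := leP 2 (- k.+1%:R * rho x - 1).
  by rewrite /rate dspline_2// !mulr0 !mul0r normr0 mulr0.
rewrite /fluxb -/b mulrA normrM (ger0_norm (mulr_ge0 ra0 b0)) mulrC.
apply: ler_wpM2r; first exact: mulr_ge0.
apply: hka => //.
have h3 : - 3 / k.+1%:R <= rho x.
  by rewrite ler_pdivrMr//; move: h2; rewrite mulNr (mulrC (rho x)); lra.
apply: le_trans h3; rewrite mulNr lerN2 ler_pdivrMr// -ler_pdivrMl//.
rewrite (@le_trans _ _ k%:R) ?ler_nat// mulrC.
by near: k; exact: nbhs_infty_ger.
Unshelve. all: by end_near. Qed.

End local.

Lemma is_derive_invr (R : realType) (s : R) : s != 0 ->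
  is_derive s (1 : R) (fun t : R => t^-1) (- s ^- 2).
Proof.
move=> s0; have d : derivable (fun t : R => t) s 1 by exact: derivable_id.
split; first exact: (@derivableV R R (fun t : R => t)).
rewrite (@deriveV R R (fun t : R => t))//.
have -> : 'D_1 (fun t : R => t) s = 1 by exact: derive_id.
by rewrite /GRing.scale/= mulr1.
Qed.

Lemma forcV (R : realType) (X : topologicalType) (f : X -> R) x :
  {for x, continuous f} -> f x != 0 -> {for x, continuous (fun y => (f y)^-1)}.
Proof. by move=> cf f0; apply: (@cvgV _ _ (nbhs x) (nbhs_filter x)). Qed.

(** * The divergence theorem and Green's formula on a smooth domain *)
Section within_algebra.
Context {R : realType} {V : topologicalType}.

Lemma withinD (A : set V) (f g : V -> R) : {within A, continuous f} -> {within A, continuous g} ->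
  {within A, continuous (fun x => f x + g x)}.
Proof. by move=> cf cg x; exact: (@forcD _ (subspace A) f g x (cf x) (cg x)). Qed.

Lemma withinB (A : set V) (f g : V -> R) : {within A, continuous f} -> {within A, continuous g} ->
  {within A, continuous (fun x => f x - g x)}.
Proof. by move=> cf cg x; exact: (@forcB _ (subspace A) f g x (cf x) (cg x)). Qed.

Lemma withinM (A : set V) (f g : V -> R) : {within A, continuous f} -> {within A, continuous g} ->
  {within A, continuous (fun x => f x * g x)}.
Proof. by move=> cf cg x; exact: (@forcM _ (subspace A) f g x (cf x) (cg x)). Qed.

Lemma within_sum (A : set V) I (r : seq I) (f : I -> V -> R) :
  (forall i, {within A, continuous (f i)}) -> {within A, continuous (fun x => \sum_(i <- r) f i x)}.
Proof. by move=> cf x; exact: (@forc_sum _ (subspace A) _ r f x (fun i => cf i x)). Qed.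

Lemma within_cst (A : set V) (c : R) : {within A, continuous (fun=> c)}.
Proof. by move=> x; exact: cvg_cst. Qed.

Lemma within_comp (X Y : topologicalType) (A : set V) (v : V -> X) (h : X -> Y) :
  {within A, continuous v} -> (forall x, A x -> {for v x, continuous h}) ->
  {within A, continuous (fun x => h (v x))}.
Proof.
move=> /subspace_continuousP cv ch; apply/subspace_continuousP => x Ax.
exact: cvg_comp (cv x Ax) (ch x Ax).
Qed.

End within_algebra.

Section C1cl.
Context {R : realType} {n : nat}.
Local Notation V := 'rV[R]_n.
Variable Om : set V.

(** The derivatives are listed as explicit functions [dg], because those of a
function on [Om] exist inside only, and are here required to extend
continuously to the closure. *)
Record C1cl (g : V -> R) (dg : 'I_n -> V -> R) : Prop := {
  C1cl_cont : {within closure Om, continuous g} ;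
  C1cl_dcont : forall j, {within closure Om, continuous (dg j)} ;
  C1cl_der : forall j x, Om x -> is_derive x (basis_vec j) g (dg j x) }.

Lemma C1clD f df g dg : C1cl f df -> C1cl g dg ->
  C1cl (fun x => f x + g x) (fun j x => df j x + dg j x).
Proof.
move=> [cf cdf Df] [cg cdg Dg]; split.
- exact: withinD.
- by move=> j; apply: withinD.
- by move=> j x Ox; have := Df j x Ox; have := Dg j x Ox; move=> ? ?; exact: is_deriveD.
Qed.

Lemma C1clM f df g dg : C1cl f df -> C1cl g dg ->
  C1cl (fun x => f x * g x) (fun j x => f x * dg j x + g x * df j x).
Proof.
move=> [cf cdf Df] [cg cdg Dg]; split.
- exact: withinM.
- by move=> j; apply: withinD; apply: withinM.
- by move=> j x Ox; have := Df j x Ox; have := Dg j x Ox; move=> ? ?; exact: is_deriveM.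
Qed.

Lemma C1cl_cst c : C1cl (fun=> c) (fun _ _ => 0).
Proof.
split=> [|j|j x _]; [exact: within_cst|exact: within_cst|exact: is_derive_cst].
Qed.

Lemma C1cl_sum I (r : seq I) (f : I -> V -> R) df : (forall i, C1cl (f i) (df i)) ->
  C1cl (fun x => \sum_(i <- r) f i x) (fun j x => \sum_(i <- r) df i j x).
Proof.
move=> h; elim: r => [|i r IH].
  have -> : (fun x => \sum_(i <- [::]) f i x) = (fun=> 0) by apply/funext => x; rewrite big_nil.
  have -> : (fun j x => \sum_(i <- [::]) df i j x) = (fun _ _ => 0).
    by apply/funext => j; apply/funext => x; rewrite big_nil.
  exact: C1cl_cst.
have -> : (fun x => \sum_(i <- i :: r) f i x) = (fun x => f i x + \sum_(i <- r) f i x).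
  by apply/funext => x; rewrite big_cons.
have -> : (fun j x => \sum_(i <- i :: r) df i j x) = (fun j x => df i j x + \sum_(i <- r) df i j x).
  by apply/funext => j; apply/funext => x; rewrite big_cons.
exact: C1clD.
Qed.

Lemma C1cl_comp1 (h dh : R -> R) g dg : C1cl g dg ->
  (forall x, closure Om x -> is_derive (g x) (1 : R) h (dh (g x)) /\ {for g x, continuous dh}) ->
  C1cl (fun x => h (g x)) (fun j x => dg j x * dh (g x)).
Proof.
move=> [cg cdg Dg] hh; split.
- by apply: within_comp => // x /hh[/is_derive_continuous].
- by move=> j; apply: withinM => //; apply: within_comp => // x /hh[].
- move=> j x Ox; have [hx _] := hh x (subset_closure Ox).
  by apply: (is_derive_comp1 (g := h)) => //; exact: Dg.
Qed.

Lemma C1cl_comp_row N (h : 'rV[R]_N -> R) (dh : 'I_N -> 'rV[R]_N -> R) (D : set 'rV[R]_N)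
    (u : V -> 'rV[R]_N) (du : 'I_N -> 'I_n -> V -> R) :
  open D -> (forall x, closure Om x -> D (u x)) ->
  {within closure Om, continuous u} ->
  (forall i, C1cl (fun x => u x 0 i) (du i)) ->
  (forall v, D v -> {for v, continuous h}) ->
  (forall i v, D v -> {for v, continuous (dh i)}) ->
  (forall i v, D v -> is_derive v (basis_vec i) h (dh i v)) ->
  C1cl (fun x => h (u x)) (fun j x => \sum_i du i j x * dh i (u x)).
Proof.
move=> oD uD cu Cu ch cdh Dh; split.
- by apply: within_comp => // x /uD; exact: ch.
- move=> j; apply: (within_sum (f := fun i x => du i j x * dh i (u x))) => i.
  apply: withinM; first by case: (Cu i).
  by apply: within_comp => // x /uD; exact: cdh.
- move=> j x Ox; have Dux := uD x (subset_closure Ox).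
  apply: (@is_derive_comp_row _ _ _ h dh u) => i.
  + have nD : nbhs (u x) D by exact: open_nbhs_nbhs.
    by apply: filterS nD => v; exact: Dh.
  + exact: cdh.
  + by case: (Cu i) => _ _; exact.
Qed.

End C1cl.

Section domain.
Context {R : realType} {n : nat}.
Local Notation V := 'rV[R]_n.
Variable Om : set V.
Hypothesis Om_domain : smooth_bounded_domain Om.

Lemma domain_open : open Om. Proof. by case: Om_domain. Qed.
Lemma domain_bounded : bounded_set Om. Proof. by case: Om_domain. Qed.

Lemma compact_closure_domain : compact (closure Om).
Proof.
apply: bounded_closed_compact; last exact: closed_closure.
have [M [Mr hM]] := domain_bounded.
exists (M + 1); split; first by rewrite num_real.
move=> M' MM' x cx /=.
have sub : closure Om `<=` [set x : V | `|x| <= M'].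
  rewrite (_ : [set x : V | `|x| <= M'] = closure [set x : V | `|x| <= M']).
    apply: closureS => y Oy; apply: (hM M') => //.
    by rewrite (lt_trans _ MM')// ltrDl.
  apply/closure_id; apply: (@closed_comp _ _ (fun x : V => `|x|) [set y | y <= M']).
    by move=> y _; exact: norm_continuous.
  exact: closed_le.
exact: sub.
Qed.

Lemma C1cl_bounded g dg : C1cl Om g dg ->
  bounded_on Om g /\ forall j, bounded_on Om (dg j).
Proof.
move=> [cg cdg _]; have sub : Om `<=` closure Om by exact: subset_closure.
split => [|j]; apply: bounded_onS sub _; apply: compact_bounded_on => //;
  exact: compact_closure_domain.
Qed.

Lemma boundaryE x : boundary Om x <-> closure Om x /\ ~ Om x.
Proof.
rewrite /boundary; have /interior_id -> := domain_open.
by split => -[].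
Qed.

Lemma BM_closure g : {within closure Om, continuous g} -> BM (g \_ Om).
Proof.
move=> cg; apply: BM_restrict; [exact: domain_open|exact: domain_bounded| |].
  by move=> x Ox; apply: (within_for cg domain_open _ Ox); exact: subset_closure.
apply: bounded_onS (@subset_closure _ Om) _.
by apply: compact_bounded_on => //; exact: compact_closure_domain.
Qed.

Lemma local_smooth x0 U rho : local_defining_function Om x0 U rho ->
  [/\ open U /\ U x0, U `&` Om = U `&` [set x | rho x < 0],
    (forall x, U x -> {for x, continuous rho}),
    (forall j x, U x -> is_derive x (basis_vec j) rho ('D_(basis_vec j) rho x)) &
    [/\ (forall j x, U x -> {for x, continuous (fun y => 'D_(basis_vec j) rho y)}),
    (forall j x, U x -> is_derive x (basis_vec j) (fun y => 'D_(basis_vec j) rho y)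
        ('D_(basis_vec j) (fun y => 'D_(basis_vec j) rho y) x)),
    (forall j x, U x ->
      {for x, continuous (fun x => 'D_(basis_vec j) (fun y => 'D_(basis_vec j) rho y) x)}) &
    (forall x, U x -> 0 < \sum_j 'D_(basis_vec j) rho x ^+ 2)]].
Proof.
move=> [[oU Ux0] sm gr UOm _]; have [c h] := sm 2%N.
split => //; first by move=> j x Ux; have [d _] := h j; apply: DeriveDef => //; exact: d.
split.
- by move=> j x Ux; have [_ [+ _]] := h j; exact.
- move=> j x Ux; have [_ [_ h2]] := h j; have [d _] := h2 j.
  by apply: DeriveDef => //; exact: d.
- by move=> j x Ux; have [_ [_ h2]] := h j; have [_ [+ _]] := h2 j; exact.
- move=> x Ux; rewrite lt_neqAle; apply/andP; split; last first.
    by apply: sumr_ge0 => j _; exact: sqr_ge0.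
  apply: contraNN (gr x Ux); rewrite eq_sym psumr_eq0; last by move=> j _; exact: sqr_ge0.
  move=> /allP h0; apply/eqP/rowP => j; rewrite !mxE.
  by apply/eqP; rewrite -sqrf_eq0; exact: h0 (mem_index_enum j).
Qed.

Lemma quad_subset (U : set V) x : nbhs x U ->
  exists2 r : R, 0 < r & [set y | 0 <= quad x (r ^+ 2) y] `<=` U.
Proof.
move=> /nbhs_ballP[e /= e0 xe]; exists (e / 2); first by rewrite divr_gt0.
move=> y /= /quad_ge0_near h; apply: xe; rewrite -ball_normE/= distrC.
by rewrite (le_lt_trans (h _))// ?divr_gt0// ltr_pdivrMr// ltr_pMr// ltr1n.
Qed.

(** Every local defining function counts, so this is tangency to the boundary
without choosing a normal vector. *)
Definition tangent_field (F : 'I_n -> V -> R) := forall x U rho, boundary Om x ->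
  local_defining_function Om x U rho -> \sum_j F j x * 'D_(basis_vec j) rho x = 0.

(** The divergence theorem for the fields [b F] with [b] the bump of radius [r] at
[x] and [F] tangent. *)
Definition divergence_radius (x : V) (r : R) := 0 < r /\ forall F dF,
  (forall j, C1cl Om (F j) (dF j)) -> tangent_field F ->
  Int ((fun y => \sum_j (dbump x (r ^+ 2) j y * F j y + bump x (r ^+ 2) y * dF j j y)) \_ Om) = 0.

(** This is [local_divergence].  The flux of [F] is zero on the boundary, so by
compactness it is small in a thin layer [- kappa <= rho] of the ball. *)
Lemma divergence_radius_boundary x : boundary Om x -> exists r, divergence_radius x r.
Proof.
move=> bx; have [_ _ _ _ /(_ x bx)[U [rho ldf]]] := Om_domain.
have [[oU Ux] UOm rhoC rhoD [drhoC drhoD ddrhoC grad]] := local_smooth ldf.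
have [r r0 QU] := quad_subset (open_nbhs_nbhs (conj oU Ux)).
exists r; split => // F dF CF tF.
have sub : U `&` Om `<=` Om by move=> y [].
have WC j y : (U `&` Om) y -> {for y, continuous (F j)}.
  move=> [_ Oy]; case: (CF j) => cF _ _.
  by apply: (within_for cF domain_open _ Oy); exact: subset_closure.
have WdC j y : (U `&` Om) y -> {for y, continuous (dF j j)}.
  move=> [_ Oy]; case: (CF j) => _ cF _.
  by apply: (within_for (cF j) domain_open _ Oy); exact: subset_closure.
have WD j y : (U `&` Om) y -> is_derive y (basis_vec j) (F j) (dF j j y).
  by move=> [_ Oy]; case: (CF j) => _ _; exact.
pose Q := [set y : V | 0 <= quad x (r ^+ 2) y].
have subQ : (U `&` Om) `&` Q `<=` Om by move=> y [[]].
have Fb j : bounded_on ((U `&` Om) `&` Q) (F j).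
  by apply: bounded_onS subQ _; have [] := C1cl_bounded (CF j).
have dFb j : bounded_on ((U `&` Om) `&` Q) (dF j j).
  by apply: bounded_onS subQ _; have [_] := C1cl_bounded (CF j); exact.
have -> : (fun y => \sum_j (dbump x (r ^+ 2) j y * F j y + bump x (r ^+ 2) y * dF j j y)) \_ Om =
   divb x r F (fun j => dF j j) \_ (U `&` Om).
  apply/funext => y; rewrite !patchE /divb; case: ifPn => [|Oy]; last first.
    by rewrite memNset// => -[_ Oy']; move/negP: Oy; apply; rewrite inE.
  rewrite inE => Oy; case: ifPn => // /negP UOy.
  have qy : quad x (r ^+ 2) y <= 0.
    apply: ltW; rewrite ltNge; apply/negP => /QU Uy.
    by apply: UOy; rewrite inE.
  by rewrite big1// => j _; rewrite dbump0// bump0// !mul0r addr0.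
apply: (local_divergence domain_open domain_bounded oU UOm rhoC rhoD drhoC drhoD ddrhoC grad
  r0 QU WC WdC WD Fb dFb).
move=> delta delta0.
pose g y := \sum_j F j y * 'D_(basis_vec j) rho y.
pose K := closure Om `&` Q.
have cK : compact K.
  apply: compact_closedI; first exact: compact_closure_domain.
  by apply: compact_closed; [exact: norm_hausdorff|exact: compact_quad].
have gK : {within K, continuous g}.
  apply: (within_sum (f := fun j y => F j y * 'D_(basis_vec j) rho y)) => j.
  apply: withinM.
    by case: (CF j) => cF _ _; apply: continuous_subspaceW cF => y [].
  by apply: for_within => y [_ /QU]; exact: drhoC.
have /compact_near_coveringP cov := cK.
have : \forall ka \near 0^'+, K `<=` (fun y => Om y -> Q y -> - ka <= rho y -> `|g y| <= delta).
  apply: cov => y [cy Qy]; have Uy := QU _ Qy.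
  have [ry|ry] := ltP (rho y) 0.
    have r2 : 0 < - (rho y / 2) by rewrite oppr_gt0 pmulr_llt0// invr_gt0.
    have h1 : \forall y' \near y, rho y' < rho y / 2.
      by apply: (cvgr_lt (rho y) (rhoC y Uy)); lra.
    have h2 : \forall ka \near 0^'+, ka < - (rho y / 2) by exact: nbhs_right_lt.
    exists ([set y' | rho y' < rho y / 2], [set ka | ka < - (rho y / 2)]) => //.
    by move=> [y' ka] [/= l1 l2] _ _; lra.
  have nOy : ~ Om y.
    move=> Oy; have : (U `&` Om) y by [].
    by rewrite UOm => -[_ /=]; rewrite ltNge ry.
  have by_ : boundary Om y by apply/boundaryE.
  have ldy : local_defining_function Om y U rho.
    by case: ldf => -[oU' _] ? ? ? ?; split.
  have g0 : g y = 0 by exact: tF by_ ldy.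
  have gy : g @ within K (nbhs y) --> (0 : R).
    by rewrite -g0; move/subspace_continuousP: gK; apply.
  have h1 := @cvgr0_norm_le _ _ _ (within K (nbhs y)) _ g gy delta delta0.
  exists ([set y' | K y' -> `|g y'| <= delta], setT).
    by split; [exact: h1|exact: filterT].
  move=> [y' ka] [/= l1 _] Oy' Qy' _; apply: l1; split => //.
  exact: subset_closure.
move=> [kap /= kap0 hk]; exists (kap / 2); first by rewrite divr_gt0.
move=> y [Uy Oy] Qy ry.
apply: (hk (kap / 2)) => //; rewrite ?divr_gt0//=.
  rewrite sub0r normrN gtr0_norm ?divr_gt0// ltr_pdivrMr// ltr_pMr//.
  by rewrite ltr1n.
by split => //; exact: subset_closure.
Qed.

(** With the constant [-1] as defining function the cut-off of parameter [3] is
identically [1], and its rate is [0]: [Int_cutoff] then has no boundary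
term. *)
Lemma divergence_radius_interior x : Om x -> exists r, divergence_radius x r.
Proof.
move=> Ox; have oOm := domain_open.
have [r r0 QO] := quad_subset (open_nbhs_nbhs (conj oOm Ox)).
exists r; split => // F dF CF _.
have OC j y : (Om `&` Om) y -> {for y, continuous (F j)}.
  move=> [_ Oy]; case: (CF j) => cF _ _.
  by apply: (within_for cF domain_open _ Oy); exact: subset_closure.
have OdC j y : (Om `&` Om) y -> {for y, continuous (dF j j)}.
  move=> [_ Oy]; case: (CF j) => _ cF _.
  by apply: (within_for (cF j) domain_open _ Oy); exact: subset_closure.
have OD j y : (Om `&` Om) y -> is_derive y (basis_vec j) (F j) (dF j j y).
  by move=> [_ Oy]; case: (CF j) => _ _; exact.
pose Q := [set y : V | 0 <= quad x (r ^+ 2) y].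
have subQ : (Om `&` Om) `&` Q `<=` Om by move=> y [[]].
have Fb j : bounded_on ((Om `&` Om) `&` Q) (F j).
  by apply: bounded_onS subQ _; have [] := C1cl_bounded (CF j).
have dFb j : bounded_on ((Om `&` Om) `&` Q) (dF j j).
  by apply: bounded_onS subQ _; have [_] := C1cl_bounded (CF j); exact.
have UOm : Om `&` Om = Om `&` [set x | (-1 : R) < 0].
  by rewrite setIid; apply/seteqP; split => [y Oy|y []//]; split => //=; rewrite ltrN10.
have three : 0 < 3 :> R by [].
have C1 y : Om y -> {for y, continuous (fun=> -1 : R)} by move=> _; exact: forc_cst.
have C0 (j : 'I_n) y : Om y -> {for y, continuous (fun=> 0 : R)} by move=> _; exact: forc_cst.
have D0 (j : 'I_n) (y : V) : Om y -> is_derive y (basis_vec j) (fun=> -1 : R) 0.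
  by move=> _; exact: is_derive_cst.
have := @Int_cutoff R n Om Om (fun=> -1) (fun _ _ => 0) x r oOm domain_bounded oOm UOm C1 D0 C0
  r0 QO F (fun j => dF j j) OC OdC OD Fb dFb 3 three.
have e1 : (fun y => eta (fun=> -1) 3 y * divb x r F (fun j => dF j j) y) \_ (Om `&` Om) =
  (fun y => \sum_j (dbump x (r ^+ 2) j y * F j y + bump x (r ^+ 2) y * dF j j y)) \_ Om.
  rewrite setIid; congr patch; apply/funext => y.
  by rewrite /eta spline_1 ?mul1r// mulrN mulr1 opprK; lra.
rewrite e1 => ->; rewrite -[RHS](@Int0 R n); congr Int; apply/funext => y.
rewrite patchE; case: ifPn => // _.
by rewrite /rate dspline_2 ?mulr0 ?mul0r// mulrN mulr1 opprK; lra.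
Qed.

(** Cover the closure by finitely many bumps [B x], with sum [S > 0], and apply
the local results to the tangent field [F / S]: the functions [B x / S] are a
partition of unity. *)
Lemma divergence_theorem (F : 'I_n -> V -> R) dF : (forall j, C1cl Om (F j) (dF j)) ->
  tangent_field F -> Int ((fun x => \sum_j dF j j x) \_ Om) = 0.
Proof.
move=> CF tF.
have [rr hrr] : {rr : V -> R & forall x, closure Om x -> divergence_radius x (rr x)}.
  apply: (@choice _ _ (fun x r => closure Om x -> divergence_radius x r)) => x.
  have [cx|ncx] := pselect (closure Om x); last by exists 0.
  have [Ox|nOx] := pselect (Om x); first by have [r hr] := divergence_radius_interior Ox; exists r.
  by have [|r hr] := @divergence_radius_boundary x; [exact/boundaryE|exists r].
have cK := compact_closure_domain.
rewrite compact_cover in cK.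
have [||D' D'sub D'cov] := cK V (closure Om) (fun x => [set y | 0 < quad x (rr x ^+ 2) y]).
- move=> x cx; apply: (@open_comp _ _ (quad x (rr x ^+ 2)) [set y | 0 < y]); last exact: open_gt.
  by move=> y _; exact: continuous_quad.
- move=> x cx; exists x => //=; rewrite /quad big1 ?subr0; last first.
    by move=> j _; rewrite subrr expr0n.
  by have [r0 _] := hrr x cx; rewrite exprn_gt0.
pose B (x : V) := bump x (rr x ^+ 2); pose dB (x : V) := dbump x (rr x ^+ 2).
pose Ds : seq V := finmap.enum_fset D'.
pose S y := \sum_(x <- Ds) B x y; pose dS j y := \sum_(x <- Ds) dB x j y.
have S0 y : closure Om y -> 0 < S y.
  move=> cy; have [x /= xD' qx] := D'cov y cy.
  rewrite /S (big_rem x)//= ltr_pwDl ?bump_gt0// sumr_ge0// => z _; exact: sqp_ge0.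
have CS : C1cl Om S dS.
  apply: C1cl_sum => x; split.
  - by apply: continuous_subspaceT => y; exact: continuous_bump.
  - by move=> j; apply: continuous_subspaceT => y; exact: continuous_dbump.
  - by move=> j y _; exact: is_derive_bump.
have CI : C1cl Om (fun y => (S y)^-1) (fun j y => dS j y * - ((S y) ^-2)).
  apply: (C1cl_comp1 (dh := fun s => - (s ^-2)) CS) => y cy; have S0y := S0 y cy; split.
    by apply: is_derive_invr; rewrite gt_eqF.
  apply: forcN; apply: (@forcV _ _ (fun s : R => s ^+ 2)); first exact: exprn_continuous.
  by rewrite expf_neq0// gt_eqF.
pose Y j y := F j y * (S y)^-1.
have CY j := C1clM (CF j) CI.
pose dY j k y := F j y * (dS k y * - S y ^- 2) + (S y)^-1 * dF j k y.
have tY : tangent_field Y.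
  move=> x U rho bx ldf; have := tF x U rho bx ldf => e.
  rewrite /Y (eq_bigr (fun j => (F j x * 'D_(basis_vec j) rho x) * (S x)^-1)); last first.
    by move=> j _; ring.
  by rewrite -mulr_suml e mul0r.
have bmC (f : V -> R) : {within closure Om, continuous f} -> BM (f \_ Om) by exact: BM_closure.
have h x : x \in Ds -> Int ((fun y => \sum_j (dB x j y * Y j y + B x y * dY j j y)) \_ Om) = 0.
  move=> xD; have cx : closure Om x by have := D'sub x xD; rewrite inE.
  by have [_ hx] := hrr x cx; exact: hx CY tY.
transitivity (Int (fun y => \sum_(x <- Ds) (((fun y => \sum_j (dB x j y * Y j y + B x y * dY j j y)) \_ Om) y))).
  congr Int; apply/funext => y; rewrite patchE.
  under [in RHS]eq_bigr do rewrite patchE.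
  case: ifPn => [|_]; last by rewrite big1.
  rewrite inE => Oy; rewrite exchange_big/=; apply: eq_bigr => j _.
  rewrite big_split/= -mulr_suml -mulr_suml -/(S y) -/(dS j y) /Y /dY.
  by have S0y : S y != 0 by [rewrite gt_eqF// S0//; exact: subset_closure]; field.
rewrite Int_sum.
  rewrite big_seq big1// => x xD; exact: h.
move=> x _; apply: bmC.
apply: (within_sum (f := fun j y => dB x j y * Y j y + B x y * dY j j y)) => j.
apply: withinD; apply: withinM.
- by apply: continuous_subspaceT => y; exact: continuous_dbump.
- by case: (CY j).
- by apply: continuous_subspaceT => y; exact: continuous_bump.
- by case: (CY j) => _ + _; exact.
Qed.

(** The divergence theorem for [phi Dw], which is tangent together with [Dw]. *)
Lemma green (phi : V -> R) dphi (Dw : 'I_n -> V -> R) DDw : C1cl Om phi dphi ->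
  (forall j, C1cl Om (Dw j) (DDw j)) -> tangent_field Dw ->
  Int ((fun x => phi x * \sum_j DDw j j x) \_ Om) =
  - Int ((fun x => \sum_j dphi j x * Dw j x) \_ Om).
Proof.
move=> Cp CD tD; pose F j x := phi x * Dw j x.
have CF j := C1clM Cp (CD j).
have tF : tangent_field F.
  move=> x U rho bx ldf; rewrite /F.
  by under eq_bigr do rewrite -mulrA; rewrite -mulr_sumr (tD x U rho bx ldf) mulr0.
have := divergence_theorem CF tF.
have -> : (fun x => \sum_j (phi x * DDw j j x + Dw j x * dphi j x)) \_ Om =
  (fun x => ((fun x => phi x * \sum_j DDw j j x) \_ Om) x +
            ((fun x => \sum_j dphi j x * Dw j x) \_ Om) x).
  apply/funext => x; rewrite !patchE; case: ifPn => _; last by rewrite addr0.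
  by rewrite big_split/= mulr_sumr; congr (_ + _); apply: eq_bigr => j _; rewrite mulrC.
rewrite IntD; first by move/eqP; rewrite addr_eq0 => /eqP.
- apply: BM_closure; apply: withinM; first by case: Cp.
  apply: (within_sum (f := fun j x => DDw j j x)) => j.
  by case: (CD j) => _ + _; exact.
- apply: BM_closure; apply: (within_sum (f := fun j x => dphi j x * Dw j x)) => j.
  by apply: withinM; [case: Cp|case: (CD j)].
Qed.

End domain.

(** * The Neumann condition makes the gradient tangent *)
Section neumann.
Context {R : realType} {n : nat}.
Local Notation V := 'rV[R]_n.
Variable Om : set V.
Hypothesis Om_domain : smooth_bounded_domain Om.

Lemma near0_radius (P : R -> Prop) : (\forall h \near (0 : R), P h) ->
  exists2 r, 0 < r & forall h, `|h| < r -> P h.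
Proof.
move=> /nbhs_ballP[r /= r0 hr]; exists r => // h hh; apply: hr.
by rewrite -ball_normE/= sub0r normrN.
Qed.

Lemma is_derive_cvg (g : R -> R) (s l : R) : is_derive s (1 : R) g l ->
  h^-1 * (g (h + s) - g s) @[h --> 0^'] --> l.
Proof.
move=> [dg <-]; have e : (fun h : R => h^-1 *: (g (h *: (1 : R) + s) - g s)) =
  (fun h : R => h^-1 * (g (h + s) - g s)).
  by apply/funext => h; rewrite /GRing.scale/= mulr1.
by move: dg; rewrite /derivable /derive e.
Qed.

Lemma derive_gt0_left (g : R -> R) (l : R) : is_derive (0 : R) (1 : R) g l -> 0 < l ->
  exists2 r, 0 < r & forall h, `|h| < r -> h < 0 -> g h < g 0.
Proof.
move=> /is_derive_cvg/cvgrPdist_lt H l0; have /= := H _ l0.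
rewrite near_withinE => /near0_radius[r r0 hr]; exists r => // h hr' h0.
have := hr h hr'; rewrite lt_eqF// addr0 => /(_ isT).
rewrite ltr_norml => /andP[_]; rewrite ltrBlDr ltrDl.
by rewrite nmulr_rgt0 ?invr_lt0// subr_lt0.
Qed.

(** The difference quotient of [w] along the normal, taken from inside, is by the
mean value theorem the value of the directional derivative [D] at an interior
point tending to [x].  By continuity of [D] on the closure, [D x = 0]. *)
Lemma neumann_tangent (w : V -> R) (Dw : 'I_n -> V -> R) : C1cl Om w Dw ->
  (forall x v, boundary Om x -> outer_unit_normal Om x v -> is_derive_in (closure Om) x v w 0) ->
  tangent_field Om Dw.
Proof.
move=> [cw cDw DDw] bc x U rho bx ldf.
have oOm := domain_open Om_domain.
have [[oU Ux] UOm rhoC rhoD [drhoC _ _ grad]] := local_smooth ldf.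
have cx : closure Om x by case/(boundaryE Om_domain): bx.
have rx : rho x = 0.
  case: (ldf) => _ _ _ _ E; have : (U `&` boundary Om) x by [].
  by rewrite E => -[].
pose c := euclidean_norm (gradient rho x).
have gradE j : gradient rho x 0 j = 'D_(basis_vec j) rho x by rewrite mxE.
have c0 : 0 < c.
  rewrite /c /euclidean_norm sqrtr_gt0; under eq_bigr do rewrite gradE.
  exact: grad.
pose v : V := c^-1 *: gradient rho x.
have vE j : v 0 j = c^-1 * 'D_(basis_vec j) rho x by rewrite !mxE.
have bcx := bc x v bx (ex_intro _ U (ex_intro _ rho (conj ldf erefl))).
have lineD (g : V -> R) (dg : 'I_n -> V -> R) (A : set V) (s : R) : open A -> A (x + s *: v) ->
    (forall j y, A y -> is_derive y (basis_vec j) g (dg j y)) ->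
    (forall j y, A y -> {for y, continuous (dg j)}) ->
    is_derive s (1 : R) (fun s : R => g (x + s *: v)) (\sum_j v 0 j * dg j (x + s *: v)).
  move=> oA As gD gC.
  apply: (@is_derive_curve _ _ g dg (fun s : R => x + s *: v) s (fun j => v 0 j)).
  - move=> j; have nA : nbhs (x + s *: v) A by exact: open_nbhs_nbhs.
    by apply: filterS nA => y; exact: gD.
  - by move=> j; exact: gC.
  - move=> j; have -> : (fun s : R => (x + s *: v) 0 j) = cst (x 0 j) + (v 0 j) \*: id.
      by apply/funext => t; rewrite !mxE !fctE /= mulrC.
    by apply: is_derive_eq; rewrite add0r /GRing.scale/= mulr1.
have drho : is_derive (0 : R) (1 : R) (fun s : R => rho (x + s *: v))
    (\sum_j v 0 j * 'D_(basis_vec j) rho x).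
  have := @lineD rho (fun j y => 'D_(basis_vec j) rho y) U 0 oU.
  by rewrite scale0r addr0 => H; apply: H.
have L0 : 0 < \sum_j v 0 j * 'D_(basis_vec j) rho x.
  under eq_bigr do rewrite vE -mulrA -expr2.
  by rewrite -mulr_sumr mulr_gt0 ?invr_gt0// grad.
have [r1 r10 hr1] := derive_gt0_left drho L0.
have {}hr1 h : `|h| < r1 -> h < 0 -> rho (x + h *: v) < 0.
  by move=> h1 h2; have := hr1 h h1 h2; rewrite scale0r addr0 rx.
have lineC : continuous (fun s : R => x + s *: v).
  move=> s; apply: (@cvgD _ _ _ (nbhs s) (nbhs_filter s)); first exact: cvg_cst.
  exact: scalel_continuous.
have nU : \forall h \near (0 : R), U (x + h *: v).
  apply: (lineC 0); rewrite scale0r addr0; exact: open_nbhs_nbhs.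
have [r2 r20 hr2] := near0_radius nU.
have inOm h : `|h| < r1 -> `|h| < r2 -> h < 0 -> Om (x + h *: v).
  move=> h1 h2 h0; have : (U `&` [set y | rho y < 0]) (x + h *: v).
    by split; [exact: hr2|exact: hr1].
  by rewrite -UOm => -[].
pose D y := \sum_j v 0 j * Dw j y.
have cD : {within closure Om, continuous D}.
  apply: (within_sum (f := fun j y => v 0 j * Dw j y)) => j.
  by apply: withinM; [exact: within_cst|exact: cDw].
suff Dx : D x = 0.
  suff -> : \sum_j Dw j x * 'D_(basis_vec j) rho x = c * D x by rewrite Dx mulr0.
  rewrite /D mulr_sumr; apply: eq_bigr => j _; rewrite vE.
  by field; rewrite gt_eqF.
apply/eqP; rewrite -normr_le0; apply/ler_addgt0Pl => e e0; rewrite addr0.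
have e2 : 0 < e / 2 by rewrite divr_gt0.
have [r3 r30 hr3] : exists2 r, 0 < r & forall h, `|h| < r -> closure Om (x + h *: v) ->
    `|D x - D (x + h *: v)| <= e / 2.
  apply: (@near0_radius (fun h => closure Om (x + h *: v) -> `|D x - D (x + h *: v)| <= e / 2)).
  move/subspace_continuousP: cD => /(_ x cx)/cvgrPdist_le/(_ _ e2) H.
  have G : (fun s : R => x + s *: v) @ (0 : R) --> x.
    by have := lineC 0; rewrite /continuous_at scale0r addr0.
  exact: (G _ H).
have [r4 r40 hr4] : exists2 r, 0 < r & forall h, `|h| < r -> h != 0 ->
    closure Om (x + h *: v) -> `|h^-1 * (w (x + h *: v) - w x)| <= e / 2.
  apply: (@near0_radius (fun h => h != 0 ->
    closure Om (x + h *: v) -> `|h^-1 * (w (x + h *: v) - w x)| <= e / 2)).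
  move/cvgr0_norm_le: bcx => /(_ _ e2); rewrite near_withinE near_withinE.
  by apply: filterS => h H h0 ch; exact: H.
pose rr := Num.min (Num.min r1 r2) (Num.min r3 r4).
have rr0 : 0 < rr by rewrite /rr !lt_min r10 r20 r30 r40.
pose h := - (rr / 2).
have h0 : h < 0 by rewrite oppr_lt0 divr_gt0.
have hrr s : h <= s -> s <= 0 -> [/\ `|s| < r1, `|s| < r2, `|s| < r3 & `|s| < r4].
  move=> hs s0; have : `|s| < rr.
    rewrite ler0_norm// ltrNl (lt_le_trans _ hs)// /h ltrN2 ltr_pdivrMr// ltr_pMr//.
    by rewrite ltr1n.
  by rewrite /rr !lt_min => /andP[/andP[-> ->] /andP[-> ->]].
have [||s] := @MVT R (fun s => w (x + s *: v)) (fun s => D (x + s *: v)) h 0 h0.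
- move=> s; rewrite in_itv/= => /andP[hs s0].
  have [s1 s2 _ _] := hrr s (ltW hs) (ltW s0).
  apply: (lineD w Dw Om s oOm (inOm s s1 s2 s0) DDw).
  move=> j y Oy; apply: (within_for (cDw j) oOm _ Oy); exact: subset_closure.
- apply/subspace_continuousP => s /=; rewrite in_itv/= => /andP[hs s0].
  have cl s' : h <= s' -> s' <= 0 -> closure Om (x + s' *: v).
    move=> hs'; rewrite le_eqVlt => /orP[/eqP ->|s0']; first by rewrite scale0r addr0.
    have [s1 s2 _ _] := hrr s' hs' (ltW s0').
    by apply: subset_closure; exact: inOm.
  move/subspace_continuousP: cw => /(_ _ (cl s hs s0)) H.
  suff G : (fun t : R => x + t *: v) @ within [set t | t \in `[h, 0]%R] (nbhs s) -->
      within (closure Om) (nbhs (x + s *: v)) by exact: cvg_comp G H.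
  move=> A; rewrite /within/= => nA; have nA' := lineC s _ nA.
  apply: (@filterS _ (nbhs s) _ _ _ _ nA') => t /= At tI.
  by apply: At; apply: cl; move: tI; rewrite in_itv/= => /andP[].
rewrite scale0r addr0 in_itv/= => /andP[hs s0] E.
have [s1 s2 s3 s4] := hrr s (ltW hs) (ltW s0).
have [h1 h2 h3 h4] := hrr h (lexx h) (ltW h0).
have cls : closure Om (x + s *: v) by apply: subset_closure; exact: inOm.
have clh : closure Om (x + h *: v) by apply: subset_closure; exact: inOm.
have B1 := hr3 s s3 cls.
have B2 := hr4 h h4 (ltr0_neq0 h0) clh.
have E' : h^-1 * (w (x + h *: v) - w x) = D (x + s *: v).
  by rewrite -opprB E; field; rewrite lt_eqF.
rewrite E' in B2.
rewrite -(subrK (D (x + s *: v)) (D x)) (le_trans (ler_normD _ _))//.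
by rewrite (splitr e) lerD.
Qed.
End neumann.

Lemma cvg_within_map (X Y : topologicalType) (A : set X) (B : set Y) (h : X -> Y) x :
  {for x, continuous h} -> (forall y, A y -> B (h y)) ->
  h @ within A (nbhs x) --> within B (nbhs (h x)).
Proof.
move=> ch AB C; rewrite /within/= => nC; have nC' := ch _ nC.
by apply: (@filterS _ (nbhs x) _ _ _ _ nC') => y /= hy Ay; apply: hy; exact: AB.
Qed.

Lemma within_coord (R : realType) m (X : topologicalType) (A : set X) (v : X -> 'rV[R]_m) i :
  {within A, continuous v} -> {within A, continuous (fun x => v x 0 i)}.
Proof.
move=> cv; apply: (within_comp (h := fun M : 'rV[R]_m => M 0 i)) => // x _.
exact: (@coord_continuous _ 1 m 0 i).
Qed.

Lemma continuous_pairl (X Y : topologicalType) (t : Y) : continuous (fun x : X => (x, t)).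
Proof. by move=> x; apply: cvg_pair; [exact: cvg_id|exact: cvg_cst]. Qed.

(** * The solution at a fixed time *)
Section helpers.
Context {R : realType} {n : nat}.
Local Notation V := 'rV[R]_n.

Lemma is_derive_in_eq (A : set V) x v (g g' : V -> R) l : A x ->
  (forall y, A y -> g y = g' y) -> is_derive_in A x v g l -> is_derive_in A x v g' l.
Proof.
move=> Ax gg; rewrite /is_derive_in; apply: cvg_trans.
apply: near_eq_cvg; rewrite near_withinE; apply: nearW => h Ah.
by rewrite !gg.
Qed.

Lemma slice_continuous (A : set V) (T t : R) (g : V * R -> R) : 0 < t < T ->
  {within cylinder A T, continuous g} -> {within A, continuous (fun x => g (x, t))}.
Proof.
move=> tT /subspace_continuousP cg; apply/subspace_continuousP => x Ax.
have H := cg (x, t) (conj Ax tT).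
have G := @cvg_within_map _ _ A (cylinder A T) (fun y : V => (y, t)) x
  (@continuous_pairl _ _ t x) (fun y Ay => conj Ay tT).
exact: cvg_comp G H.
Qed.

End helpers.

Section solution.
Context (R : realType) (n N : nat).
Local Notation V := 'rV[R]_n.
Local Notation row := 'rV[R]_N.
Variables (Om : set V) (Om_domain : smooth_bounded_domain Om)
  (tau : 'I_N -> R)
  (d : 'I_N -> row -> R)
  (f : row -> row) (T : R)
  (u0 : 'I_N -> V -> R)
  (u : V -> R -> row)
  (u_solution : positive_classical_solution Om T tau d f u0 u).

Definition cylc : set (V * R) := cylinder (closure Om) T.

(** The derivatives of the solution replaced by their continuous extensions to
the closure, which are then used everywhere. *)
Lemma solution_derivatives : exists (Dt : 'I_N -> V * R -> R)
    (DX : 'I_N -> 'I_n -> V * R -> R) (DXX : 'I_N -> 'I_n -> 'I_n -> V * R -> R),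
  [/\ (forall i, {within cylc, continuous (Dt i)}) /\
      (forall i x t, Om x -> 0 < t < T ->
         is_derive t (1 : R) (fun s => u x s 0 i) (Dt i (x, t))),
      (forall i j, {within cylc, continuous (DX i j)}),
      (forall i j x t, Om x -> 0 < t < T ->
         is_derive x (basis_vec j) (fun y => u y t 0 i) (DX i j (x, t))),
      (forall i j k, {within cylc, continuous (DXX i j k)}) &
      (forall i j k x t, Om x -> 0 < t < T ->
         is_derive x (basis_vec k) (fun y => DX i j (y, t)) (DXX i j k (x, t)))].
Proof.
have C := solution_C21 u_solution.
have /choice[Dt hDt] : forall i, exists G, {within cylc, continuous G} /\
    forall p, cylinder Om T p -> G p = derive1 (fun t => u p.1 t 0 i) p.2.
  by move=> i; have [_ [_ ext] _ _] := C i.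
have /choice[DX' hDX'] : forall p : 'I_N * 'I_n, exists G, {within cylc, continuous G} /\
    forall q, cylinder Om T q -> G q = 'D_(basis_vec p.2) (fun x => u x q.2 0 p.1) q.1.
  by move=> [i j]; have [_ _ h _] := C i; have [_ ext] := h j.
have /choice[DXX' hDXX'] : forall p : 'I_N * 'I_n * 'I_n, exists G, {within cylc, continuous G} /\
    forall q, cylinder Om T q -> G q = 'D_(basis_vec p.2) (fun y =>
        'D_(basis_vec p.1.2) (fun x => u x q.2 0 p.1.1) y) q.1.
  by move=> [[i j] k]; have [_ _ _ h] := C i; have [_ ext] := h j k.
exists Dt, (fun i j => DX' (i, j)), (fun i j k => DXX' (i, j, k)); split.
- split; first by move=> i; case: (hDt i).
  move=> i x t Ox tT; have [_ [dt _] _ _] := C i; have [_ e] := hDt i.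
  rewrite e; last by split.
  rewrite derive1E; apply: DeriveDef => //.
  by apply: (dt (x, t)); split.
- by move=> i j; case: (hDX' (i, j)).
- move=> i j x t Ox tT; have [_ _ h _] := C i; have [dx _] := h j; have [_ e] := hDX' (i, j).
  rewrite e; last by split.
  by apply: DeriveDef => //; apply: (dx (x, t)); split.
- by move=> i j k; case: (hDXX' (i, j, k)).
- move=> i j k x t Ox tT; have [_ _ _ h] := C i; have [dx _] := h j k.
  have [_ e] := hDXX' (i, j, k); have [_ e1] := hDX' (i, j).
  have nO : nbhs x Om by apply: open_nbhs_nbhs; split => //; exact: domain_open.
  rewrite e; last by split.
  apply: (@near_eq_is_derive _ _ _ (fun y => 'D_(basis_vec j) (fun x => u x t 0 i) y)).
    by apply: filterS nO => y Oy; rewrite e1//; split.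
  by apply: DeriveDef => //; apply: (dx (x, t)); split.
Qed.

Definition cyl0 : set (V * R) := [set p | closure Om p.1 /\ 0 <= p.2 < T].

Lemma solution_coord_continuous i : {within cyl0, continuous (fun p => u p.1 p.2 0 i)}.
Proof.
exact: within_coord (solution_continuous u_solution).
Qed.

Lemma slice_u_continuous0 t : 0 <= t < T -> {within closure Om, continuous (fun x => u x t)}.
Proof.
move=> tT; have := solution_continuous u_solution => /subspace_continuousP cu.
apply/subspace_continuousP => x Ax.
have H := cu (x, t) (conj Ax tT).
have G := @cvg_within_map _ _ (closure Om)
  [set p : V * R | closure Om p.1 /\ 0 <= p.2 < T] (fun y : V => (y, t)) x
  (@continuous_pairl _ _ t x) (fun y Ay => conj Ay tT).
exact: cvg_comp G H.
Qed.

Lemma slice_u_continuous t : 0 < t < T -> {within closure Om, continuous (fun x => u x t)}.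
Proof. by move=> /andP[t0 tT]; apply: slice_u_continuous0; rewrite (ltW t0). Qed.

(** Positivity is assumed inside only; as a weak inequality it passes to the limit
at the boundary. *)
Lemma solution_orthant x t : closure Om x -> 0 < t < T -> orthant (u x t).
Proof.
move=> cx tT j; have cu := slice_u_continuous tT.
have cuj : {within closure Om, continuous (fun x => u x t 0 j)} by exact: within_coord cu.
rewrite leNgt; apply/negP => neg.
move/subspace_continuousP: cuj => /(_ x cx)/(@cvgr_lt _ _ _ _ _) /(_ _ neg).
rewrite near_withinE => nx; have [y [Oy /= hy]] := cx _ nx.
have := hy (subset_closure Oy); rewrite ltNge.
by rewrite ltW// (solution_positive u_solution).
Qed.

Variables (Dt : 'I_N -> V * R -> R)
    (DX : 'I_N -> 'I_n -> V * R -> R) (DXX : 'I_N -> 'I_n -> 'I_n -> V * R -> R).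
Hypotheses (DtC : forall i, {within cylc, continuous (Dt i)})
  (DtD : forall i x t, Om x -> 0 < t < T ->
         is_derive t (1 : R) (fun s => u x s 0 i) (Dt i (x, t)))
  (DXC : forall i j, {within cylc, continuous (DX i j)})
  (DXD : forall i j x t, Om x -> 0 < t < T ->
         is_derive x (basis_vec j) (fun y => u y t 0 i) (DX i j (x, t)))
  (DXXC : forall i j k, {within cylc, continuous (DXX i j k)})
  (DXXD : forall i j k x t, Om x -> 0 < t < T ->
         is_derive x (basis_vec k) (fun y => DX i j (y, t)) (DXX i j k (x, t))).

Variables (U : 'I_N -> set row) (G : 'I_N -> row -> R).
Hypotheses (oU : forall i, open (U i)) (orthU : forall i, @orthant R N `<=` U i)
  (smG : forall i, smooth (U i) (G i)) (Gd : forall i v, orthant v -> G i v = d i v).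

(** Outside the orthant the coefficients [d i] carry no information, and their
derivatives need not exist at its boundary; their smooth extensions [G i] do
not have this defect. *)
Definition dG i k v := 'D_(basis_vec k) (G i) v.
Definition ddG i k l v := 'D_(basis_vec l) (fun y => dG i k y) v.

Lemma G_reg i : [/\ (forall v, U i v -> {for v, continuous (G i)}),
  (forall k v, U i v -> is_derive v (basis_vec k) (G i) (dG i k v)),
  (forall k v, U i v -> {for v, continuous (dG i k)}),
  (forall k l v, U i v -> is_derive v (basis_vec l) (dG i k) (ddG i k l v)) &
  (forall k l v, U i v -> {for v, continuous (ddG i k l)})].
Proof.
have [c h] := smG i 2%N; split => //.
- by move=> k v Uv; have [dv _] := h k; apply: DeriveDef => //; exact: dv.
- by move=> k v Uv; have [_ [+ _]] := h k; exact.
- move=> k l v Uv; have [_ [_ h2]] := h k; have [dv _] := h2 l.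
  by apply: DeriveDef => //; exact: dv.
- by move=> k l v Uv; have [_ [_ h2]] := h k; have [_ [+ _]] := h2 l; exact.
Qed.

Lemma C1cl_u t i : 0 < t < T -> C1cl Om (fun x => u x t 0 i) (fun j x => DX i j (x, t)).
Proof.
move=> tT; split.
- exact: within_coord (slice_u_continuous tT).
- by move=> j; exact: (@slice_continuous _ _ (closure Om) T t (DX i j) tT (@DXC i j)).
- by move=> j x Ox; exact: DXD.
Qed.

Lemma C1cl_DX t i j : 0 < t < T ->
  C1cl Om (fun x => DX i j (x, t)) (fun k x => DXX i j k (x, t)).
Proof.
move=> tT; split.
- exact: (@slice_continuous _ _ (closure Om) T t (DX i j) tT (@DXC i j)).
- by move=> k; exact: (@slice_continuous _ _ (closure Om) T t (DXX i j k) tT (@DXXC i j k)).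
- by move=> k x Ox; exact: DXXD.
Qed.

Let uU i x t : 0 < t < T -> closure Om x -> U i (u x t).
Proof. by move=> tT cx; apply: orthU; exact: solution_orthant. Qed.

(** [gv] is the diffusion coefficient [d_i] along the solution, [wv] the product
[d_i u_i] under the Laplacian; [Dgv] and [Dwv] are their gradients. *)
Definition gv i (p : V * R) := G i (u p.1 p.2).
Definition Dgv i j (p : V * R) := \sum_k DX k j p * dG i k (u p.1 p.2).
Definition wv i (p : V * R) := gv i p * u p.1 p.2 0 i.
Definition Dwv i j (p : V * R) := gv i p * DX i j p + u p.1 p.2 0 i * Dgv i j p.

Lemma C1cl_gv t i : 0 < t < T -> C1cl Om (fun x => gv i (x, t)) (fun j x => Dgv i j (x, t)).
Proof.
move=> tT; have [GC GD dGC _ _] := G_reg i.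
apply: (@C1cl_comp_row R n Om N (G i) (dG i) (U i) (fun x => u x t)
  (fun k j x => DX k j (x, t))) => //.
- by move=> x cx; exact: uU.
- exact: slice_u_continuous.
- by move=> k; exact: C1cl_u.
Qed.

Lemma C1cl_dG t i k : 0 < t < T ->
  C1cl Om (fun x => dG i k (u x t)) (fun j x => \sum_l DX l j (x, t) * ddG i k l (u x t)).
Proof.
move=> tT; have [_ _ dGC dGD ddGC] := G_reg i.
apply: (@C1cl_comp_row R n Om N (dG i k) (ddG i k) (U i) (fun x => u x t)
  (fun k j x => DX k j (x, t))) => //.
- by move=> x cx; exact: uU.
- exact: slice_u_continuous.
- by move=> l; exact: C1cl_u.
- by move=> v; exact: dGC.
- by move=> l v; exact: ddGC.
Qed.

Lemma C1cl_wv t i : 0 < t < T -> C1cl Om (fun x => wv i (x, t)) (fun j x => Dwv i j (x, t)).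
Proof. by move=> tT; exact: C1clM (C1cl_gv i tT) (C1cl_u i tT). Qed.

Lemma C1cl_Dwv t i j : 0 < t < T -> exists DD, C1cl Om (fun x => Dwv i j (x, t)) DD.
Proof.
move=> tT.
have h1 := C1clM (C1cl_gv i tT) (C1cl_DX i j tT).
have h2 := C1cl_sum (index_enum 'I_N) (fun k => C1clM (C1cl_DX k j tT) (C1cl_dG i k tT)).
have h3 := C1clM (C1cl_u i tT) h2.
by have h4 := C1clD h1 h3; exists (fun k x => (gv i (x, t) * DXX i j k (x, t) + DX i j (x, t) * Dgv i k (x, t)) +
 (u x t 0 i * (\sum_k0 (DX k0 j (x, t) * (\sum_l DX l k (x, t) * ddG i k0 l (u x t)) + dG i k0 (u x t) * DXX k0 j k (x, t))) +
  (\sum_k0 DX k0 j (x, t) * dG i k0 (u x t)) * DX i k (x, t))); exact: h4.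
Qed.

(** The value of the Laplacian of [d_i u_i] that the equation prescribes; unlike
the Laplacian itself it is continuous up to the boundary for free. *)
Definition Lw i (p : V * R) := tau i * Dt i p - f (u p.1 p.2) 0 i.

(** [green] for [grad (d_i u_i)], which is C^1 up to the boundary and tangent to
it by the Neumann condition. *)
Lemma green_solution t i phi dphi : 0 < t < T -> C1cl Om phi dphi ->
  BM ((fun x => phi x * Lw i (x, t)) \_ Om) /\
  Int ((fun x => phi x * Lw i (x, t)) \_ Om) =
  - Int ((fun x => \sum_j dphi j x * Dwv i j (x, t)) \_ Om).
Proof.
move=> tT Cphi.
have /choice[DD hDD] := fun j => C1cl_Dwv i j tT.
have tw : tangent_field Om (fun j x => Dwv i j (x, t)).
  apply: (neumann_tangent Om_domain (C1cl_wv i tT)) => x v bx nv.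
  have cl : closure Om x by case/(boundaryE Om_domain): bx.
  apply: is_derive_in_eq cl _ (solution_boundary u_solution i bx nv tT).
  by move=> y cy; rewrite /wv /gv/= Gd//; exact: solution_orthant.
have oOm := domain_open Om_domain.
have E x : Om x -> \sum_j DD j j x = Lw i (x, t).
  move=> Ox; have eq := solution_equation u_solution i Ox tT.
  rewrite /Lw/= -eq derive1E.
  have -> : 'D_1 (fun s => u x s 0 i) t = Dt i (x, t) by case: (DtD i Ox tT).
  rewrite opprB addrC subrK /laplacian; apply: eq_bigr => j _.
  have [_ _ dd] := hDD j; have [_ <-] := dd j x Ox.
  apply: near_eq_derive.
  have nO : nbhs x Om by exact: open_nbhs_nbhs.
  apply: filterS nO => y Oy.
  have [_ _ dw] := C1cl_wv i tT; have [_ <-] := dw j y Oy.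
  apply: near_eq_derive.
  have nOy : nbhs y Om by exact: open_nbhs_nbhs.
  apply: filterS nOy => z Oz; rewrite /wv /gv/= Gd//.
  by apply: solution_orthant => //; exact: subset_closure.
have gr := green Om_domain Cphi hDD tw.
have e : (fun x => phi x * Lw i (x, t)) \_ Om = (fun x => phi x * \sum_j DD j j x) \_ Om.
  apply/funext => x; rewrite !patchE; case: ifPn => //; rewrite inE => Ox.
  by rewrite E.
rewrite e gr; split => //.
apply: BM_closure => //; apply: withinM; first by case: Cphi.
apply: (within_sum (f := fun j x => DD j j x)) => j.
by case: (hDD j) => _ + _; exact.
Qed.

End solution.

(** * Uniform time increments *)
Section time.
Context (R : realType) (n : nat).
Local Notation V := 'rV[R]_n.
Variables (Om : set V) (Om_domain : smooth_bounded_domain Om) (a b : R).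

Definition cylab : set (V * R) := closure Om `*` `[a, b].

Lemma compact_cylab : compact cylab.
Proof. by apply: compact_setX; [exact: compact_closure_domain|exact: segment_compact]. Qed.

(** A tube-lemma form of uniform continuity: only the time varies, and the
modulus does not depend on [x]. *)
Lemma unif_time (g : V * R -> R) : {within cylab, continuous g} ->
  forall delta, 0 < delta -> exists2 eta, 0 < eta & forall x t t', closure Om x ->
    a <= t <= b -> a <= t' <= b -> `|t' - t| <= eta -> `|g (x, t') - g (x, t)| <= delta.
Proof.
move=> cg delta d0.
have /compact_near_coveringP cov := compact_cylab.
have d2 : 0 < delta / 2 by rewrite divr_gt0.
have : \forall e \near 0^'+, cylab `<=` (fun p => cylab p -> forall t', a <= t' <= b ->
    `|t' - p.2| <= e -> `|g (p.1, t') - g p| <= delta).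
  apply: cov => -[x t] [/= cx tab].
  move/subspace_continuousP: cg => /(_ (x, t) (conj cx tab))/cvgrPdist_le/(_ _ d2).
  rewrite near_withinE => -[[A B] [/= nA nB] AB].
  have [r /= r0 hr] := iffLR (nbhs_ballP _ _) nB.
  have r2 : 0 < r / 2 by rewrite divr_gt0.
  exists (A `*` ball t (r / 2), [set e | e < r / 2]).
    split; last exact: nbhs_right_lt.
    by exists (A, ball t (r / 2)) => //; split => //; exact: nbhsx_ballx.
  move=> [[x' s] e] [/= [Ax' sr] er] [/= cx' sab] t' t'ab t's.
  have h1 : `|g (x, t) - g (x', s)| <= delta / 2.
    apply: (AB (x', s)) => //; split => //=; apply: hr.
    by apply: le_ball sr; rewrite ler_pdivrMr// ler_pMr// ler1n.
  have h2 : `|g (x, t) - g (x', t')| <= delta / 2.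
    apply: (AB (x', t')); split => //=; apply: hr.
    move: sr; rewrite -!ball_normE/= => sr.
    rewrite -(subrK s t) -addrA (le_lt_trans (ler_normD _ _))//.
    by rewrite [ltRHS]splitr ltrD// distrC (le_lt_trans t's).
  rewrite distrC in h2.
  rewrite -(subrK (g (x, t)) (g (x', t'))) -addrA (le_trans (ler_normD _ _))//.
  by rewrite [leRHS]splitr lerD.
move=> [e0 /= e00 he]; exists (e0 / 2); first by rewrite divr_gt0.
move=> x t t' cx tab t'ab tt.
have e2 : 0 < e0 / 2 by rewrite divr_gt0.
have := he (e0 / 2); rewrite /= sub0r normrN gtr0_norm//.
rewrite ltr_pdivrMr// ltr_pMr// ltr1n => /(_ isT e2 (x, t) (conj cx tab)).
by apply => //; split.
Qed.

(** The mean value theorem in time, with the modulus of [unif_time] for the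
derivative. *)
Lemma time_increment (v : V -> R -> R) (g : V * R -> R) : {within cylab, continuous g} ->
  (forall x t, Om x -> a <= t <= b -> is_derive t (1 : R) (v x) (g (x, t))) ->
  forall delta, 0 < delta -> exists2 eta, 0 < eta & forall x t t', Om x ->
    a <= t <= b -> a <= t' <= b -> `|t' - t| <= eta ->
    `|v x t' - v x t - (t' - t) * g (x, t)| <= delta * `|t' - t|.
Proof.
move=> cg dv delta d0; have [eta eta0 heta] := unif_time cg d0.
exists eta => // x t t' Ox tab t'ab tt.
have cx : closure Om x by exact: subset_closure.
have mvt s s' : a <= s -> s' <= b -> s <= s' ->
    exists2 c, s <= c <= s' & v x s' - v x s = g (x, c) * (s' - s).
  move=> as_ s'b ss.
  have dvs r : s <= r -> r <= s' -> is_derive r (1 : R) (v x) (g (x, r)).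
    by move=> sr rs; apply: dv => //; rewrite (le_trans as_ sr) (le_trans rs s'b).
  have [r||c] := @MVT_segment R (v x) (fun r => g (x, r)) s s' ss.
  - by rewrite in_itv/= => /andP[sr rs]; apply: dvs; exact: ltW.
  - apply: continuous_in_subspaceT => r; rewrite inE/= in_itv/= => /andP[sr rs].
    by apply: is_derive_continuous; exact: dvs.
  - by rewrite in_itv/= => sc E; exists c.
have [c cc E] : exists2 c, [/\ a <= c <= b & `|c - t| <= eta] &
    v x t' - v x t = (t' - t) * g (x, c).
  move: tab t'ab => /andP[ta tb] /andP[t'a t'b].
  have [h|/ltW h] := leP t t'.
    have [c /andP[c1 c2] E] := mvt t t' ta t'b h; exists c; last by rewrite E mulrC.
    split; first by rewrite (le_trans ta c1) (le_trans c2 t'b).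
    apply: le_trans tt; rewrite !ger0_norm ?subr_ge0//; lra.
  have [c /andP[c1 c2] E] := mvt t' t t'a tb h; exists c.
    split; first by rewrite (le_trans t'a c1) (le_trans c2 tb).
    apply: le_trans tt; rewrite !ler0_norm ?subr_le0//; lra.
  by rewrite -opprB E mulrC -mulNr opprB.
case: cc => cab ct; rewrite E -mulrBr normrM mulrC ler_wpM2r//.
exact: heta.
Qed.

End time.

(** * The space-time L^2 estimate *)
Section IO.
Context {R : realType} {n : nat}.
Local Notation V := 'rV[R]_n.
Variable Om : set V.
Implicit Types f g : V -> R.

Definition BO f := BM (f \_ Om).
Definition IO f := Int (f \_ Om).

Lemma patchO f x : Om x -> (f \_ Om) x = f x.
Proof. by move=> Ox; rewrite patchE mem_set. Qed.

Lemma patchN f x : ~ Om x -> (f \_ Om) x = 0.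
Proof. by move=> Ox; rewrite patchE memNset. Qed.

Lemma eq_patchO f g : (forall x, Om x -> f x = g x) -> f \_ Om = g \_ Om.
Proof.
by move=> fg; apply/funext => x; have [Ox|Ox] := pselect (Om x);
  [rewrite !patchO// fg|rewrite !patchN].
Qed.

Lemma eq_IO f g : (forall x, Om x -> f x = g x) -> IO f = IO g.
Proof. by move=> fg; rewrite /IO (eq_patchO fg). Qed.

Lemma eq_BO f g : (forall x, Om x -> f x = g x) -> BO f -> BO g.
Proof. by move=> fg; rewrite /BO (eq_patchO fg). Qed.

Let patchD f g : (fun x => f x + g x) \_ Om = (fun x => (f \_ Om) x + (g \_ Om) x).
Proof.
by apply/funext => x; have [Ox|Ox] := pselect (Om x);
  [rewrite !patchO|rewrite !patchN// addr0].
Qed.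

Let patchZ c f : (fun x => c * f x) \_ Om = (fun x => c * (f \_ Om) x).
Proof.
by apply/funext => x; have [Ox|Ox] := pselect (Om x);
  [rewrite !patchO|rewrite !patchN// mulr0].
Qed.

Let patch_sum I (r : seq I) (f : I -> V -> R) :
  (fun x => \sum_(i <- r) f i x) \_ Om = (fun x => \sum_(i <- r) (f i \_ Om) x).
Proof.
apply/funext => x; have [Ox|Ox] := pselect (Om x).
  by rewrite patchO//; apply: eq_bigr => i _; rewrite patchO.
by rewrite patchN// big1// => i _; rewrite patchN.
Qed.

Lemma BO_D f g : BO f -> BO g -> BO (fun x => f x + g x).
Proof. by rewrite /BO patchD; exact: BMD. Qed.

Lemma BO_Z c f : BO f -> BO (fun x => c * f x).
Proof. by rewrite /BO patchZ; exact: BMZ. Qed.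

Lemma BO_sum I (r : seq I) (f : I -> V -> R) : (forall i, BO (f i)) ->
  BO (fun x => \sum_(i <- r) f i x).
Proof. by move=> h; rewrite /BO patch_sum; apply: BM_sum => i _; exact: h. Qed.

Lemma IO_D f g : BO f -> BO g -> IO (fun x => f x + g x) = IO f + IO g.
Proof. by rewrite /IO patchD; exact: IntD. Qed.

Lemma IO_Z c f : BO f -> IO (fun x => c * f x) = c * IO f.
Proof. by rewrite /IO patchZ; exact: IntZ. Qed.

Lemma IO_sum I (r : seq I) (f : I -> V -> R) : (forall i, BO (f i)) ->
  IO (fun x => \sum_(i <- r) f i x) = \sum_(i <- r) IO (f i).
Proof. by move=> h; rewrite /IO patch_sum Int_sum// => i _; exact: h. Qed.

Lemma le_IO f g : BO f -> BO g -> (forall x, Om x -> f x <= g x) -> IO f <= IO g.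
Proof.
move=> bf bg fg; apply: le_Int => // x.
by have [Ox|Ox] := pselect (Om x); [rewrite !patchO// fg|rewrite !patchN].
Qed.

Lemma IO_ge0 f : (forall x, Om x -> 0 <= f x) -> 0 <= IO f.
Proof.
move=> f0; apply: Int_ge0 => x.
by have [Ox|Ox] := pselect (Om x); [rewrite !patchO// f0|rewrite !patchN].
Qed.

Lemma BO_N f : BO f -> BO (fun x => - f x).
Proof.
move=> h; apply: (@eq_BO (fun x => -1 * f x)); last exact: BO_Z.
by move=> x _; rewrite mulN1r.
Qed.

Lemma IO_N f : BO f -> IO (fun x => - f x) = - IO f.
Proof.
move=> h; rewrite (@eq_IO _ (fun x => -1 * f x)); first by rewrite IO_Z// mulN1r.
by move=> x _; rewrite mulN1r.
Qed.

Lemma BO_B f g : BO f -> BO g -> BO (fun x => f x - g x).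
Proof. by move=> bf bg; apply: BO_D => //; exact: BO_N. Qed.

Lemma IO_B f g : BO f -> BO g -> IO (fun x => f x - g x) = IO f - IO g.
Proof. by move=> bf bg; rewrite IO_D ?IO_N//; exact: BO_N. Qed.

Lemma IO_0 : IO (fun=> 0) = 0.
Proof.
rewrite /IO -[RHS](@Int0 R n); congr Int; apply/funext => x.
by rewrite patchE; case: ifP.
Qed.

End IO.

(** The discrete form of [int_0^t (int_0^s c) c s = (int_0^t c)^2 / 2], whose error
term is the diagonal. *)
Lemma triangular_sum (R : realType) (c : nat -> R) m :
  \sum_(l < m) (\sum_(k < l) c k) * c l = ((\sum_(k < m) c k) ^+ 2 - \sum_(l < m) c l ^+ 2) / 2.
Proof.
elim: m => [|m IH]; first by rewrite !big_ord0 expr0n subrr mul0r.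
by rewrite !big_ord_recr/= IH; field.
Qed.

(** In this section [w] and [z] stand for [sum_i tau_i u_i] and
[sum_i d_i u_i], [Dz] for the gradient of [z], [Lz] for its Laplacian and
[wt] for the time derivative of [w]. *)
Section L2.
Context {R : realType} {n : nat}.
Local Notation V := 'rV[R]_n.
Variables (Om : set V) (Om_domain : smooth_bounded_domain Om).
Variables (w z wt Lz : V * R -> R) (Dz : 'I_n -> V * R -> R).
Variables (a b T' M0 Cz MD : R).
Hypotheses (ab : a < b) (abT : b - a <= T').
Hypotheses (wC : forall t, a <= t <= b -> {within closure Om, continuous (fun x => w (x, t))})
  (zC : forall t, a <= t <= b -> C1cl Om (fun x => z (x, t)) (fun j x => Dz j (x, t)))
  (green_z : forall t phi dphi, a <= t <= b -> C1cl Om phi dphi ->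
     BO Om (fun x => phi x * Lz (x, t)) /\
     IO Om (fun x => phi x * Lz (x, t)) = - IO Om (fun x => \sum_j dphi j x * Dz j (x, t)))
  (wt_le : forall x t, Om x -> a <= t <= b -> wt (x, t) <= Lz (x, t))
  (w_inc : exists2 eta, 0 < eta & forall x t t', Om x ->
    a <= t <= b -> a <= t' <= b -> `|t' - t| <= eta ->
    `|w (x, t') - w (x, t) - (t' - t) * wt (x, t)| <= 1 * `|t' - t|)
  (z_ge0 : forall x t, Om x -> a <= t <= b -> 0 <= z (x, t))
  (z_le : forall x t, Om x -> a <= t <= b -> z (x, t) <= Cz * w (x, t))
  (Cz0 : 0 <= Cz) (M00 : 0 <= M0)
  (w_init : forall x, Om x -> w (x, a) <= M0)
  (Dz_le : forall j x t, Om x -> a <= t <= b -> `|Dz j (x, t)| <= MD).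

Definition vol := IO Om (fun=> 1).
(** The initial bound, plus the discretisation error accumulated over a time
[T'] at the rate [1] allowed in [w_inc]. *)
Definition M1 := M0 + T'.

Lemma BO_cst c : BO Om (fun=> c).
Proof. by apply: BM_closure => //; exact: within_cst. Qed.

Lemma IO_cst c : IO Om (fun=> c) = c * vol.
Proof.
rewrite -IO_Z; last exact: BO_cst.
by apply: eq_IO => x _; rewrite mulr1.
Qed.

Lemma vol_ge0 : 0 <= vol. Proof. by apply: IO_ge0 => x _; exact: ler01. Qed.

Definition grid (K k : nat) : R := a + (b - a) / K%:R * k%:R.

Lemma grid_in K k : (0 < K)%N -> (k <= K)%N -> a <= grid K k <= b.
Proof.
move=> K0 kK; have K0' : 0 < K%:R :> R by rewrite ltr0n.
have kK' : k%:R <= K%:R :> R by rewrite ler_nat.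
have ba : 0 <= (b - a) / K%:R by rewrite divr_ge0 ?subr_ge0 ?ltW.
rewrite /grid lerDl mulr_ge0//= -lerBrDl mulrAC ler_pdivrMr//.
by rewrite ler_wpM2l// subr_ge0 ltW.
Qed.

Lemma grid_step K k : grid K k.+1 - grid K k = (b - a) / K%:R.
Proof. by rewrite /grid -natr1; ring. Qed.

(** The inequality [D_t w <= Laplacian z] summed over the grid. *)
Lemma w_grid : exists2 K0 : nat, (0 < K0)%N & forall K l x, (K0 <= K)%N -> (l <= K)%N -> Om x ->
  w (x, grid K l) <= M1 + (b - a) / K%:R * \sum_(k < l) Lz (x, grid K k).
Proof.
have [eta eta0 heta] := w_inc.
have ba : 0 < b - a by rewrite subr_gt0.
pose K0 := (Num.truncn ((b - a) / eta)).+1; exists K0 => // K l x KK lK Ox.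
have K0' : (0 < K)%N by apply: leq_trans KK.
have Kr : 0 < K%:R :> R by rewrite ltr0n.
have h0 : 0 < (b - a) / K%:R by rewrite divr_gt0.
have heta' : (b - a) / K%:R <= eta.
  rewrite ler_pdivrMr// mulrC -ler_pdivrMr//; apply: ltW.
  by rewrite (lt_le_trans (truncnS_gt _))// ler_nat.
suff H : w (x, grid K l) <= M0 + (b - a) / K%:R * l%:R + (b - a) / K%:R * \sum_(k < l) Lz (x, grid K k).
  apply: (le_trans H); rewrite lerD2r /M1 lerD2l (le_trans _ abT)// mulrAC ler_pdivrMr//.
  by rewrite ler_wpM2l ?(ltW ba)// ler_nat.
elim: l lK => [|l IH] lK.
  by rewrite big_ord0 !mulr0 !addr0 /grid mulr0 addr0 w_init.
have {}IH := IH (ltnW lK).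
have g1 := grid_in K0' (ltnW lK); have g2 := grid_in K0' lK.
have := heta x (grid K l) (grid K l.+1) Ox g1 g2.
rewrite grid_step ger0_norm ?(ltW h0)// => /(_ heta').
rewrite ler_norml mul1r => /andP[_ E].
have W := wt_le Ox g1.
rewrite big_ord_recr/= -natr1.
have W' := ler_wpM2l (ltW h0) W.
by move: E W' IH; move: ((b - a) / K%:R) => h; rewrite !mulrDr; lra.
Qed.

Let BOw t : a <= t <= b -> BO Om (fun x => w (x, t)).
Proof. by move=> tab; apply: BM_closure => //; exact: wC. Qed.

Let BOz t : a <= t <= b -> BO Om (fun x => z (x, t)).
Proof. by move=> tab; apply: BM_closure => //; case: (zC tab). Qed.

(** [w_grid] tested with [phi >= 0]; Green's formula trades the Laplacian of [z]
for [- grad phi . grad z]. *)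
Lemma w_test K l phi dphi : (forall l x, (l <= K)%N -> Om x ->
     w (x, grid K l) <= M1 + (b - a) / K%:R * \sum_(k < l) Lz (x, grid K k)) ->
  (0 < K)%N -> (l <= K)%N -> C1cl Om phi dphi -> (forall x, Om x -> 0 <= phi x) ->
  IO Om (fun x => phi x * w (x, grid K l)) <= M1 * IO Om phi
   - (b - a) / K%:R * IO Om (fun x => \sum_(k < l) \sum_j dphi j x * Dz j (x, grid K k)).
Proof.
move=> hw K0 lK Cphi phi0.
have gl := grid_in K0 lK.
have gk (k : 'I_l) : a <= grid K k <= b.
  by apply: grid_in => //; rewrite (leq_trans _ lK)// ltnW.
have B1 : BO Om phi by apply: BM_closure => //; case: Cphi.
have B2 : BO Om (fun x => phi x * w (x, grid K l)).
  by apply: BM_closure => //; apply: withinM; [case: Cphi|exact: wC].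
have B3 (k : 'I_l) := (green_z (gk k) Cphi).1.
have B4 (k : 'I_l) : BO Om (fun x => \sum_j dphi j x * Dz j (x, grid K k)).
  apply: BM_closure => //; apply: (within_sum (f := fun j x => dphi j x * Dz j (x, grid K k))) => j.
  by apply: withinM; [case: Cphi|case: (zC (gk k))].
have E : IO Om (fun x => \sum_(k < l) phi x * Lz (x, grid K k)) =
    - IO Om (fun x => \sum_(k < l) \sum_j dphi j x * Dz j (x, grid K k)).
  rewrite IO_sum// IO_sum// -sumrN; apply: eq_bigr => k _.
  by rewrite (green_z (gk k) Cphi).2.
rewrite -mulrN -E -IO_Z// -IO_Z; last exact: BO_sum.
rewrite -IO_D; [|exact: BO_Z|by apply: BO_Z; exact: BO_sum].
apply: le_IO => //.
  by apply: BO_D; [exact: BO_Z|by apply: BO_Z; exact: BO_sum].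
move=> x Ox; have := ler_wpM2l (phi0 x Ox) (hw l x lK Ox).
move=> H; apply: (le_trans H); rewrite -mulr_sumr; rewrite le_eqVlt; apply/orP; left; apply/eqP; ring.
Qed.

Let M10 : 0 <= M1.
Proof. by rewrite /M1 addr_ge0// (le_trans _ abT)// subr_ge0 ltW. Qed.

Lemma mass_grid K l : (forall l x, (l <= K)%N -> Om x ->
     w (x, grid K l) <= M1 + (b - a) / K%:R * \sum_(k < l) Lz (x, grid K k)) ->
  (0 < K)%N -> (l <= K)%N -> IO Om (fun x => w (x, grid K l)) <= M1 * vol.
Proof.
move=> hw K0 lK.
have := w_test hw K0 lK (C1cl_cst Om 1) (fun _ _ => ler01).
have -> : IO Om (fun x => \sum_(k < l) \sum_j 0 * Dz j (x, grid K k)) = 0.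
  rewrite -[RHS](@IO_0 R n Om); apply: eq_IO => x _.
  by rewrite big1// => k _; rewrite big1// => j _; rewrite mul0r.
rewrite mulr0 subr0; apply: le_trans; rewrite le_eqVlt; apply/orP; left; apply/eqP.
by apply: eq_IO => x _; rewrite mul1r.
Qed.

(** Test with [phi = z] at each grid time and add up: the double sum of
[grad z_k . grad z_l] over [k < l] is half a square minus half the diagonal
([triangular_sum]), and the diagonal is of the order of the mesh.  The right
side is controlled by the mass of [z <= Cz * w]. *)
Lemma L2_grid : exists2 K0 : nat, (0 < K0)%N & forall K, (K0 <= K)%N ->
  (b - a) / K%:R * \sum_(l < K.+1) IO Om (fun x => w (x, grid K l) * z (x, grid K l)) <=
    2 * T' * Cz * M1 ^+ 2 * vol + 1 /\
  forall l, (l <= K)%N -> IO Om (fun x => w (x, grid K l)) <= M1 * vol.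
Proof.
have [K1 K10 hK1] := w_grid.
have ba : 0 < b - a by rewrite subr_gt0.
pose D := n%:R * MD ^+ 2.
have D0 : 0 <= D by rewrite mulr_ge0// sqr_ge0.
have v0 := vol_ge0.
(* From this many steps on, the diagonal term is at most [1]. *)
pose K2 := (Num.truncn ((b - a) ^+ 2 * D * vol)).+1.
exists (K1 + K2)%N; first by rewrite addn_gt0 K10.
move=> K KK; have KK1 : (K1 <= K)%N by rewrite (leq_trans _ KK)// leq_addr.
have KK2 : (K2 <= K)%N by rewrite (leq_trans _ KK)// leq_addl.
have K0 : (0 < K)%N by rewrite (leq_trans K10).
have hw l x : (l <= K)%N -> Om x ->
     w (x, grid K l) <= M1 + (b - a) / K%:R * \sum_(k < l) Lz (x, grid K k).
  by move=> lK Ox; exact: (hK1 K l x KK1 lK Ox).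
have mass l (lK : (l <= K)%N) := mass_grid hw K0 lK.
split => //.
have gin (l : 'I_K.+1) : a <= grid K l <= b by apply: grid_in => //; rewrite -ltnS.
have Kr : 0 < K%:R :> R by rewrite ltr0n.
set h := (b - a) / K%:R; have h0 : 0 < h by rewrite divr_gt0.
pose X (l : 'I_K.+1) x := \sum_(k < l) \sum_j Dz j (x, grid K l) * Dz j (x, grid K k).
have gk (l : 'I_K.+1) (k : 'I_l) : a <= grid K k <= b.
  by apply: grid_in => //; rewrite ltnW// (leq_trans (ltn_ord k))// -ltnS.
have BX l : BO Om (X l).
  apply: BO_sum => k; apply: BM_closure => //.
  apply: (within_sum (f := fun j x => Dz j (x, grid K l) * Dz j (x, grid K k))) => j.
  by apply: withinM; [case: (zC (gin l))|case: (zC (gk l k))].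
have step (l : 'I_K.+1) : IO Om (fun x => w (x, grid K l) * z (x, grid K l)) <=
    M1 * (Cz * (M1 * vol)) - h * IO Om (X l).
  have lK : (l <= K)%N by rewrite -ltnS.
  have z0 x : Om x -> 0 <= z (x, grid K l) by move=> Ox; exact: z_ge0.
  rewrite (@eq_IO _ _ _ _ (fun x => z (x, grid K l) * w (x, grid K l))); last first.
    by move=> x _; rewrite mulrC.
  apply: (le_trans (w_test hw K0 lK (zC (gin l)) z0)).
  rewrite lerD2r ler_wpM2l//.
  apply: (@le_trans _ _ (IO Om (fun x => Cz * w (x, grid K l)))).
    apply: le_IO; [exact/BOz/gin|exact/BO_Z/BOw/gin|].
    by move=> x Ox; exact: z_le.
  by rewrite IO_Z ?ler_wpM2l ?mass//; exact/BOw/gin.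
have lowX : - (K.+1%:R * D / 2 * vol) <= IO Om (fun x => \sum_(l < K.+1) X l x).
  rewrite -mulNr -IO_cst; apply: le_IO; [exact: BO_cst|exact: BO_sum|move=> x Ox].
  have -> : \sum_(l < K.+1) X l x = \sum_j \sum_(l < K.+1)
      (\sum_(k < l) Dz j (x, grid K k)) * Dz j (x, grid K l).
    rewrite exchange_big/=; apply: eq_bigr => l _; rewrite /X exchange_big/=.
    apply: eq_bigr => j _; rewrite mulr_suml; apply: eq_bigr => k _; exact: mulrC.
  have -> : - (K.+1%:R * D / 2) = \sum_(j < n) - (K.+1%:R * MD ^+ 2 / 2).
    by rewrite sumr_const card_ord -[RHS]mulr_natl /D; field.
  apply: ler_sum => j _; rewrite (triangular_sum (fun k => Dz j (x, grid K k))).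
  rewrite -mulNr ler_wpM2r ?invr_ge0//.
  have : \sum_(l < K.+1) Dz j (x, grid K l) ^+ 2 <= K.+1%:R * MD ^+ 2.
    have -> : K.+1%:R * MD ^+ 2 = \sum_(l < K.+1) MD ^+ 2.
      by rewrite sumr_const card_ord mulr_natl.
    apply: ler_sum => l _; rewrite -[leLHS]real_normK ?num_real//.
    by rewrite ler_sqr ?nnegrE// ?Dz_le// (le_trans _ (Dz_le j Ox (gin l))).
  have := sqr_ge0 (\sum_(k < K.+1) Dz j (x, grid K k)); lra.
apply: (@le_trans _ _ (h * \sum_(l < K.+1) (M1 * (Cz * (M1 * vol)) - h * IO Om (X l)))).
  by rewrite ler_wpM2l ?(ltW h0)//; apply: ler_sum.
rewrite sumrB sumr_const card_ord -mulr_sumr -IO_sum// -[X in h * (X - _)]mulr_natl mulrBr.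
have hK : h * K.+1%:R <= 2 * (b - a).
  rewrite /h mulrAC ler_pdivrMr// -mulrA mulrCA ler_wpM2l ?(ltW ba)//.
  by rewrite -natr1 (mulrC 2) mulr_natr mulr2n lerD2l ler1n.
have P1 : h * (K.+1%:R * (M1 * (Cz * (M1 * vol)))) <= 2 * T' * Cz * M1 ^+ 2 * vol.
  have -> : 2 * T' * Cz * M1 ^+ 2 * vol = (2 * T') * (M1 * (Cz * (M1 * vol))) by ring.
  rewrite mulrA ler_wpM2r ?mulr_ge0// (le_trans hK)// ler_wpM2l//.
apply: lerD => //.
rewrite -mulrN; apply: (@le_trans _ _ (h * (h * (K.+1%:R * D / 2 * vol)))).
  by rewrite ler_wpM2l ?(ltW h0)// -mulrN ler_wpM2l ?(ltW h0)// lerNl.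
have -> : h * (h * (K.+1%:R * D / 2 * vol)) = (h * K.+1%:R) * (h * D * vol / 2) by ring.
apply: (@le_trans _ _ (2 * (b - a) * (h * D * vol / 2))).
  by rewrite ler_wpM2r// divr_ge0// mulr_ge0// mulr_ge0// ltW.
have -> : 2 * (b - a) * (h * D * vol / 2) = ((b - a) ^+ 2 * D * vol) / K%:R.
  by rewrite /h; field; rewrite gt_eqF.
rewrite ler_pdivrMr// mul1r; apply: ltW; rewrite (lt_le_trans (truncnS_gt _))// ler_nat//.
Qed.

End L2.

(** * Pointwise inequalities for the entropy *)
Section real_entropy.
Context {R : realType}.
Implicit Types (s e M : R).

Lemma ln_leB1 (y : R) : 0 < y -> ln y <= y - 1.
Proof. by move=> y0; have := @le_ln1Dx R (y - 1); rewrite (addrC 1) subrK; apply; lra. Qed.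

(** Concavity of the logarithm, [ln r <= r - 1] at [r = y / x]. *)
Lemma mul_lnB_le (x y : R) : 0 < x -> 0 < y -> x * (ln y - ln x) <= y - x.
Proof.
move=> x0 y0; rewrite -ln_div//.
have : x * ln (y / x) <= x * (y / x - 1) by rewrite ler_wpM2l ?(ltW x0)// ln_leB1// divr_gt0.
by rewrite mulrBr mulr1 mulrCA divff ?mulr1// gt_eqF.
Qed.

(** The primitive of [ln (s + e)], up to a constant. *)
Definition Psi e s := (s + e) * ln (s + e) - s.

Lemma Psi_convex e s s' : 0 < e -> 0 <= s -> 0 <= s' ->
  Psi e s' - Psi e s <= ln (s' + e) * (s' - s).
Proof.
move=> e0 s0 s'0; have h : 0 < s + e by rewrite ltr_wpDl.
have h' : 0 < s' + e by rewrite ltr_wpDl.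
have := mul_lnB_le h h'; rewrite /Psi; nra.
Qed.

Lemma ln1D_le s : 0 <= s -> ln (1 + s) <= s.
Proof. by move=> s0; apply: le_ln1Dx; lra. Qed.

Lemma ln1D_ge0 s : 0 <= s -> 0 <= ln (1 + s).
Proof. by move=> s0; apply: ln_ge0; lra. Qed.

Lemma Psi_lower e s : 0 < e -> e <= 1 -> 0 <= s -> s * ln (1 + s) <= Psi e s + s + 2.
Proof.
move=> e0 e1 s0; have h : 0 < s + e by rewrite ltr_wpDl.
have h1 : 0 < 1 + s by rewrite ltr_pwDl.
have A := mul_lnB_le h h1.
have B := @ln1D_ge0 s s0.
have C : e * ln (1 + s) >= 0 by apply: mulr_ge0 => //; exact: ltW.
rewrite /Psi; nra.
Qed.

Lemma Psi_upper e s : 0 < e -> e <= 1 -> 0 <= s -> Psi e s <= (s + 1) * s.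
Proof.
move=> e0 e1 s0; have h : 0 < s + e by rewrite ltr_wpDl.
have L : ln (s + e) <= s by rewrite (le_trans (ln_leB1 h))//; lra.
rewrite /Psi; nra.
Qed.

(** [X = ln (1 + m) - ln (s + e)] is nonnegative and [s X <= 1 + m], so the lower
bound on [F] suffices, whatever the sign of [F]. *)
Lemma react_term e s m F Cf : 0 < e -> e <= 1 -> 0 <= s -> s <= m -> 0 <= Cf ->
  - Cf * (1 + m) * s <= F ->
  F * ln (s + e) <= F * ln (1 + m) + Cf * (1 + m) ^+ 2.
Proof.
move=> e0 e1 s0 sm C0 hF.
have h : 0 < s + e by rewrite ltr_wpDl.
have m0 : 0 <= m by rewrite (le_trans s0).
have h1 : 0 < 1 + m by rewrite ltr_pwDl.
have A := mul_lnB_le h h1.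
have L : ln (s + e) <= ln (1 + m) by rewrite ler_ln ?posrE//; lra.
set X := ln (1 + m) - ln (s + e) in A.
have X0 : 0 <= X by rewrite subr_ge0.
have sX : s * X <= 1 + m.
  apply: (@le_trans _ _ ((s + e) * X)); first by rewrite ler_wpM2r//; lra.
  by rewrite (le_trans A)//; lra.
have B : - F * X <= Cf * (1 + m) * s * X.
  by rewrite ler_wpM2r//; lra.
have D : Cf * (1 + m) * s * X <= Cf * (1 + m) * (1 + m).
  by rewrite -mulrA ler_wpM2l// mulr_ge0// ltW.
have E : ln (s + e) = ln (1 + m) - X by rewrite /X; ring.
rewrite E; nra.
Qed.

Lemma reaction_bound (N : nat) (uu F : 'I_N -> R) e m Cf : 0 < e -> e <= 1 -> 0 <= Cf ->
  (forall i, 0 <= uu i <= m) -> 0 <= m -> (forall i, - Cf * (1 + m) * uu i <= F i) ->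
  \sum_i F i <= 0 -> \sum_i F i * ln (uu i + e) <= N%:R * (Cf * (1 + m) ^+ 2).
Proof.
move=> e0 e1 C0 um m0 hF sF.
apply: (@le_trans _ _ (\sum_i (F i * ln (1 + m) + Cf * (1 + m) ^+ 2))).
  by apply: ler_sum => i _; have /andP[u0 u1] := um i; exact: react_term.
rewrite big_split/= -mulr_suml sumr_const card_ord -[X in _ + X <= _]mulr_natl gerDr.
by rewrite mulr_le0_ge0// ln1D_ge0.
Qed.

Lemma sqrt_theta_bound (x y : R) : 0 <= x <= 1 -> 0 <= y <= 1 ->
  `|x - Num.sqrt x * Num.sqrt y| <= (1 - x) + (1 - y).
Proof.
move=> /andP[x0 x1] /andP[y0 y1].
have sx : Num.sqrt x ^+ 2 = x by rewrite sqr_sqrtr.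
have sy : Num.sqrt y ^+ 2 = y by rewrite sqr_sqrtr.
have px := sqrtr_ge0 x; have py := sqrtr_ge0 y.
have qx : Num.sqrt x <= 1 by rewrite -sqrtr1 ler_sqrt.
have qy : Num.sqrt y <= 1 by rewrite -sqrtr1 ler_sqrt.
move: sx sy px py qx qy; move: (Num.sqrt x) (Num.sqrt y) => p q <- <- p0 q0 p1 q1.
rewrite ler_norml; apply/andP; split; nra.
Qed.

(** Put [theta = u / (u + e)].  The form on the right has coefficients
[theta_i * dg i k] where the nonnegative form evaluated at
[sqrt theta_i * xi_i] has [sqrt theta_i * sqrt theta_k * dg i k]; the diagonal
parts agree.  The difference of the two is bounded by
[(1 - theta_i) + (1 - theta_k)] ([sqrt_theta_bound]), and
[1 - theta_i = e / (u_i + e)]. *)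
Lemma degenerate_form (N : nat) (dg : 'I_N -> 'I_N -> R) (g u xi : 'I_N -> R) e MD MG :
  0 < e -> (forall i, 0 < u i) ->
  (forall zeta : 'I_N -> R, 0 <= \sum_i \sum_k dg i k * zeta i * zeta k + \sum_i g i * zeta i ^+ 2 / u i) ->
  (forall i, `|xi i| <= MD) -> (forall i k, `|dg i k| <= MG) ->
  - (2 * N%:R * MG * MD ^+ 2 * \sum_i e / (u i + e)) <=
  \sum_i xi i / (u i + e) * (g i * xi i + u i * \sum_k xi k * dg i k).
Proof.
move=> e0 u0 P xiM dgM.
pose th i := u i / (u i + e).
have ue i : 0 < u i + e by rewrite addr_gt0.
have th01 i : 0 <= th i <= 1.
  apply/andP; split; first by apply: divr_ge0; exact: ltW.
  by rewrite ler_pdivrMr// mul1r lerDl ltW.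
have the i : 1 - th i = e / (u i + e) by rewrite /th; field; rewrite gt_eqF.
have sth i : Num.sqrt (th i) ^+ 2 = th i by rewrite sqr_sqrtr//; case/andP: (th01 i).
have := P (fun i => Num.sqrt (th i) * xi i).
have -> : \sum_i g i * (Num.sqrt (th i) * xi i) ^+ 2 / u i = \sum_i xi i / (u i + e) * (g i * xi i).
  apply: eq_bigr => i _; rewrite exprMn sth /th; field.
  by rewrite !gt_eqF.
have -> : \sum_i xi i / (u i + e) * (g i * xi i + u i * \sum_k xi k * dg i k) =
   \sum_i xi i / (u i + e) * (g i * xi i) + \sum_i \sum_k th i * (dg i k * xi i * xi k).
  rewrite -big_split/=; apply: eq_bigr => i _; rewrite mulrDr; congr (_ + _).
  by rewrite !mulr_sumr; apply: eq_bigr => k _; rewrite /th; ring.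
move=> H.
have K : \sum_i \sum_k dg i k * (Num.sqrt (th i) * xi i) * (Num.sqrt (th k) * xi k)
    - \sum_i \sum_k th i * (dg i k * xi i * xi k) <= 2 * N%:R * MG * MD ^+ 2 * \sum_i e / (u i + e).
  rewrite -sumrB.
  have -> : 2 * N%:R * MG * MD ^+ 2 * \sum_i e / (u i + e) =
      \sum_i \sum_k MG * MD ^+ 2 * ((1 - th i) + (1 - th k)).
    transitivity (\sum_(i < N) (MG * MD ^+ 2 * (N%:R * (1 - th i) + \sum_k (1 - th k)))).
      pose A := \sum_k (1 - th k).
      have -> : \sum_i e / (u i + e) = A by apply: eq_bigr => i _; rewrite -the.
      rewrite -mulr_sumr big_split/= -mulr_sumr -/A sumr_const card_ord -(mulr_natl A); ring.
    apply: eq_bigr => i _; rewrite -mulr_sumr [in RHS]big_split/= sumr_const card_ord.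
    by rewrite -(mulr_natl (1 - th i)).
  apply: ler_sum => i _; rewrite -sumrB; apply: ler_sum => k _.
  have -> : dg i k * (Num.sqrt (th i) * xi i) * (Num.sqrt (th k) * xi k) - th i * (dg i k * xi i * xi k)
    = (dg i k * (xi i * xi k)) * - (th i - Num.sqrt (th i) * Num.sqrt (th k)) by ring.
  apply: (le_trans (ler_norm _)); rewrite normrM normrN ler_pM//; last exact: sqrt_theta_bound.
  by rewrite !normrM ler_pM// expr2 ler_pM.
lra.
Qed.

End real_entropy.

(** * The entropy inequality *)

(** Here [g], [dg] are the diffusion coefficients and their derivatives along the
solution, [Lw] the Laplacians of [g i * ui i], [Dwv] their gradients, and [wz]
the function that dominates the reaction. *)
Section entropy.
Context {R : realType} {n N : nat}.
Local Notation V := 'rV[R]_n.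
Variables (Om : set V) (Om_domain : smooth_bounded_domain Om).
Variables (ui : 'I_N -> V * R -> R) (Dt Lw : 'I_N -> V * R -> R)
  (DX : 'I_N -> 'I_n -> V * R -> R) (g : 'I_N -> V * R -> R)
  (dg : 'I_N -> 'I_N -> V * R -> R) (wz : V * R -> R) (tau : 'I_N -> R).
Variables (a b MD MG MU CR : R).
Hypotheses (ab : a < b) (tau_gt0 : forall i, 0 < tau i) (CR0 : 0 <= CR)
  (MD0 : 0 <= MD) (MG0 : 0 <= MG).
Let Dwv i j p := g i p * DX i j p + ui i p * \sum_k DX k j p * dg i k p.
Hypotheses
  (uC : forall i t, a <= t <= b -> C1cl Om (fun x => ui i (x, t)) (fun j x => DX i j (x, t)))
  (u_ge0 : forall i x t, closure Om x -> a <= t <= b -> 0 <= ui i (x, t))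
  (u_gt0 : forall i x t, Om x -> a <= t <= b -> 0 < ui i (x, t))
  (u_time : forall i x, Om x -> {within `[a, b], continuous (fun t => ui i (x, t))})
  (u_le : forall i x t, closure Om x -> a <= t <= b -> ui i (x, t) <= MU)
  (DX_le : forall i j x t, Om x -> a <= t <= b -> `|DX i j (x, t)| <= MD)
  (dg_le : forall i k x t, Om x -> a <= t <= b -> `|dg i k (x, t)| <= MG)
  (psd_form : forall x t (zeta : 'I_N -> R), Om x -> a <= t <= b ->
     0 <= \sum_i \sum_k dg i k (x, t) * zeta i * zeta k + \sum_i g i (x, t) * zeta i ^+ 2 / ui i (x, t))
  (green_w : forall i t phi dphi, a <= t <= b -> C1cl Om phi dphi ->
     BO Om (fun x => phi x * Lw i (x, t)) /\
     IO Om (fun x => phi x * Lw i (x, t)) = - IO Om (fun x => \sum_j dphi j x * Dwv i j (x, t)))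
  (DwvC : forall i j t, a <= t <= b -> {within closure Om, continuous (fun x => Dwv i j (x, t))})
  (u_inc : forall i delta, 0 < delta -> exists2 eta, 0 < eta & forall x t t', Om x ->
    a <= t <= b -> a <= t' <= b -> `|t' - t| <= eta ->
    `|ui i (x, t') - ui i (x, t) - (t' - t) * Dt i (x, t)| <= delta * `|t' - t|)
  (react : forall x t e, Om x -> a <= t <= b -> 0 < e -> e <= 1 ->
     \sum_i (tau i * Dt i (x, t) - Lw i (x, t)) * ln (ui i (x, t) + e) <= CR * (1 + wz (x, t)))
  (wzC : forall t, a <= t <= b -> {within closure Om, continuous (fun x => wz (x, t))})
  (wz_ge0 : forall x t, Om x -> a <= t <= b -> 0 <= wz (x, t)).

Let BOC (h : V -> R) : {within closure Om, continuous h} -> BO Om h.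
Proof. exact: BM_closure. Qed.

Let sumC e t : 0 < e -> a <= t <= b ->
  {within closure Om, continuous (fun x => \sum_i e / (ui i (x, t) + e))}.
Proof.
move=> e0 tab; apply: (within_sum (f := fun i x => e / (ui i (x, t) + e))) => i.
apply: withinM; first exact: within_cst.
apply: (within_comp (h := fun s : R => (s + e)^-1)); first by case: (uC i tab).
move=> x cx; apply: (@forcV _ _ (fun s : R => s + e)).
  by apply: forcD; [exact: cvg_id|exact: forc_cst].
by rewrite gt_eqF// ltr_wpDl// u_ge0.
Qed.

(** Otherwise there are [e_m] tending to [0] and times [t_m] violating the bound.
At a fixed interior point each [ui i] is bounded below by a positive number on
[[a, b]], so the integrands tend to [0] pointwise whatever the [t_m], and
dominated convergence is a contradiction. *)
Lemma small_layer delta : 0 < delta -> exists e, [/\ 0 < e, e <= 1 & forall t, a <= t <= b ->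
  IO Om (fun x => \sum_i e / (ui i (x, t) + e)) <= delta].
Proof.
move=> d0; apply: contrapT => /forallNP H.
pose em (m : nat) : R := m.+1%:R^-1.
have em0 m : 0 < em m by rewrite invr_gt0.
have em1 m : em m <= 1 by rewrite invf_le1// ler1n.
have /choice[tm htm] : forall m, exists t, a <= t <= b /\
    delta < IO Om (fun x => \sum_i em m / (ui i (x, t) + em m)).
  move=> m; have := H (em m); apply: contra_notP => /forallNP h; split => // t tab.
  by rewrite leNgt; apply/negP => lt; apply: (h t).
pose F m := (fun x => \sum_i em m / (ui i (x, tm m) + em m)) \_ Om.
have tab m : a <= tm m <= b by case: (htm m).
have F01 m x : 0 <= F m x <= N%:R.
  have [Ox|Ox] := pselect (Om x); last by rewrite /F patchN// lexx/= ler0n.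
  rewrite /F patchO//; have cx : closure Om x by exact: subset_closure.
  have u0 i := u_ge0 i cx (tab m).
  rewrite sumr_ge0/=; last by move=> i _; rewrite divr_ge0 ?addr_ge0// ltW.
  apply: (@le_trans _ _ (\sum_(i < N) 1)); last by rewrite sumr_const card_ord.
  apply: ler_sum => i _; rewrite ler_pdivrMr; last by rewrite ltr_wpDl.
  by rewrite mul1r lerDr.
have [M OmM] := bounded_rowP (domain_bounded Om_domain).
have [||x|_ cvgF] := @Int_dominated R n F (fun=> 0) (Num.max N%:R M).
- by move=> m; apply: BOC; exact: sumC.
- move=> m; split=> x.
    by have /andP[f0 f1] := F01 m x; rewrite ger0_norm// le_max f1.
  have [Ox _ j|Ox] := pselect (Om x); first by rewrite le_max OmM// orbT.
  by rewrite /F patchN// eqxx.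
- have [Ox|Ox] := pselect (Om x); last first.
    rewrite (_ : (fun m => F m x) = cst 0); first exact: cvg_cst.
    by apply/funext => m; rewrite /F patchN.
  have cx : closure Om x by exact: subset_closure.
  have low i : exists2 mi, 0 < mi & forall t, a <= t <= b -> mi <= ui i (x, t).
    have [c cab hc] := @EVT_min R (fun t => ui i (x, t)) a b (ltW ab) (@u_time i x Ox).
    exists (ui i (x, c)); first by apply: u_gt0 => //; move: cab; rewrite in_itv.
    by move=> t tab'; apply: hc; rewrite in_itv.
  have [mi mi0 hmi] : exists2 mi : 'I_N -> R, (forall i, 0 < mi i) &
      forall i t, a <= t <= b -> mi i <= ui i (x, t).
    have /choice[mi h] : forall i, exists mi, 0 < mi /\ forall t, a <= t <= b -> mi <= ui i (x, t).
      by move=> i; have [mi h1 h2] := low i; exists mi.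
    by exists mi => i; have [] := h i.
  apply: (@squeeze_cvgr _ _ _ _ (fun=> 0) (fun m => em m * \sum_i (mi i)^-1)).
  + apply: nearW => m; have /andP[-> _] := F01 m x; rewrite /F patchO// mulr_sumr.
    apply: ler_sum => i _; rewrite ler_wpM2l ?(ltW (em0 m))//.
    rewrite lef_pV2 ?posrE//; last by rewrite addr_gt0 ?u_gt0.
    by rewrite (le_trans (hmi i _ (tab m)))// lerDl ltW.
  + exact: cvg_cst.
  + rewrite -[X in _ --> X](mul0r (\sum_i (mi i)^-1)); apply: cvgM; last exact: cvg_cst.
    exact: cvg_harmonic.
rewrite (@Int0 R n) in cvgF.
have /cvgr_lt/(_ _ d0) := cvgF.
move=> [m _ /(_ m (leqnn m))]/=.
by rewrite ltNge; have [_ /ltW ->] := htm m.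
Qed.

Let lnC e t i : 0 < e -> a <= t <= b ->
  C1cl Om (fun x => ln (ui i (x, t) + e)) (fun j x => DX i j (x, t) * (ui i (x, t) + e)^-1).
Proof.
move=> e0 tab.
apply: (C1cl_comp1 (h := fun s => ln (s + e)) (dh := fun s => (s + e)^-1) (uC i tab)) => x cx.
have u0 : 0 < ui i (x, t) + e by rewrite ltr_wpDl// u_ge0.
split.
  have dl := is_derive1_ln u0.
  have dsh : is_derive (ui i (x, t)) (1 : R) (fun s : R => s + e) (1 + 0).
    exact: (@is_deriveD _ _ _ (id : R -> R) (cst e)).
  have := @is_derive_comp1 R R (@ln R) (fun s : R => s + e) _ _ _ _ dl dsh.
  by rewrite addr0 mul1r.
apply: (@forcV _ _ (fun s : R => s + e)); last by rewrite gt_eqF.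
by apply: forcD; [exact: cvg_id|exact: forc_cst].
Qed.

Lemma Psi_continuous e t i : 0 < e -> a <= t <= b -> {within closure Om, continuous (fun x => Psi e (ui i (x, t)))}.
Proof.
move=> e0 tab; have uc : {within closure Om, continuous (fun x => ui i (x, t))} by case: (uC i tab).
apply: withinB => //; apply: withinM; last by case: (lnC i e0 tab).
by apply: withinD => //; exact: within_cst.
Qed.

Let M' := n%:R * (2 * N%:R * MG * MD ^+ 2).

(** Green's formula with the test function [ln (u_i + e)], then
[degenerate_form] in each of the [n] space directions. *)
Lemma dissipation e t : 0 < e -> a <= t <= b ->
  \sum_i IO Om (fun x => ln (ui i (x, t) + e) * Lw i (x, t)) <=
    M' * IO Om (fun x => \sum_i e / (ui i (x, t) + e)).
Proof.
move=> e0 tab.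
have Bi i : BO Om (fun x => \sum_j DX i j (x, t) * (ui i (x, t) + e)^-1 * Dwv i j (x, t)).
  apply: BOC; apply: (within_sum (f := fun j x => DX i j (x, t) * (ui i (x, t) + e)^-1 * Dwv i j (x, t))) => j.
  by apply: withinM; [case: (lnC i e0 tab) => _ + _; exact|exact: DwvC].
under eq_bigr => i _ do rewrite (green_w i tab (lnC i e0 tab)).2.
rewrite sumrN lerNl -IO_sum// -mulrN -IO_N; last exact/BOC/sumC.
rewrite -IO_Z; last by apply: BO_N; exact/BOC/sumC.
apply: le_IO; [by apply: BO_Z; apply: BO_N; exact/BOC/sumC|exact: BO_sum|].
move=> x Ox; rewrite exchange_big/=.
have -> : M' * - (\sum_i e / (ui i (x, t) + e)) =
    \sum_(j < n) - (2 * N%:R * MG * MD ^+ 2 * \sum_i e / (ui i (x, t) + e)).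
  by rewrite sumr_const card_ord -[RHS]mulr_natl /M'; ring.
apply: ler_sum => j _.
apply: (degenerate_form (dg := fun i k => dg i k (x, t)) (g := fun i => g i (x, t))
  (u := fun i => ui i (x, t)) (xi := fun i => DX i j (x, t))) => //.
- by move=> i; exact: u_gt0.
- by move=> zeta; exact: psd_form.
- by move=> i; exact: DX_le.
- by move=> i k; exact: dg_le.
Qed.

Definition entropy e t := \sum_i tau i * IO Om (fun x => Psi e (ui i (x, t))).

Let v0 : 0 <= vol Om. Proof. exact: vol_ge0. Qed.

Let common_eta delta : 0 < delta -> exists2 eta, 0 < eta & forall i x t t', Om x ->
    a <= t <= b -> a <= t' <= b -> `|t' - t| <= eta ->
    `|ui i (x, t') - ui i (x, t) - (t' - t) * Dt i (x, t)| <= delta * `|t' - t|.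
Proof.
move=> d0.
have /choice[et het] : forall i, exists eta, 0 < eta /\ forall x t t', Om x ->
    a <= t <= b -> a <= t' <= b -> `|t' - t| <= eta ->
    `|ui i (x, t') - ui i (x, t) - (t' - t) * Dt i (x, t)| <= delta * `|t' - t|.
  by move=> i; have [eta e0 h] := u_inc i d0; exists eta.
have et0 i : 0 < et i by case: (het i).
have s0 : 0 < 1 + \sum_i (et i)^-1.
  by rewrite ltr_wpDr// sumr_ge0// => i _; rewrite invr_ge0 ltW.
exists (1 + \sum_i (et i)^-1)^-1; first by rewrite invr_gt0.
move=> i x t t' Ox tab t'ab tt; have [_ h] := het i; apply: h => //.
apply: (le_trans tt); rewrite -[leRHS]invrK lef_pV2 ?posrE ?invr_gt0//.
rewrite (bigD1 i)//= addrCA lerDl addr_ge0// sumr_ge0// => k _.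
by rewrite invr_ge0 ltW.
Qed.

Lemma entropy_step e h t t' : 0 < e -> e <= 1 -> 0 < h -> a <= t <= b -> a <= t' <= b ->
  M' * IO Om (fun x => \sum_i e / (ui i (x, t') + e)) <= 1 ->
  (forall x, Om x -> \sum_i tau i * Psi e (ui i (x, t')) - \sum_i tau i * Psi e (ui i (x, t)) <=
     h * (\sum_i tau i * Dt i (x, t') * ln (ui i (x, t') + e) + 1)) ->
  entropy e t' - entropy e t <= h * (1 + vol Om + CR * vol Om + CR * IO Om (fun x => wz (x, t'))).
Proof.
move=> e0 e1 h0 tab t'ab small incr.
have EE s : a <= s <= b -> entropy e s = IO Om (fun x => \sum_i tau i * Psi e (ui i (x, s))).
  move=> sab; rewrite /entropy IO_sum; last by move=> i; exact/BO_Z/BOC/Psi_continuous.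
  by apply: eq_bigr => i _; rewrite IO_Z//; exact/BOC/Psi_continuous.
have BP s : a <= s <= b -> BO Om (fun x => \sum_i tau i * Psi e (ui i (x, s))).
  by move=> sab; apply: BO_sum => i; exact/BO_Z/BOC/Psi_continuous.
have BL i : BO Om (fun x => ln (ui i (x, t') + e) * Lw i (x, t')).
  exact: (green_w i t'ab (lnC i e0 t'ab)).1.
have Bwz : BO Om (fun x => wz (x, t')) by exact/BOC/wzC.
have B1 (c : R) : BO Om (fun=> c) by exact: BO_cst.
have BR : BO Om (fun x => CR * (1 + wz (x, t')) + 1).
  by apply: BO_D => //; apply: BO_Z; exact: BO_D.
rewrite (EE _ t'ab) (EE _ tab) -IO_B; [|exact: BP|exact: BP].
apply: (@le_trans _ _ (IO Om (fun x => h * (\sum_i ln (ui i (x, t') + e) * Lw i (x, t') +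
    (CR * (1 + wz (x, t')) + 1))))).
  apply: le_IO; [by apply: BO_B; exact: BP| by apply/BO_Z/BO_D => //; exact: BO_sum|].
  move=> x Ox; apply: (le_trans (incr x Ox)); rewrite ler_wpM2l ?(ltW h0)// addrA lerD2r.
  have := react Ox t'ab e0 e1.
  have -> : \sum_i (tau i * Dt i (x, t') - Lw i (x, t')) * ln (ui i (x, t') + e) =
     \sum_i tau i * Dt i (x, t') * ln (ui i (x, t') + e) - \sum_i ln (ui i (x, t') + e) * Lw i (x, t').
    by rewrite -sumrB; apply: eq_bigr => i _; ring.
  by rewrite lerBlDl.
rewrite IO_Z; last by apply: BO_D => //; exact: BO_sum.
rewrite ler_wpM2l ?(ltW h0)// IO_D//; last exact: BO_sum.
have -> : IO Om (fun x => CR * (1 + wz (x, t')) + 1) = CR * (vol Om + IO Om (fun x => wz (x, t'))) + vol Om.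
  by rewrite IO_D// ?IO_Z ?IO_D//; [exact: BO_D|apply: BO_Z; exact: BO_D].
rewrite IO_sum//; have := dissipation e0 t'ab; lra.
Qed.

(** [e] is chosen first, so that the dissipation error is at most [1] per unit of
time, and then the mesh, according to how large [ln (u_i + e)] may be.
Convexity of [Psi] bounds the increment over a step by the derivative at the
end of the step. *)
Lemma entropy_grid : exists e, [/\ 0 < e, e <= 1 & exists2 K0 : nat, (0 < K0)%N &
  forall K, (K0 <= K)%N -> entropy e b - entropy e a <=
    (b - a) * (1 + vol Om + CR * vol Om) +
    CR * ((b - a) / K%:R * \sum_(l < K.+1) IO Om (fun x => wz (x, grid a b K l)))].
Proof.
have M'0 : 0 <= M' by rewrite /M' !mulr_ge0// sqr_ge0.
have d0 : 0 < (M' + 1)^-1 by rewrite invr_gt0 ltr_wpDl.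
have [e [e0 e1 small]] := small_layer d0.
have {}small t : a <= t <= b -> M' * IO Om (fun x => \sum_i e / (ui i (x, t) + e)) <= 1.
  move=> /small h; apply: (le_trans (ler_wpM2l M'0 h)).
  by rewrite ler_pdivrMr ?ltr_wpDl// mul1r lerDl.
exists e; split => //.
pose La := `|ln e| + `|ln (MU + e)|.
have La0 : 0 <= La by rewrite addr_ge0.
have lnLa i x t : Om x -> a <= t <= b -> `|ln (ui i (x, t) + e)| <= La.
  move=> Ox tab; have cx : closure Om x by exact: subset_closure.
  have u0 := u_ge0 i cx tab; have u1 := u_le i cx tab.
  have p1 : 0 < ui i (x, t) + e by rewrite ltr_wpDl.
  have p2 : 0 < MU + e by rewrite ltr_wpDl// (le_trans u0).
  have l1 : ln e <= ln (ui i (x, t) + e) by rewrite ler_ln ?posrE// lerDr.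
  have l2 : ln (ui i (x, t) + e) <= ln (MU + e) by rewrite ler_ln ?posrE// lerD2r.
  have n1 : - `|ln e| <= ln e by rewrite lerNl -normrN ler_norm.
  have n2 := ler_norm (ln (MU + e)).
  by rewrite /La ler_norml; apply/andP; split; have := normr_ge0 (ln e); have := normr_ge0 (ln (MU + e)); lra.
pose S := \sum_i tau i.
have S0 : 0 <= S by apply: sumr_ge0 => i _; exact: ltW.
(* Errors [de * h] in the increments of the [ui i] cost at most
   [S * La * de * h <= h] in the entropy. *)
pose de := (S * La + 1)^-1.
have de0 : 0 < de by rewrite invr_gt0 ltr_wpDl// mulr_ge0.
have [eta eta0 heta] := common_eta de0.
have ba : 0 < b - a by rewrite subr_gt0.
pose K0 := (Num.truncn ((b - a) / eta)).+1; exists K0 => // K KK.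
have K0' : (0 < K)%N by apply: leq_trans KK.
have Kr : 0 < K%:R :> R by rewrite ltr0n.
set h := (b - a) / K%:R; have h0 : 0 < h by rewrite divr_gt0.
have heta' : h <= eta.
  rewrite /h ler_pdivrMr// mulrC -ler_pdivrMr//; apply: ltW.
  by rewrite (lt_le_trans (truncnS_gt _))// ler_nat.
have step k : (k < K)%N -> entropy e (grid a b K k.+1) - entropy e (grid a b K k) <=
    h * (1 + vol Om + CR * vol Om + CR * IO Om (fun x => wz (x, grid a b K k.+1))).
  move=> kK; have g1 := @grid_in _ _ _ ab K k K0' (ltnW kK); have g2 := @grid_in _ _ _ ab K k.+1 K0' kK.
  apply: entropy_step => //; first exact: small.
  move=> x Ox; rewrite -sumrB mulrDr mulr1 mulr_sumr.
  apply: (@le_trans _ _ (\sum_i (h * (tau i * Dt i (x, grid a b K k.+1) * ln (ui i (x, grid a b K k.+1) + e))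
      + tau i * (La * (de * h))))).
    apply: ler_sum => i _; rewrite -mulrBr.
    have cx : closure Om x by exact: subset_closure.
    have C := Psi_convex e0 (u_ge0 i cx g1) (u_ge0 i cx g2).
    have := heta i x (grid a b K k.+1) (grid a b K k) Ox g2 g1.
    rewrite -opprB grid_step normrN ger0_norm ?(ltW h0)// => /(_ heta') E.
    set D := Dt i (x, grid a b K k.+1) in E *.
    set v := ui i (x, grid a b K k) in C E *; set v' := ui i (x, grid a b K k.+1) in C E *.
    have Ll := lnLa i x _ Ox g2; rewrite -/v' in Ll.
    set L := ln (v' + e) in C Ll *.
    have X : - (L * (v - v' - - h * D)) <= La * (de * h).
      by apply: (le_trans (ler_norm _)); rewrite normrN normrM ler_pM.
    have -> : h * (tau i * D * L) + tau i * (La * (de * h)) = tau i * (h * D * L + La * (de * h)) by ring.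
    rewrite ler_wpM2l ?(ltW (tau_gt0 i))//; apply: (le_trans C).
    have -> : L * (v' - v) = h * D * L - L * (v - v' - - h * D) by ring.
    by rewrite lerD2l.
  rewrite big_split/= lerD2l.
  have -> : \sum_i tau i * (La * (de * h)) = (S * La * de) * h by rewrite -mulr_suml -/S; ring.
  apply: ler_piMl; first exact: ltW.
  by rewrite /de ler_pdivrMr ?ltr_wpDl ?mulr_ge0// mul1r lerDl.
have gK : grid a b K K = b by rewrite /grid divfK ?gt_eqF// addrC subrK.
have g0 : grid a b K 0 = a by rewrite /grid mulr0 addr0.
have tele : entropy e b - entropy e a <=
    \sum_(k < K) h * (1 + vol Om + CR * vol Om + CR * IO Om (fun x => wz (x, grid a b K k.+1))).
  have -> : entropy e b - entropy e a =
      \sum_(k < K) (entropy e (grid a b K k.+1) - entropy e (grid a b K k)).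
    rewrite -(big_mkord xpredT (fun k => entropy e (grid a b K k.+1) - entropy e (grid a b K k))).
    by rewrite telescope_sumr// gK g0.
  by apply: ler_sum => k _; exact: step.
apply: (le_trans tele); rewrite -mulr_sumr big_split/= sumr_const card_ord mulrDr.
apply: lerD.
  by rewrite -[X in h * X]mulr_natl mulrA /h divfK// gt_eqF.
rewrite -mulr_sumr mulrCA -/h; apply: ler_wpM2l => //; apply: ler_wpM2l; first exact: ltW.
rewrite [leRHS]big_ord_recl/= lerDr.
by apply: IO_ge0 => x Ox; apply: wz_ge0 => //; exact: grid_in.
Qed.

End entropy.

(** * The lower bound for the reaction terms *)
Section reaction.
Context {R : realType} {N : nat}.
Local Notation row := 'rV[R]_N.
Variable f : row -> row.
Hypotheses (f_lipschitz : [locally [lipschitz f u | u in @orthant R N]])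
  (f_quasi_positive : forall u i, orthant u ->
     0 <= f (\row_j (if j == i then 0 else u 0 j)) 0 i).

Lemma euclidean_norm_mono (u v : row) : (forall j, `|u 0 j| <= `|v 0 j|) ->
  euclidean_norm u <= euclidean_norm v.
Proof.
move=> h; rewrite ler_wsqrtr//; apply: ler_sum => j _.
by rewrite -(real_normK (num_real (u 0 j))) -(real_normK (num_real (v 0 j))) ler_sqr ?nnegrE.
Qed.

Lemma coord_le_euclidean (u : row) i : `|u 0 i| <= euclidean_norm u.
Proof.
rewrite -sqrtr_sqr ler_wsqrtr// (bigD1 i)//= lerDl sumr_ge0// => j _; exact: sqr_ge0.
Qed.

(** Local Lipschitz bounds become uniform on the compact square of pairs of
parameters; the covering argument is carried out on pairs because the bound is
local at pairs of points. *)
Lemma segment_lipschitz (c : R -> row) (U : R) : continuous c ->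
  (forall s t, `|c s - c t| <= `|s - t|) -> (forall s, 0 <= s <= U -> orthant (c s)) ->
  exists M, 0 <= M /\ forall s t, 0 <= s <= U -> 0 <= t <= U -> `|f (c s) - f (c t)| <= M * `|s - t|.
Proof.
move=> cc clip corth.
pose K : set (R * R) := `[0, U] `*` `[0, U].
have cK : compact K by apply: compact_setX; exact: segment_compact.
have /compact_near_coveringP cov := cK.
have : \forall M \near +oo, K `<=` (fun p => K p ->
    `|f (c p.1) - f (c p.2)| <= M * `|c p.1 - c p.2|).
  apply: cov => -[s t] [/= sU tU].
  have os : orthant (c s) by apply: corth; move: sU; rewrite in_itv.
  have ot : orthant (c t) by apply: corth; move: tU; rewrite in_itv.
  have [M [_ hM]] := f_lipschitz (x := (c s, c t)) (conj os ot).
  have M1 : M < M + 1 by rewrite ltrDl.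
  have nS := hM _ M1; rewrite /dominated_by/= in nS.
  have c1 : (fun p : R * R => c p.1) @ (s, t) --> c s.
    by apply: (@continuous_comp _ _ _ (@fst R R) c (s, t)); [exact: cvg_fst|exact: cc].
  have c2 : (fun p : R * R => c p.2) @ (s, t) --> c t.
    by apply: (@continuous_comp _ _ _ (@snd R R) c (s, t)); [exact: cvg_snd|exact: cc].
  have cmap := cvg_pair (FF := nbhs_filter (s, t)) (FG := nbhs_filter (c s))
    (FH := nbhs_filter (c t)) c1 c2.
  have nS' := cmap _ nS.
  exists ([set p | (orthant (n:=N) `*` orthant (n:=N)) (c p.1, c p.2) ->
    `|f (c p.1) - f (c p.2)| <= (M + 1) * `|c p.1 - c p.2|], [set M' | M + 1 < M']).
    by split; [exact: nS'|exists (M + 1); split => //; exact: num_real].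
  move=> [[s' t'] M'] [/= h1 h2] [/= s'U t'U].
  apply: (le_trans (h1 _)).
    by split => /=; apply: corth; [move: s'U|move: t'U]; rewrite in_itv.
  by rewrite ler_wpM2r// ltW.
move=> [M [_ hM]]; exists (`|M| + 1); split; first by rewrite addr_ge0.
move=> s t sU tU.
have M1 : M < `|M| + 1 by rewrite (le_lt_trans (ler_norm M))// ltrDl.
have Kst : K (s, t) by split; rewrite /= in_itv.
apply: (le_trans (hM _ M1 (s, t) Kst Kst)) => /=.
by rewrite ler_wpM2l// addr_ge0.
Qed.

(** Vary the [i]-th coordinate from [0], where [f_i >= 0], to [u_i]: this is
[lipschitz_derivative_ge] along a segment on which the norm is at most
that of [u]. *)
Lemma reaction_lower (Cf : R) (u : row) i : 0 < Cf ->
  (forall v, orthant v -> forall l,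
     is_derive_in (@orthant R N) v (basis_vec i) (fun v => f v 0 i) l ->
       - Cf * (1 + euclidean_norm v) <= l) ->
  orthant u -> - Cf * (1 + euclidean_norm u) * u 0 i <= f u 0 i.
Proof.
move=> Cf0 growth ou; have U0 := ou i; set U := u 0 i in U0 *.
pose c (s : R) : row := u + (s - U) *: basis_vec i.
have cE s j : c s 0 j = if j == i then s else u 0 j.
  rewrite !mxE eqxx/=; case: eqP => [->|_]; last by rewrite mulr0 addr0.
  by rewrite mulr1 /U addrC subrK.
have cU : c U = u by rewrite /c subrr scale0r addr0.
have c0 : c 0 = \row_j (if j == i then 0 else u 0 j) by apply/rowP => j; rewrite cE mxE.
have f0 : 0 <= f (c 0) 0 i by rewrite c0; exact: f_quasi_positive.
have [UE|Un0] := eqVneq U 0.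
  by rewrite UE mulr0 -cU UE.
have {}U0 : 0 < U by rewrite lt_neqAle eq_sym Un0.
have cc : continuous c.
  move=> s; apply: (@cvgD _ _ _ (nbhs s) (nbhs_filter s)); first exact: cvg_cst.
  apply: (@cvgZr_tmp _ _ _ (nbhs s) (nbhs_filter s)).
  by apply: (@cvgB _ _ _ (nbhs s) (nbhs_filter s)); [exact: cvg_id|exact: cvg_cst].
have clip s t : `|c s - c t| <= `|s - t|.
  apply: norm_le_coord => // j; rewrite mxE [X in _ + X]mxE !cE.
  by case: eqP => // _; rewrite subrr normr0.
have corth s : 0 <= s <= U -> orthant (c s).
  by move=> /andP[s0 _] j; rewrite cE; case: eqP => // _; exact: ou.
have cnorm s : 0 <= s <= U -> euclidean_norm (c s) <= euclidean_norm u.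
  move=> /andP[s0 sU]; apply: euclidean_norm_mono => j; rewrite cE.
  by case: eqP => [->|//]; rewrite -/U !ger0_norm// ltW.
have [M [M0 hM]] := segment_lipschitz cc clip corth.
(* [c] leaves the orthant outside [[0, U]]; clamping the parameter gives a
   function that is Lipschitz on the whole line. *)
pose cl (s : R) := Num.max 0 (Num.min s U).
have clU s : 0 <= cl s <= U.
  rewrite /cl le_max lexx/= ge_max (ltW U0)/=; by rewrite ge_min lexx orbT.
have cllip s t : `|cl s - cl t| <= `|s - t|.
  rewrite /cl; case: (leP s U) => h1; case: (leP t U) => h2;
  case: (leP 0 s) => h3; case: (leP 0 t) => h4; case: (leP 0 U) => h5; rewrite ler_norml; apply/andP; split;
  have := ler_norm (s - t); have := ler_norm (t - s); rewrite (distrC t s); lra.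
have clid s : 0 <= s <= U -> cl s = s.
  by move=> /andP[s0 sU]; rewrite /cl (min_idPl sU) (max_idPr s0).
pose phi s := f (c (cl s)) 0 i.
have philip s t : `|phi s - phi t| <= M * `|s - t|.
  rewrite /phi; have := coord_le_norm (f (c (cl s)) - f (c (cl t))) i.
  rewrite mxE [X in _ + X]mxE => h; apply: (le_trans h).
  apply: (le_trans (hM _ _ (clU s) (clU t))); rewrite ler_wpM2l//.
have dphi s : 0 < s < U -> derivable phi s 1 -> - Cf * (1 + euclidean_norm u) <= derive1 phi s.
  move=> /andP[s0 sU] ds.
  have sU' : 0 <= s <= U by rewrite !ltW.
  apply: (@le_trans _ _ (- Cf * (1 + euclidean_norm (c s)))).
    by rewrite !mulNr lerN2 ler_wpM2l ?(ltW Cf0)// lerD2l cnorm.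
  apply: (growth _ (corth _ sU')).
  have dd : is_derive s (1 : R) phi (derive1 phi s) by rewrite derive1E; exact: derivableP.
  have := is_derive_cvg dd; rewrite /is_derive_in => H.
  have {}H : h^-1 * (phi (h + s) - phi s) @[h --> within [set h | orthant (c s + h *: basis_vec i)] 0^']
      --> derive1 phi s by apply: cvg_trans H; apply: cvg_app; exact: cvg_within.
  apply: cvg_trans H; apply: near_eq_cvg.
  rewrite near_withinE near_withinE.
  have n1 : \forall h \near (0 : R), 0 < h + s < U.
    have r0 : 0 < Num.min s (U - s) by rewrite lt_min s0 subr_gt0.
    apply/nbhs_ballP; exists (Num.min s (U - s)) => // h.
    rewrite -ball_normE/= sub0r normrN lt_min !ltr_norml => /andP[/andP[h1 h2] /andP[h3 h4]].
    by apply/andP; split; lra.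
  apply: filterS n1 => h /andP[h1 h2] _ _.
  rewrite /phi !clid//; last by rewrite !ltW.
  congr (_ * (f _ 0 i - _)).
  by rewrite /c -[RHS]addrA -scalerDl; congr (_ + _ *: _); ring.
have := lipschitz_derivative_ge U0 philip dphi.
rewrite subr0 /phi !clid ?lexx ?(ltW U0)// cU => h.
by apply: (le_trans h); rewrite gerBl.
Qed.

End reaction.

(** * The matrix P as a quadratic form *)
Section psd.
Context {R : realType} {N : nat}.
Local Notation row := 'rV[R]_N.

Lemma within_near_eq (T : Type) (F : set_system T) (S : set T) : Filter F -> F S -> within S F = F.
Proof.
move=> FF FS; apply/seteqP; split=> A; rewrite /within/=.
  by move=> FA; apply: filterS2 FA FS => x; exact.
by apply: filterS => x.
Qed.

Lemma orthant_interior (v : row) (k : 'I_N) : (forall j, 0 < v 0 j) ->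
  \forall h \near (0 : R), orthant (v + h *: basis_vec k).
Proof.
move=> v0; apply/nbhs_ballP; exists (v 0 k) => //= h.
rewrite -ball_normE/= sub0r normrN ltr_norml => /andP[h1 h2] j.
rewrite !mxE eqxx/=; case: eqP => [->|_].
  by rewrite mulr1; lra.
by rewrite mulr0 addr0 ltW.
Qed.

(** At an interior point of the orthant the restricted derivative of [d] is the
ordinary one of the extension. *)
Lemma derive_in_interior (d G : row -> R) (v : row) (k : 'I_N) l : (forall j, 0 < v 0 j) ->
  (forall y, orthant y -> G y = d y) -> is_derive v (basis_vec k) G l ->
  derive_in (@orthant R N) v (basis_vec k) d = l.
Proof.
move=> v0 Gd [dG <-].
have no := orthant_interior k v0.
have no' : 0^' [set h : R | orthant (v + h *: basis_vec k)].
  by apply: (@nbhs_dnbhs R 0).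
rewrite /derive_in within_near_eq//.
apply: cvg_lim; first exact: Rhausdorff.
apply: cvg_trans dG; apply: near_eq_cvg.
apply: (@filterS _ _ (dnbhs_filter (0 : R)) _ _ _ no') => h oh.
have ov : orthant v by move=> j; exact: ltW.
by rewrite /= -!Gd// (addrC v).
Qed.

(** The entries of [P_matrix] contain [v_i * v_j], so the form is evaluated at
[zeta_i / v_i]; symmetrisation accounts for a factor [2]. *)
Lemma psd_quadratic (d G : 'I_N -> row -> R) (dG : 'I_N -> 'I_N -> row -> R) (v : row) :
  (forall j, 0 < v 0 j) -> (forall i y, orthant y -> G i y = d i y) ->
  (forall i k, is_derive v (basis_vec k) (G i) (dG i k v)) ->
  psd (P_matrix d v) -> forall zeta : 'I_N -> R,
  0 <= \sum_i \sum_k dG i k v * zeta i * zeta k + \sum_i G i v * zeta i ^+ 2 / v 0 i.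
Proof.
move=> v0 Gd GD P zeta; have ov : orthant v by move=> j; exact: ltW.
have v_neq0 i : v 0 i != 0 by rewrite gt_eqF.
have := P (\row_i (zeta i / v 0 i)).
have -> : ((\row_i (zeta i / v 0 i)) *m P_matrix d v *m (\row_i (zeta i / v 0 i))^T) 0 0 =
    \sum_k \sum_i (dG i k v * zeta i * zeta k + dG k i v * zeta k * zeta i +
       (i == k)%:R * (2 * (G i v * zeta i ^+ 2 / v 0 i))).
  rewrite mxE; apply: eq_bigr => k _; rewrite !mxE mulr_suml; apply: eq_bigr => i _.
  rewrite !mxE (derive_in_interior v0 (Gd i) (GD i k)) (derive_in_interior v0 (Gd k) (GD k i)).
  rewrite -!Gd//; have [->|ik] := eqVneq i k.
    by rewrite !mul1r; field; exact: v_neq0.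
  rewrite !mul0r !addr0; field.
  by rewrite !v_neq0.
have -> : \sum_k \sum_i (dG i k v * zeta i * zeta k + dG k i v * zeta k * zeta i +
       (i == k)%:R * (2 * (G i v * zeta i ^+ 2 / v 0 i))) =
    2 * (\sum_i \sum_k dG i k v * zeta i * zeta k + \sum_i G i v * zeta i ^+ 2 / v 0 i).
  transitivity (\sum_k (\sum_i dG i k v * zeta i * zeta k + \sum_i dG k i v * zeta k * zeta i +
       2 * (G k v * zeta k ^+ 2 / v 0 k))).
    apply: eq_bigr => k _; rewrite !big_split/=; congr (_ + _).
    rewrite (bigD1 k)//= eqxx mul1r big1 ?addr0// => i /negbTE ->.
    by rewrite mul0r.
  rewrite !big_split/= exchange_big/= -mulr_sumr mulrDr; congr (_ + _).
  by rewrite mulr_natl mulr2n.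
by rewrite pmulr_rge0.
Qed.

End psd.

(** * The Luxemburg norm *)
Section LlogL.
Context {R : realType} {n : nat}.
Local Notation V := 'rV[R]_n.
Variable Om : set V.
Hypothesis Om_domain : smooth_bounded_domain Om.

Lemma integral_on_IO (h : V -> R) : BO Om h -> integral_on Om (fun x => (h x)%:E) = (IO Om h)%:E.
Proof.
move=> Bh; rewrite /integral_on /IO -Int_EFin// integral_mkcond.
apply: eq_integral => t _; rewrite !patchE.
have -> : (t \in @row_of_tuple R n @^-1` Om) = (row_of_tuple t \in Om).
  by apply/idP/idP; rewrite !inE.
by case: ifP.
Qed.

Lemma within_slnC (g : V -> R) l : {within closure Om, continuous g} -> 0 < l ->
  {within closure Om, continuous (fun x => `|g x| / l * ln (1 + `|g x| / l))}.
Proof.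
move=> cg l0.
have c1 : {within closure Om, continuous (fun x => `|g x| / l)}.
  apply: withinM; last exact: within_cst.
  by apply: (within_comp (h := fun s : R => `|s|) cg) => x _; exact: norm_continuous.
apply: withinM => //.
apply: (within_comp (h := fun s : R => ln (1 + s)) c1) => x _.
have p : 0 < 1 + `|g x| / l by rewrite ltr_pwDl// divr_ge0// ltW.
apply: (@forc_comp _ _ (@ln R)); last exact: continuous_ln.
by apply: forcD; [exact: forc_cst|exact: cvg_id].
Qed.

(** Divide by [l = A + 1 >= 1]: the Young function at [s / l] is at most [1 / l]
times its value at [s]. *)
Lemma LlogL_le (g : V -> R) A : {within closure Om, continuous g} -> 0 <= A ->
  IO Om (fun x => `|g x| / 1 * ln (1 + `|g x| / 1)) <= A ->
  (LlogL_norm Om g <= (A + 1)%:E)%E.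
Proof.
move=> cg A0 hA; apply: ereal_inf_lbound; exists (A + 1) => //.
have l0 : 0 < A + 1 by rewrite ltr_wpDl.
split => //.
have B l : 0 < l -> BO Om (fun x => `|g x| / l * ln (1 + `|g x| / l)).
  by move=> ?; apply: BM_closure => //; exact: within_slnC.
rewrite integral_on_IO; last exact: B.
rewrite lee_fin.
apply: (@le_trans _ _ (IO Om (fun x => (A + 1)^-1 * (`|g x| / 1 * ln (1 + `|g x| / 1))))).
  apply: le_IO; [exact: B|by apply: BO_Z; exact: B|move=> x _].
  rewrite divr1 mulrA (mulrC _ `|g x|) ler_wpM2l ?divr_ge0 ?(ltW l0)//.
  have p : 0 < 1 + `|g x| by rewrite ltr_pwDl.
  have q : `|g x| / (A + 1) <= `|g x|.
    by rewrite ler_pdivrMr// ler_peMr// lerDr.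
  rewrite ler_ln ?posrE// ?lerD2l//.
  by rewrite ltr_pwDl// divr_ge0// ltW.
rewrite IO_Z; last exact: B.
by rewrite ler_pdivrMl// mulr1 (le_trans hA)// lerDl.
Qed.

End LlogL.

(** * The a priori bound *)
Section apriori.
Context (R : realType) (n N : nat).
Local Notation V := 'rV[R]_n.
Local Notation row := 'rV[R]_N.
Variables (Om : set V) (Om_domain : smooth_bounded_domain Om)
  (tau : 'I_N -> R) (tau_gt0 : forall i, 0 < tau i)
  (d : 'I_N -> row -> R)
  (P_psd : forall v : row, orthant v -> psd (P_matrix d v))
  (delta Cd : R) (delta_gt0 : 0 < delta) (Cd_gt0 : 0 < Cd)
  (d_bounds : forall i v, orthant v -> delta <= d i v <= Cd)
  (f : row -> row)
  (f_mass : forall v, orthant v -> \sum_i f v 0 i <= 0)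
  (Cf : R) (Cf_gt0 : 0 < Cf)
  (f_lower : forall v i, orthant v -> - Cf * (1 + euclidean_norm v) * v 0 i <= f v 0 i)
  (T : R) (T_gt0 : 0 < T)
  (u0 : 'I_N -> V -> R)
  (u : V -> R -> row)
  (u_solution : positive_classical_solution Om T tau d f u0 u).

Variables (Dt : 'I_N -> V * R -> R)
    (DX : 'I_N -> 'I_n -> V * R -> R) (DXX : 'I_N -> 'I_n -> 'I_n -> V * R -> R).
Local Notation cyl := (cylc Om T).
Hypotheses (DtC : forall i, {within cyl, continuous (Dt i)})
  (DtD : forall i x t, Om x -> 0 < t < T ->
         is_derive t (1 : R) (fun s => u x s 0 i) (Dt i (x, t)))
  (DXC : forall i j, {within cyl, continuous (DX i j)})
  (DXD : forall i j x t, Om x -> 0 < t < T ->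
         is_derive x (basis_vec j) (fun y => u y t 0 i) (DX i j (x, t)))
  (DXXC : forall i j k, {within cyl, continuous (DXX i j k)})
  (DXXD : forall i j k x t, Om x -> 0 < t < T ->
         is_derive x (basis_vec k) (fun y => DX i j (y, t)) (DXX i j k (x, t))).

Variables (U : 'I_N -> set row) (G : 'I_N -> row -> R).
Hypotheses (oU : forall i, open (U i)) (orthU : forall i, @orthant R N `<=` U i)
  (smG : forall i, smooth (U i) (G i)) (Gd : forall i v, orthant v -> G i v = d i v).

Local Notation wvG := (wv u G).
Local Notation DwvG := (Dwv u DX G).
Local Notation LwG := (Lw tau f u Dt).

Let ui i (p : V * R) : R := u p.1 p.2 0 i.
Let w p := \sum_i tau i * ui i p.
Let wt p := \sum_i tau i * Dt i p.
Let z p := \sum_i wvG i p.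
Let Dz j p := \sum_i DwvG i j p.
Let Lz p := \sum_i LwG i p.

Lemma cylc_cyl0 : cyl `<=` cyl0 Om T.
Proof. by move=> p [cx /andP[t0 tT]]; split => //; rewrite (ltW t0) tT. Qed.

Lemma bounded_cyl (a b : R) (S : set (V * R)) (g : V * R -> R) :
  {within S, continuous g} -> cylab Om a b `<=` S ->
  exists M, 0 <= M /\ forall x t, closure Om x -> a <= t <= b -> `|g (x, t)| <= M.
Proof.
move=> cg sub; have := compact_bounded_on (@compact_cylab _ _ _ Om_domain a b) (continuous_subspaceW sub cg).
case=> M h; exists `|M|; split => // x t cx tab.
apply: le_trans (ler_norm M); apply: h; split => //=.
Qed.

Lemma ui_cont i : {within cyl, continuous (ui i)}.
Proof.
apply: (continuous_subspaceW (@cylc_cyl0)).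
exact: (@solution_coord_continuous _ _ _ _ _ _ _ _ _ _ u_solution i).
Qed.

Lemma u_cont : {within cyl, continuous (fun p => u p.1 p.2)}.
Proof.
apply: (continuous_subspaceW (@cylc_cyl0)).
exact: (solution_continuous u_solution).
Qed.

Lemma dG_cont i k : {within cyl, continuous (fun p => dG G i k (u p.1 p.2))}.
Proof.
have [_ _ c _ _] := G_reg smG i.
apply: (within_comp (h := dG G i k) u_cont) => -[x t] [cx tT]/=.
by apply: c; apply: orthU; exact: (solution_orthant u_solution).
Qed.

Lemma Dwv_cont i j : {within cyl, continuous (DwvG i j)}.
Proof.
have [c _ _ _ _] := G_reg smG i.
apply: withinD; apply: withinM.
- apply: (within_comp (h := G i) u_cont) => -[x t] [cx tT]/=.
  by apply: c; apply: orthU; exact: (solution_orthant u_solution).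
- exact: DXC.
- exact: ui_cont.
- apply: (within_sum (f := fun k p => DX k j p * dG G i k (u p.1 p.2))) => k.
  by apply: withinM; [exact: DXC|exact: dG_cont].
Qed.


(** A constant with [1 <= IT * tau i] for every [i]. *)
Let IT := 1 + \sum_i (tau i)^-1.

Lemma IT_ge1 : 1 <= IT.
Proof. by rewrite lerDl sumr_ge0// => i _; rewrite invr_ge0 ltW. Qed.

Lemma IT_tau i : 1 <= IT * tau i.
Proof.
rewrite -ler_pdivrMr// div1r /IT (bigD1 i)//= addrCA lerDl addr_ge0// sumr_ge0// => k _.
by rewrite invr_ge0 ltW.
Qed.

Section pointwise.
Variables (x : V) (t : R).
Hypotheses (cx : closure Om x) (tT : 0 < t < T).

Let ou : orthant (u x t). Proof. exact: (solution_orthant u_solution). Qed.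

Lemma ui_ge0 i : 0 <= ui i (x, t). Proof. exact: ou. Qed.

Lemma w_ge0 : 0 <= w (x, t).
Proof. by apply: sumr_ge0 => i _; rewrite mulr_ge0 ?ui_ge0// ltW. Qed.

Lemma wv_le i : wvG i (x, t) <= Cd * ui i (x, t).
Proof.
by rewrite /wv /gv/= Gd// ler_wpM2r ?ui_ge0//; have /andP[] := d_bounds i ou.
Qed.

Lemma wv_ge i : delta * ui i (x, t) <= wvG i (x, t).
Proof.
by rewrite /wv /gv/= Gd// ler_wpM2r ?ui_ge0//; have /andP[] := d_bounds i ou.
Qed.

Lemma z_ge : delta * \sum_i ui i (x, t) <= z (x, t).
Proof. by rewrite mulr_sumr; apply: ler_sum => i _; exact: wv_ge. Qed.

Lemma z_ge0 : 0 <= z (x, t).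
Proof.
by apply: le_trans z_ge; rewrite mulr_ge0 ?(ltW delta_gt0)// sumr_ge0// => i _; exact: ui_ge0.
Qed.

Lemma sum_ui_le : \sum_i ui i (x, t) <= IT * w (x, t).
Proof.
rewrite mulr_sumr; apply: ler_sum => i _.
by rewrite mulrA ler_peMl ?ui_ge0// IT_tau.
Qed.

Lemma z_le : z (x, t) <= Cd * IT * w (x, t).
Proof.
rewrite -mulrA; apply: (@le_trans _ _ (Cd * \sum_i ui i (x, t))).
  by rewrite mulr_sumr; apply: ler_sum => i _; exact: wv_le.
by rewrite ler_wpM2l ?(ltW Cd_gt0)// sum_ui_le.
Qed.

(** [w] and [z] each dominate [sum_i u_i], so their product dominates the square,
which is what the reaction needs. *)
Lemma sqr_sum_ui_le : (\sum_i ui i (x, t)) ^+ 2 <= IT / delta * (w (x, t) * z (x, t)).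
Proof.
have s0 : 0 <= \sum_i ui i (x, t) by apply: sumr_ge0 => i _; exact: ui_ge0.
have -> : IT / delta * (w (x, t) * z (x, t)) = (IT * w (x, t)) * (z (x, t) / delta) by ring.
rewrite expr2 ler_pM// ?sum_ui_le// ler_pdivlMr// mulrC; exact: z_ge.
Qed.

Lemma euclidean_norm_sqr_le : euclidean_norm (u x t) ^+ 2 <= IT / delta * (w (x, t) * z (x, t)).
Proof.
apply: le_trans sqr_sum_ui_le; rewrite sqr_sqrtr; last by apply: sumr_ge0 => i _; exact: sqr_ge0.
rewrite [leRHS]expr2 mulr_suml; apply: ler_sum => i _.
rewrite expr2 ler_wpM2l ?ui_ge0// (bigD1 i)//= lerDl sumr_ge0// => k _; exact: ui_ge0.
Qed.

Let CR := 2 * N%:R * Cf * (1 + IT / delta).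

Lemma reaction_le e : 0 < e -> e <= 1 ->
  \sum_i (tau i * Dt i (x, t) - LwG i (x, t)) * ln (ui i (x, t) + e) <=
    CR * (1 + w (x, t) * z (x, t)).
Proof.
move=> e0 e1; set m := euclidean_norm (u x t).
have m0 : 0 <= m by exact: sqrtr_ge0.
have -> : \sum_i (tau i * Dt i (x, t) - LwG i (x, t)) * ln (ui i (x, t) + e) =
    \sum_i f (u x t) 0 i * ln (ui i (x, t) + e).
  by apply: eq_bigr => i _; rewrite /Lw/=; congr (_ * _); ring.
apply: (@le_trans _ _ (N%:R * (Cf * (1 + m) ^+ 2))).
  apply: (reaction_bound (uu := fun i => ui i (x, t)) (F := fun i => f (u x t) 0 i)) => //.
  - exact: ltW.
  - move=> i; rewrite ui_ge0/=; apply: le_trans (coord_le_euclidean _ i); exact: ler_norm.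
  - by move=> i; exact: f_lower.
  - exact: f_mass.
have m2 := euclidean_norm_sqr_le; rewrite -/m in m2.
have wz0 : 0 <= w (x, t) * z (x, t) by rewrite mulr_ge0 ?w_ge0 ?z_ge0.
have q0 : 0 <= IT / delta by rewrite divr_ge0 ?(ltW delta_gt0)// (le_trans ler01 IT_ge1).
rewrite /CR; have -> : 2 * N%:R * Cf * (1 + IT / delta) * (1 + w (x, t) * z (x, t)) =
  N%:R * (Cf * (2 * (1 + IT / delta) * (1 + w (x, t) * z (x, t)))) by ring.
rewrite ler_wpM2l// ler_wpM2l ?(ltW Cf_gt0)//.
by move: m2 q0 wz0; move: (IT / delta) (w (x, t) * z (x, t)) => q y; nra.
Qed.

End pointwise.

Lemma psd_solution x t (zeta : 'I_N -> R) : Om x -> 0 < t < T ->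
  0 <= \sum_i \sum_k dG G i k (u x t) * zeta i * zeta k +
       \sum_i gv u G i (x, t) * zeta i ^+ 2 / ui i (x, t).
Proof.
move=> Ox tT.
have u_pos j : 0 < u x t 0 j by exact: (solution_positive u_solution).
have ov : orthant (u x t) by move=> j; exact: ltW.
apply: (psd_quadratic (d := d) (G := G) (dG := dG G)) => //.
  by move=> i k; have [_ h _ _ _] := G_reg smG i; apply: h; exact: orthU.
exact: P_psd.
Qed.

Lemma early_bound : exists C, 0 <= C /\ forall i t, 0 <= t <= T / 2 ->
  IO Om (fun x => `|u x t 0 i| / 1 * ln (1 + `|u x t 0 i| / 1)) <= C.
Proof.
have sub : cylab Om 0 (T / 2) `<=` cyl0 Om T.
  move=> p [cx /=]; rewrite in_itv/= => /andP[t0 tT]; split => //; rewrite t0/=.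
  by rewrite (le_lt_trans tT)// ltr_pdivrMr// ltr_pMr// ltr1n.
have /choice[M hM] : forall i, exists M, 0 <= M /\ forall x t, closure Om x ->
    0 <= t <= T / 2 -> `|ui i (x, t)| <= M.
  move=> i; apply: (@bounded_cyl 0 (T / 2) (cyl0 Om T)) => //.
  exact: (@solution_coord_continuous _ _ _ _ _ _ _ _ _ _ u_solution i).
have C0 : 0 <= \sum_i M i * M i * vol Om.
  by apply: sumr_ge0 => i _; rewrite !mulr_ge0 ?vol_ge0//; case: (hM i).
exists (\sum_i M i * M i * vol Om); split => // i t tT.
apply: (@le_trans _ _ (M i * M i * vol Om)); last first.
  rewrite (bigD1 i)//= lerDl sumr_ge0// => k _.
  by rewrite !mulr_ge0 ?vol_ge0//; case: (hM k).
rewrite -(IO_cst Om_domain); have [M0 {}hM] := hM i.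
have tT' : 0 <= t < T.
  move: tT => /andP[-> tT] /=; rewrite (le_lt_trans tT)// ltr_pdivrMr// ltr_pMr// ltr1n.
  by [].
apply: le_IO; last 1 first.
- move=> x Ox; have := hM x t (subset_closure Ox) tT; rewrite /ui/= !divr1 => h.
  rewrite ler_pM// ?ln1D_ge0//; exact: le_trans (ln1D_le _) h.
- apply: BM_closure => //; apply: within_slnC => //.
  exact: within_coord (slice_u_continuous0 u_solution tT').
- exact: BO_cst.
Qed.


Section late.
Variables (a b : R).
Hypotheses (a0 : 0 < a) (ab : a < b) (bT : b < T).

Let in_time t : a <= t <= b -> 0 < t < T.
Proof. by move=> /andP[t1 t2]; rewrite (lt_le_trans a0 t1) (le_lt_trans t2 bT). Qed.

Let sub_cyl : cylab Om a b `<=` cyl.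
Proof. by move=> [x t] [cx /=]; rewrite in_itv/= => /in_time. Qed.

Let bound (g : V * R -> R) : {within cyl, continuous g} ->
  exists M, 0 <= M /\ forall x t, closure Om x -> a <= t <= b -> `|g (x, t)| <= M.
Proof. by move=> cg; exact: bounded_cyl cg sub_cyl. Qed.

Lemma family_bound (I : finType) (g : I -> V * R -> R) :
  (forall i, {within cyl, continuous (g i)}) ->
  exists M, 0 <= M /\ forall i x t, Om x -> a <= t <= b -> `|g i (x, t)| <= M.
Proof.
move=> cg; have /choice[M hM] := fun i => bound (cg i).
exists (\sum_i M i); split; first by apply: sumr_ge0 => i _; case: (hM i).
move=> i x t Ox tab; have [_ h] := hM i.
apply: (le_trans (h x t (subset_closure Ox) tab)).
by rewrite (bigD1 i)//= lerDl sumr_ge0// => k _; case: (hM k).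
Qed.

Let green t phi dphi i : a <= t <= b -> C1cl Om phi dphi ->
  BO Om (fun x => phi x * LwG i (x, t)) /\
  IO Om (fun x => phi x * LwG i (x, t)) = - IO Om (fun x => \sum_j dphi j x * DwvG i j (x, t)).
Proof.
move=> tab Cphi.
exact: (green_solution Om_domain u_solution DtD DXC DXD DXXC DXXD oU orthU smG Gd i (in_time tab) Cphi).
Qed.

Let DwvC i j t : a <= t <= b -> {within closure Om, continuous (fun x => DwvG i j (x, t))}.
Proof. by move=> tab; exact: (slice_continuous (in_time tab) (@Dwv_cont i j)). Qed.

Let C1w i t : a <= t <= b -> C1cl Om (fun x => wvG i (x, t)) (fun j x => DwvG i j (x, t)).
Proof. by move=> tab; exact: (C1cl_wv u_solution DXC DXD oU orthU smG i (in_time tab)). Qed.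

Let uC i t : a <= t <= b -> C1cl Om (fun x => ui i (x, t)) (fun j x => DX i j (x, t)).
Proof. by move=> tab; exact: (C1cl_u u_solution DXC DXD i (in_time tab)). Qed.

Let wC t : a <= t <= b -> {within closure Om, continuous (fun x => w (x, t))}.
Proof.
move=> tab; apply: (within_sum (f := fun i x => tau i * ui i (x, t))) => i.
by apply: withinM; [exact: within_cst|case: (uC i tab)].
Qed.

Let zC t : a <= t <= b -> C1cl Om (fun x => z (x, t)) (fun j x => Dz j (x, t)).
Proof. by move=> tab; exact: (C1cl_sum (index_enum 'I_N) (fun i => C1w i tab)). Qed.

Let green_z t phi dphi : a <= t <= b -> C1cl Om phi dphi ->
  BO Om (fun x => phi x * Lz (x, t)) /\
  IO Om (fun x => phi x * Lz (x, t)) = - IO Om (fun x => \sum_j dphi j x * Dz j (x, t)).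
Proof.
move=> tab Cphi; have g i := green i tab Cphi.
have E : (fun x => phi x * Lz (x, t)) = (fun x => \sum_i phi x * LwG i (x, t)).
  by apply/funext => x; rewrite mulr_sumr.
rewrite E; split; first by apply: BO_sum => i; case: (g i).
rewrite IO_sum; last by move=> i; case: (g i).
have B i : BO Om (fun x => \sum_j dphi j x * DwvG i j (x, t)).
  apply: BM_closure => //; apply: (within_sum (f := fun j x => dphi j x * DwvG i j (x, t))) => j.
  by apply: withinM; [case: Cphi|exact: DwvC].
transitivity (\sum_i - IO Om (fun x => \sum_j dphi j x * DwvG i j (x, t))).
  by apply: eq_bigr => i _; case: (g i).
rewrite sumrN -IO_sum//; congr (- _); apply: eq_IO => x _.
by rewrite exchange_big/=; apply: eq_bigr => j _; rewrite mulr_sumr.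
Qed.

Let wt_le x t : Om x -> a <= t <= b -> wt (x, t) <= Lz (x, t).
Proof.
move=> Ox tab; rewrite /wt /Lz /Lw sumrB lerBrDr gerDl.
by apply: f_mass; exact: (solution_orthant u_solution (subset_closure Ox) (in_time tab)).
Qed.

Let u_inc i de : 0 < de -> exists2 eta, 0 < eta & forall x t t', Om x ->
    a <= t <= b -> a <= t' <= b -> `|t' - t| <= eta ->
    `|ui i (x, t') - ui i (x, t) - (t' - t) * Dt i (x, t)| <= de * `|t' - t|.
Proof.
move=> de0; apply: (@time_increment _ _ Om Om_domain a b (fun x t => u x t 0 i)) => //.
  exact: continuous_subspaceW sub_cyl (@DtC i).
by move=> x t Ox tab; apply: DtD => //; exact: in_time.
Qed.

Let w_inc : exists2 eta, 0 < eta & forall x t t', Om x ->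
    a <= t <= b -> a <= t' <= b -> `|t' - t| <= eta ->
    `|w (x, t') - w (x, t) - (t' - t) * wt (x, t)| <= 1 * `|t' - t|.
Proof.
apply: (@time_increment _ _ Om Om_domain a b (fun x t => w (x, t))) => //.
  apply: (within_sum (f := fun i p => tau i * Dt i p)) => i.
  by apply: withinM; [exact: within_cst|exact: continuous_subspaceW sub_cyl (@DtC i)].
move=> x t Ox tab; rewrite /w /ui /wt/=.
have h i : is_derive t (1 : R) (fun s => tau i * u x s 0 i) (tau i * Dt i (x, t)).
  by apply: is_deriveZ; apply: DtD => //; exact: in_time.
have -> : (fun s => \sum_i tau i * u x s 0 i) = \sum_i (fun s => tau i * u x s 0 i).
  by apply/funext => s; rewrite fct_sumE.
exact: is_derive_sum.
Qed.


Let u_in_time i x : Om x -> {within `[a, b], continuous (fun t => ui i (x, t))}.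
Proof.
move=> Ox; apply: derivable_within_continuous => t; rewrite in_itv/= => tab.
by case: (DtD i Ox (in_time tab)).
Qed.

Let wzC t : a <= t <= b -> {within closure Om, continuous (fun x => w (x, t) * z (x, t))}.
Proof. by move=> tab; apply: withinM; [exact: wC|case: (zC tab)]. Qed.

Let CR := 2 * N%:R * Cf * (1 + IT / delta).
Variables (M0 : R) (M00 : 0 <= M0) (ui_a : forall i x, Om x -> ui i (x, a) <= M0).
Let S := \sum_i tau i.

(** [entropy_grid] and [L2_grid] on a common grid of [[a, b]]: the sum that
appears in the first is estimated by the second.  The bound involves [T] but
neither [b] nor the bounds [MD], [MG], [MU] of the derivatives on
[[a, b]]. *)
Lemma late_step i : IO Om (fun x => `|u x b 0 i| / 1 * ln (1 + `|u x b 0 i| / 1)) <=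
  IT * (S * ((M0 + 1) * M0 * vol Om) + T * (1 + vol Om + CR * vol Om) +
   CR * (2 * T * (Cd * IT) * (M1 T (S * M0)) ^+ 2 * vol Om + 1) +
   M1 T (S * M0) * vol Om + 2 * (S * vol Om)).
Proof.
have IT0 : 0 <= IT by rewrite (le_trans ler01 IT_ge1).
have CR0 : 0 <= CR by rewrite /CR !mulr_ge0 ?(ltW Cf_gt0)// addr_ge0// divr_ge0// ltW.
have S0 : 0 <= S by apply: sumr_ge0 => k _; exact: ltW.
have abT : b - a <= T by rewrite lerBlDr (le_trans (ltW bT))// lerDl ltW.
have cl x : Om x -> closure Om x by exact: subset_closure.
have [MD [MD0 hMD]] : exists M, 0 <= M /\ forall (p : 'I_N * 'I_n) x t, Om x -> a <= t <= b ->
    `|DX p.1 p.2 (x, t)| <= M by apply: (family_bound (g := fun (p : 'I_N * 'I_n) => DX p.1 p.2)) => p; exact: DXC.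
have [MW [MW0 hMW]] : exists M, 0 <= M /\ forall j x t, Om x -> a <= t <= b ->
    `|Dz j (x, t)| <= M.
  apply: (family_bound (g := Dz)) => j; apply: (within_sum (f := fun i p => DwvG i j p)) => k; exact: Dwv_cont.
have [MG [MG0 hMG]] : exists M, 0 <= M /\ forall (p : 'I_N * 'I_N) x t, Om x -> a <= t <= b ->
    `|dG G p.1 p.2 (u x t)| <= M.
  by apply: (family_bound (g := fun p q => dG G p.1 p.2 (u q.1 q.2))) => p; exact: dG_cont.
have [MU hMU] : exists M, forall i x t, closure Om x -> a <= t <= b -> ui i (x, t) <= M.
  have /choice[M hM] := fun i => bound (@ui_cont i).
  exists (\sum_i M i) => k x t cx tab; have [_ h] := hM k.
  apply: (le_trans (ler_norm _)); apply: (le_trans (h x t cx tab)).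
  by rewrite (bigD1 k)//= lerDl sumr_ge0// => l _; case: (hM l).
have aab : a <= a <= b by rewrite lexx ltW.
have bab : a <= b <= b by rewrite lexx ltW.
have w_a x : Om x -> w (x, a) <= S * M0.
  move=> Ox; rewrite /S mulr_suml; apply: ler_sum => k _.
  by rewrite ler_wpM2l ?ui_a// ltW.
have [K1 K10 L2] := @L2_grid R n Om Om_domain w z wt Lz Dz a b T (S * M0) (Cd * IT) MW ab abT
  wC zC green_z wt_le w_inc
  (fun x t Ox tab => @z_ge0 x t (cl x Ox) (in_time tab))
  (fun x t Ox tab => @z_le x t (cl x Ox) (in_time tab))
  (mulr_ge0 (ltW Cd_gt0) IT0) (mulr_ge0 S0 M00) w_a hMW.
have [e [e0 e1 [K2 K20 ent]]] := @entropy_grid R n N Om Om_domain ui Dt LwG DX (gv u G)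
  (fun i k p => dG G i k (u p.1 p.2)) (fun p => w p * z p) tau a b MD MG MU CR ab tau_gt0 CR0 MD0 MG0
  uC (fun i x t cx tab => ui_ge0 cx (in_time tab) i)
  (fun i x t Ox tab => solution_positive u_solution i Ox (in_time tab))
  (fun i x Ox => @u_in_time i x Ox) hMU
  (fun i j x t => hMD (i, j) x t) (fun i k x t => hMG (i, k) x t)
  (fun x t zeta Ox tab => @psd_solution x t zeta Ox (in_time tab))
  (fun i t phi dphi tab => green i tab) DwvC u_inc
  (fun x t e Ox tab => @reaction_le x t (cl x Ox) (in_time tab) e) wzC
  (fun x t Ox tab => mulr_ge0 (@w_ge0 x t (cl x Ox) (in_time tab)) (@z_ge0 x t (cl x Ox) (in_time tab))).
pose K := (K1 + K2)%N.
have KK1 : (K1 <= K)%N by rewrite leq_addr.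
have K0 : (0 < K)%N by rewrite (leq_trans K10).
have [L2K massK] := L2 K KK1; have := ent K (leq_addl _ _) => {ent L2} entK.
have gK : grid a b K K = b.
  by rewrite /grid divfK; [rewrite addrC subrK|rewrite gt_eqF// ltr0n].
have := massK K (leqnn K); rewrite gK => {massK} mass.
have v0 : 0 <= vol Om by exact: vol_ge0.
have BP t k : a <= t <= b -> BO Om (fun x => Psi e (ui k (x, t))).
  move=> tab; apply: BM_closure => //.
  exact: (@Psi_continuous R n N Om ui DX a b uC (fun i x t cx tab => ui_ge0 cx (in_time tab) i) e t k e0 tab).
have Bu t k : a <= t <= b -> BO Om (fun x => ui k (x, t)).
  by move=> tab; apply: BM_closure => //; case: (uC k tab).
have ent_a : entropy Om ui tau e a <= S * ((M0 + 1) * M0 * vol Om).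
  rewrite /entropy /S mulr_suml; apply: ler_sum => k _; rewrite ler_wpM2l ?(ltW (tau_gt0 k))//.
  rewrite -(IO_cst Om_domain); apply: le_IO; [exact: BP|exact: BO_cst|move=> x Ox].
  have u0' := ui_ge0 (cl x Ox) (in_time aab) k; have u1 := @ui_a k x Ox.
  apply: (le_trans (Psi_upper e0 e1 u0')).
  by rewrite ler_pM// ?addr_ge0// lerD2r.
pose A k := IO Om (fun x => `|u x b 0 k| / 1 * ln (1 + `|u x b 0 k| / 1)).
have A0 k : 0 <= A k.
  by apply: IO_ge0 => x Ox; rewrite divr1 mulr_ge0// ln1D_ge0.
have A_le k : A k <= IO Om (fun x => Psi e (ui k (x, b))) + IO Om (fun x => ui k (x, b)) + 2 * vol Om.
  have B2 : BO Om (fun x => Psi e (ui k (x, b)) + ui k (x, b)) by apply: BO_D; [exact: BP|exact: Bu].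
  rewrite -(IO_cst Om_domain) -IO_D; [|exact: BP|exact: Bu].
  rewrite -IO_D//; last exact: BO_cst.
  apply: le_IO; last 1 first.
  - move=> x Ox; have u0' := ui_ge0 (cl x Ox) (in_time bab) k.
    by rewrite divr1 ger0_norm//; exact: Psi_lower.
  - apply: BM_closure => //; apply: within_slnC => //; first by case: (uC k bab).
  - by apply: BO_D => //; exact: BO_cst.
have sumA : \sum_k tau k * A k <=
    entropy Om ui tau e b + IO Om (fun x => w (x, b)) + 2 * (S * vol Om).
  have -> : IO Om (fun x => w (x, b)) = \sum_k tau k * IO Om (fun x => ui k (x, b)).
    rewrite /w IO_sum; first by apply: eq_bigr => k _; rewrite IO_Z//; exact: Bu.
    by move=> k; apply: BO_Z; exact: Bu.
  have -> : 2 * (S * vol Om) = \sum_k tau k * (2 * vol Om) by rewrite -mulr_suml -/S; ring.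
  rewrite /entropy -!big_split/=; apply: ler_sum => k _.
  by rewrite -!mulrDr ler_wpM2l// ltW.
apply: (@le_trans _ _ (IT * \sum_k tau k * A k)).
  apply: (@le_trans _ _ (IT * (tau i * A i))); first by rewrite -/(A i) mulrA ler_peMl ?IT_tau.
  rewrite ler_wpM2l// (bigD1 i)//= lerDl sumr_ge0// => k _.
  by rewrite mulr_ge0// ltW.
rewrite ler_wpM2l//; apply: (le_trans sumA).
have c1 : (b - a) * (1 + vol Om + CR * vol Om) <= T * (1 + vol Om + CR * vol Om).
  by rewrite ler_wpM2r// !addr_ge0// mulr_ge0.
have c2 := ler_wpM2l CR0 L2K.
rewrite lerD2r lerD//; move: entK ent_a c1 c2; set X := CR * (_ / _ * _); lra.
Qed.

End late.

Lemma late_bound : exists C, 0 <= C /\ forall i t, T / 2 < t < T ->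
  IO Om (fun x => `|u x t 0 i| / 1 * ln (1 + `|u x t 0 i| / 1)) <= C.
Proof.
have T20 : 0 < T / 2 by rewrite divr_gt0.
have T2T : T / 2 < T by rewrite ltr_pdivrMr// ltr_pMr// ltr1n.
have /choice[M hM] : forall i, exists M, 0 <= M /\ forall x, Om x -> ui i (x, T / 2) <= M.
  move=> i; have [] := @bounded_cyl (T / 2) (T / 2) cyl (ui i) (@ui_cont i).
    by move=> [x t] [cx /=]; rewrite in_itv/= => /andP[t1 t2]; split => //=; rewrite (lt_le_trans T20 t1) (le_lt_trans t2).
  move=> M [M0 h]; exists M; split => // x Ox.
  by apply: (le_trans (ler_norm _)); apply: h; [exact: subset_closure|rewrite lexx].
pose M0 := \sum_i M i.
have M00 : 0 <= M0 by apply: sumr_ge0 => i _; case: (hM i).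
have hM0 i x : Om x -> ui i (x, T / 2) <= M0.
  move=> Ox; apply: (le_trans ((hM i).2 x Ox)).
  by rewrite /M0 (bigD1 i)//= lerDl sumr_ge0// => k _; case: (hM k).
suff [C hC] : exists C, forall i t, T / 2 < t < T ->
    IO Om (fun x => `|u x t 0 i| / 1 * ln (1 + `|u x t 0 i| / 1)) <= C.
  by exists `|C|; split => // i t tT; exact: le_trans (hC i t tT) (ler_norm _).
eexists => i t /andP[t1 t2]; exact: (@late_step (T / 2) t T20 t1 t2 M0 M00 hM0 i).
Qed.

End apriori.

Theorem theorem1 (R : realType) (n N : nat) (n_gt0 : (0 < n)%N)
  (Om : set 'rV[R]_n) (Om_domain : smooth_bounded_domain Om)
  (tau : 'I_N -> R) (tau_gt0 : forall i, 0 < tau i)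
  (d : 'I_N -> 'rV[R]_N -> R)
  (d_smooth : forall i, smooth_on (@orthant R N) (d i))
  (d_ge : exists c0 : R, 0 < c0 /\ forall i u, orthant u -> c0 <= d i u)
  (P_psd : forall u : 'rV[R]_N, orthant u -> psd (P_matrix d u))
  (d_bounds : exists delta C : R, [/\ 0 < delta, 0 < C &
     forall i u, orthant u -> delta <= d i u <= C])
  (f : 'rV[R]_N -> 'rV[R]_N)
  (f_lipschitz : [locally [lipschitz f u | u in @orthant R N]])
  (f_quasi_positive : forall u i, orthant u ->
     0 <= f (\row_j (if j == i then 0 else u 0 j)) 0 i)
  (f_mass : forall u, orthant u -> \sum_(i < N) f u 0 i <= 0)
  (f_growth : exists C : R, 0 < C /\ forall u, orthant u ->
     euclidean_norm (f u) <= C * (1 + euclidean_norm u ^+ 2) /\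
     forall i l,
       is_derive_in (@orthant R N) u (basis_vec i) (fun v => f v 0 i) l ->
       - C * (1 + euclidean_norm u) <= l)
  (T : R) (T_gt0 : 0 < T)
  (u0 : 'I_N -> 'rV[R]_n -> R)
  (u0_regular : forall i, Ck_on (closure Om) 2 (u0 i))
  (u0_ge0 : forall i x, Om x -> 0 <= u0 i x)
  (u0_neq0 : exists i x, Om x /\ u0 i x != 0)
  (u : 'rV[R]_n -> R -> 'rV[R]_N)
  (u_solution : positive_classical_solution Om T tau d f u0 u) :
  exists C_T : R,
    (ereal_sup [set LlogL_norm_vec Om (u^~ t) | t in [set t : R | (0 <= t < T)%R]]
       <= C_T%:E)%E.
Proof.
have [delta [Cd [delta0 Cd0 dbd]]] := d_bounds.
have [Cf [Cf0 growth]] := f_growth.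
have [Dt [DX [DXX [[DtC DtD] DXC DXD DXXC DXXD]]]] := solution_derivatives Om_domain u_solution.
have /choice[UG hUG] : forall i, exists UG : set 'rV[R]_N * ('rV[R]_N -> R),
    [/\ open UG.1, @orthant R N `<=` UG.1, smooth UG.1 UG.2 & forall v, orthant v -> UG.2 v = d i v].
  by move=> i; have [U [G [? ? ? ?]]] := d_smooth i; exists (U, G).
have f_lower v i : orthant v -> - Cf * (1 + euclidean_norm v) * v 0 i <= f v 0 i.
  move=> ov; apply: reaction_lower => //.
  by move=> v' ov' l; have [_ h] := growth v' ov'; exact: h.
have [C1 [C10 early]] := early_bound Om_domain T_gt0 u_solution.
have [C2 [C20 late]] := @late_bound R n N Om Om_domain tau tau_gt0 d P_psd delta Cd delta0 Cd0 dbd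
  f f_mass Cf Cf0 f_lower T T_gt0 u0 u u_solution Dt DX DXX DtC DtD DXC DXD DXXC DXXD
  (fun i => (UG i).1) (fun i => (UG i).2)
  (fun i => let: And4 h _ _ _ := hUG i in h) (fun i => let: And4 _ h _ _ := hUG i in h)
  (fun i => let: And4 _ _ h _ := hUG i in h) (fun i => let: And4 _ _ _ h := hUG i in h).
pose C := C1 + C2; have C0 : 0 <= C by exact: addr_ge0.
exists (\sum_(i < N) (C + 1)); apply: ub_ereal_sup => _ [t /= tT <-].
rewrite /LlogL_norm_vec -sumEFin; apply: lee_sum => i _.
apply: LlogL_le => //.
  exact: within_coord (slice_u_continuous0 u_solution tT).
have /andP[t0 tT'] := tT; have [le|gt] := leP t (T / 2).
  by apply: (le_trans (early i t _)); rewrite ?t0// lerDl.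
by apply: (le_trans (late i t _)); rewrite ?gt// lerDr.
Qed.
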